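(* Let $p$ be a prime with $p \equiv 1 \pmod{12}$, let $b,c$ be positive integers with $p=b^{2}+bc+c^{2}$, let $m$ be an odd integer with $3\nmid m$, and let $\mathcal Q$ be a finite self-dual directly regular $4$-polytope of type $\{\{3,6\}_{(m,0)},\{6,3\}_{(m,0)}\}$ such that $p(p^{2}-1)$ does not divide $|\Gamma(\mathcal{Q})|$. Then there exists a properly self-dual chiral $4$-polytope, whose automorphism group is isomorphic to $L_{2}(p)\times \Gamma^{+}(\mathcal{Q})$, of type $\{\{3,6\}_{(m,0)},\{6,3\}_{(m,0)}\}$ if $p\mid m$, and of type $\{\{3,6\}_{(mb,mc)},\{6,3\}_{(mb,mc)}\}$ if $p\nmid m$.
   Context: An abstract $n$-polytope is a ranked poset (ranks $-1,\dots,n$) with a least and a greatest face, all flags of size $n+2$, strongly flag-connected, and satisfying the diamond condition; $\Gamma(\mathcal P)$ is its automorphism group. $\mathcal P$ is regular if $\Gamma(\mathcal P)$ is flag-transitive, and chiral if $\Gamma(\mathcal P)$ has exactly two flag orbits with adjacent flags always in distinct orbits. For regular $\mathcal P$, $\Gamma(\mathcal P)$ is generated by involutions $\rho_0,\dots,\rho_{n-1}$; the rotation subgroup $\Gamma^+(\mathcal P)$ is generated by $\sigma_i=\rho_{i-1}\rho_i$, has index at most $2$, and $\mathcal P$ is directly regular if the index is $2$. A polytope is of type $\{\mathcal P_1,\mathcal P_2\}$ if its facets are isomorphic to $\mathcal P_1$ and its vertex-figures to $\mathcal P_2$. A polytope is self-dual if it admits a duality (incidence-reversing bijection onto itself); a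 chiral polytope is properly self-dual if it admits a duality mapping each of the two flag orbits of $\Gamma(\mathcal P)$ onto itself. $\{6,3\}_{(b,c)}$ and $\{3,6\}_{(b,c)}$ denote the toroidal maps obtained from the hexagonal, respectively triangular, tessellation of the plane by factoring out the translation lattice generated by the vector $(b,c)$ (in the usual hexagonal-lattice coordinates) and its image under rotation by $60^\circ$ (the two maps are dual); they are regular if $bc=0$ or $b=c$ and chiral otherwise. $L_2(p)=PSL_2(p)$. *)

(* Defs.v *)
From HB Require Import structures.
From mathcomp Require Import all_boot all_order all_algebra all_fingroup.
From mathcomp Require Import center.

Set Implicit Arguments.
Unset Strict Implicit.
Unset Printing Implicit Defensive.

Import GRing.Theory.
Local Open Scope ring_scope.

Definition order_iso (S T : Type) (leS : S -> S -> Prop) (leT : T -> T -> Prop) : Prop :=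
  exists2 f : S -> T, bijective f & forall x y, leS x y <-> leT (f x) (f y).

Definition chain (d : Order.disp_t) (P : finPOrderType d) (A : {set P}) : bool :=
  [forall x in A, forall y in A, (x >=< y)%O].

Definition flag (d : Order.disp_t) (P : finPOrderType d) (A : {set P}) : bool :=
  maxset (@chain d P) A.

Definition adjacent (d : Order.disp_t) (P : finPOrderType d) (A B : {set P}) : bool :=
  [&& flag A, flag B, #|A :\: B| == 1%N & #|B :\: A| == 1%N].

Definition strongly_flag_connected (d : Order.disp_t) (P : finPOrderType d) : Prop :=
  forall A B : {set P}, flag A -> flag B ->
    connect [rel C D | [&& adjacent C D, A :&: B \subset C & A :&: B \subset D]] A B.

Record is_polytope (n : nat) (d : Order.disp_t) (P : finPOrderType d)
    (rank : P -> int) : Prop := IsPolytope {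
  polytope_rank_bounds : forall x, - 1 <= rank x <= n%:Z;
  polytope_rank_mono : forall x y, (x < y)%O -> rank x < rank y;
  polytope_least : exists x0 : P, forall x, (x0 <= x)%O;
  polytope_greatest : exists x1 : P, forall x, (x <= x1)%O;
  polytope_flag_size : forall A : {set P}, flag A -> #|A| = n.+2;
  polytope_connected : strongly_flag_connected P;
  polytope_diamond : forall x y : P, (x < y)%O -> rank y = rank x + 2%:Z ->
    #|[set z | (x < z < y)%O]| = 2%N
}.

(** Only finite polytopes are considered: a polytope with finite automorphism
    group and finitely many flag orbits is finite. *)
Record polytope (n : nat) : Type := Polytope {
  polytope_disp : Order.disp_t;
  face :> finPOrderType polytope_disp;
  rank : face -> int;
  polytopeP : is_polytope n rank
}.

Definition flags (n : nat) (P : polytope n) : {set {set P}} := [set A | flag A].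

Definition i_adjacent (n : nat) (P : polytope n) (i : nat) (A B : {set P}) : bool :=
  adjacent A B && [forall x in A :\: B, rank x == i%:Z].

Definition Gamma (n : nat) (P : polytope n) : {set {perm P}} :=
  [set g : {perm P} | [forall x, forall y, (g x <= g y)%O == (x <= y)%O]].

Lemma Gamma_group_set (n : nat) (P : polytope n) : group_set (Gamma P).
Proof.
apply/group_setP; split=> [|g h].
  by rewrite inE; apply/forallP=> x; apply/forallP=> y; rewrite !perm1.
rewrite !inE => /forallP hg /forallP hh.
apply/forallP=> x; apply/forallP=> y; rewrite !permM.
by rewrite (eqP (forallP (hh _) _)) (eqP (forallP (hg _) _)).
Qed.

Canonical Gamma_group (n : nat) (P : polytope n) : {group {perm P}} :=
  Group (Gamma_group_set P).

Definition flag_orbits (n : nat) (P : polytope n) : {set {set {set P}}} :=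
  orbit 'P^*%act (Gamma P) @: flags P.

Definition regular (n : nat) (P : polytope n) : Prop :=
  [transitive Gamma P, on flags P | 'P^*].

Definition chiral (n : nat) (P : polytope n) : Prop :=
  #|flag_orbits P| = 2%N /\
  forall A B : {set P}, adjacent A B -> B \notin orbit 'P^*%act (Gamma P) A.

(** For [P] regular and [A] a (base) flag, [rho A i] with [i < n] is the unique
    automorphism taking [A] to its [i]-adjacent flag. *)
Definition rho (n : nat) (P : polytope n) (A : {set P}) (i : nat) : {perm P} :=
  odflt 1%g [pick g in Gamma P | i_adjacent i A (g @: A)].

Definition Gamma_plus (n : nat) (P : polytope n) (A : {set P}) : {set {perm P}} :=
  <<[set (rho A i * rho A i.+1)%g | i : 'I_n.-1]>>%g.

Canonical Gamma_plus_group (n : nat) (P : polytope n) (A : {set P}) :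
    {group {perm P}} :=
  Eval hnf in [group of Gamma_plus A].

Definition directly_regular (n : nat) (P : polytope n) (A : {set P}) : Prop :=
  regular P /\ #|Gamma P : Gamma_plus A|%g = 2%N.

Definition duality (n : nat) (P : polytope n) (delta : {perm P}) : Prop :=
  forall x y : P, (delta x <= delta y)%O = (y <= x)%O.

Definition self_dual (n : nat) (P : polytope n) : Prop :=
  exists delta : {perm P}, duality delta.

Definition properly_self_dual (n : nat) (P : polytope n) : Prop :=
  exists2 delta : {perm P}, duality delta &
    forall O, O \in flag_orbits P -> [set delta @: A | A : {set P} in O] = O.

Definition has_type (n : nat) (P : polytope n) (S T : Type)
    (leS : S -> S -> Prop) (leT : T -> T -> Prop) : Prop :=
  (forall F : P, rank F = n%:Z - 1 ->
     order_iso (fun x y : {x : P | (x <= F)%O} => (sval x <= sval y)%O) leS) /\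
  (forall v : P, rank v = 0 ->
     order_iso (fun x y : {x : P | (v <= x)%O} => (sval x <= sval y)%O) leT).

(** The pair [(x, y)] is the point [x + y w] of the triangular lattice, where
    [w] is the complex number of modulus 1 and argument 60 degrees; hence
    [w ^ 2 = w - 1]. *)
Definition point : Type := (int * int)%type.

Definition rot60 (v : point) : point := (- v.2, v.1 + v.2).

Definition unit_vec (k : nat) : point := iter k rot60 (1, 0).

(** Every edge and every triangle of the tessellation is listed exactly once:
    those based at the lattice point [v] are the edges from [v] in the
    directions [1, w, w ^ 2], and the two triangles at [v] between consecutive
    such directions. *)
Inductive tess_face : Type :=
  | TEmpty
  | TVertex of point
  | TEdge of point & 'I_3
  | TTriangle of point & 'I_2
  | TPlane.

(** [TPlane] is treated separately in [tri_le]. *)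
Definition corners (f : tess_face) : seq point :=
  match f with
  | TVertex v => [:: v]
  | TEdge v k => [:: v; v + unit_vec k]
  | TTriangle v k => [:: v; v + unit_vec k; v + unit_vec k.+1]
  | TEmpty | TPlane => [::]
  end.

Definition tri_le (f g : tess_face) : Prop :=
  match f, g with
  | _, TPlane => True
  | TPlane, _ => False
  | _, _ => {subset corners f <= corners g}
  end.

(** The hexagonal tessellation is the dual of the triangular one: its tiles are
    centred at the lattice points, so both have the same translations. *)
Definition hex_le (f g : tess_face) : Prop := tri_le g f.

Definition translate (t : point) (f : tess_face) : tess_face :=
  match f with
  | TVertex v => TVertex (v + t)
  | TEdge v k => TEdge (v + t) k
  | TTriangle v k => TTriangle (v + t) k
  | TEmpty => TEmpty
  | TPlane => TPlane
  end.

Definition in_lattice (u : point) (t : point) : Prop :=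
  exists r s : int, t = u *~ r + rot60 u *~ s.

Definition translation_orbit (u : point) (f : tess_face) : tess_face -> Prop :=
  fun g => exists2 t, in_lattice u t & g = translate t f.

Definition torus_face (u : point) : Type :=
  {A : tess_face -> Prop | exists f, A = translation_orbit u f}.

Definition torus_le (le : tess_face -> tess_face -> Prop) (u : point)
    (A B : torus_face u) : Prop :=
  exists f g, [/\ sval A f, sval B g & le f g].

(** [{3,6}_u] and [{6,3}_u]. *)
Definition map36 (u : point) := torus_le tri_le (u := u).
Definition map63 (u : point) := torus_le hex_le (u := u).

Definition SL2 (p : nat) : {set {'GL_2(p)}} :=
  [set g : {'GL_2(p)} | \det (GLval g) == 1].

Lemma SL2_group_set (p : nat) : group_set (SL2 p).
Proof.
apply/group_setP; split=> [|g h]; first by rewrite inE /= det1.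
by rewrite !inE GL_MxE det_mulmx => /eqP-> /eqP->; rewrite mulr1.
Qed.

Canonical SL2_group (p : nat) : {group {'GL_2(p)}} := Group (SL2_group_set p).

Definition PSL2 (p : nat) : {set coset_of 'Z(SL2 p)} := (SL2 p / 'Z(SL2 p))%g.

Canonical PSL2_group (p : nat) : {group coset_of 'Z(SL2 p)} :=
  Eval hnf in [group of PSL2 p].

(* Main.v *)
(** Both [Gamma_plus Phi] and [PSL2 p] are generated by three elements that
    satisfy the relations of the rotations of a self-dual 4-polytope with
    triangulated toroidal facets. In [PSL2 p] the translations of the facet are
    unipotent, and [w = - b / c], a primitive sixth root of unity modulo [p],
    acts on them as the rotation by 60 degrees; so the translation by [(x, y)]
    is trivial exactly when [p] divides [c x - b y], that is, when [(x, y)] is in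
    the lattice of [(b, c)]. By Goursat's lemma, since [PSL2 p] is simple and its
    order does not divide that of [Gamma_plus Phi], the pairs of corresponding
    generators generate the whole direct product. The cosets of the face
    stabilisers form a polytope, whose facets are the quotients of the
    tessellation by the translations trivial in both factors. If it were not
    chiral, the product would have an automorphism taking the translation by
    [(b, c)] to its mirror image, by [(- b - c, c)]. By simplicity that
    automorphism preserves the factor [Gamma_plus Phi], which contains the first
    translation but not the second. *)

Require Import Defs.
From HB Require Import structures.
From mathcomp Require Import all_boot all_order all_algebra all_fingroup.
From mathcomp Require Import center cyclic gseries finfield boolp zify ring.

Set Implicit Arguments.
Unset Strict Implicit.
Unset Printing Implicit Defensive.

Import Order.TTheory GRing.Theory Num.Theory.
Local Open Scope ring_scope.

(** * Flags and automorphisms of polytopes *)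

Section ImsetPerm.
Variable T : finType.
Implicit Types (g h : {perm T}) (A : {set T}).

Lemma imset_permM g h A : (g * h)%g @: A = h @: (g @: A).
Proof. by rewrite -imset_comp; apply: eq_imset => x; rewrite permM. Qed.

Lemma imset_perm1 A : (1%g : {perm T}) @: A = A.
Proof. by rewrite -[RHS]imset_id; apply: eq_imset => x; rewrite perm1. Qed.

End ImsetPerm.

Section RankedPoset.
Variables (d : Order.disp_t) (P : finPOrderType d).
Implicit Types (A B : {set P}) (x y z : P).

Lemma chainP A : reflect {in A &, forall x y, (x >=< y)%O} (chain A).
Proof.
apply: (iffP forall_inP) => [cA x y xA yA|cA x xA].
  exact: (forall_inP (cA x xA)).
by apply/forall_inP=> y yA; apply: cA.
Qed.

Lemma chain_subset A B : B \subset A -> chain A -> chain B.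
Proof.
by move=> /subsetP BA /chainP cA; apply/chainP=> x y /BA xA /BA; apply: cA.
Qed.

Lemma chain_setU1 A x :
  chain A -> {in A, forall y, (x >=< y)%O} -> chain (x |: A).
Proof.
move=> /chainP cA xA; apply/chainP=> y z.
case/setU1P=> [->|yA]; case/setU1P=> [->|zA]; rewrite ?comparablexx ?xA //.
  by rewrite comparable_sym xA.
exact: cA.
Qed.

Lemma flag_chain A : flag A -> chain A.
Proof. exact: maxsetp. Qed.

Lemma chain_extends A : chain A -> exists2 B, flag B & A \subset B.
Proof. by case/maxset_exists=> B ? ?; exists B. Qed.

Lemma face_in_flag x : exists2 A, flag A & x \in A.
Proof.
have cx : chain [set x].
  by apply/chainP=> y z /set1P-> /set1P->; rewrite comparablexx.
by have [A fA] := chain_extends cx; rewrite sub1set => xA; exists A.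
Qed.

Lemma flag_absorb A x : flag A -> {in A, forall y, (x >=< y)%O} -> x \in A.
Proof.
move=> fA xA; suff <- : x |: A = A by rewrite !inE eqxx.
have /maxsetP[cA maxA] := fA; apply: maxA; last exact: subsetUr.
exact: chain_setU1.
Qed.

Lemma imset_chain (g : {perm P}) A :
  (forall x y, (g x >=< g y)%O = (x >=< y)%O) -> chain (g @: A) = chain A.
Proof.
move=> gE; apply/chainP/chainP=> cA.
  by move=> x y xA yA; rewrite -gE; apply: cA; apply: imset_f.
by move=> _ _ /imsetP[x xA ->] /imsetP[y yA ->]; rewrite gE; apply: cA.
Qed.

Variable rk : P -> int.
Hypothesis rk_mono : {homo rk : x y / (x < y)%O >-> x < y}.

Lemma chain_lt A x y : chain A -> x \in A -> y \in A ->
  (x < y)%O = (rk x < rk y).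
Proof.
move=> /chainP cA xA yA; have /orP := cA x y xA yA.
rewrite !le_eqVlt => -[/orP[/eqP->|xy]|/orP[/eqP->|yx]]; rewrite ?ltxx //.
  by rewrite xy (rk_mono xy).
by rewrite lt_gtF //; apply/esym/negbTE; rewrite -leNgt ltW ?rk_mono.
Qed.

Lemma chain_rank_inj A : chain A -> {in A &, injective rk}.
Proof.
move=> cA x y xA yA eqr; have /chainP/(_ x y xA yA) := cA.
by rewrite /Order.comparable !le_eqVlt !(chain_lt cA) // eqr ltxx !orbF
  => /orP[] /eqP.
Qed.

Variable N : nat.
Hypothesis card_flag : forall A, flag A -> #|A| = N.

Lemma card_chain_flag A : chain A -> #|A| = N -> flag A.
Proof.
move=> cA sA; have [B fB sAB] := chain_extends cA.
suff -> : A = B by [].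
by apply/eqP; rewrite eqEcard sAB sA card_flag ?leqnn.
Qed.

Lemma subset_flag_eq A B : flag A -> flag B -> A \subset B -> A = B.
Proof. by move=> fA fB sAB; apply/eqP; rewrite eqEcard sAB !card_flag ?leqnn. Qed.

Lemma flag_exchange A x y : flag A -> x \in A -> y \notin A ->
  {in A :\ x, forall z, (y >=< z)%O} -> flag (y |: A :\ x).
Proof.
move=> fA xA yA yc; apply: card_chain_flag.
  exact: (chain_setU1 (chain_subset (subD1set A x) (flag_chain fA)) yc).
have := card_flag fA; rewrite (cardsD1 x) xA cardsU1 !inE.
by rewrite (negPf yA) andbF.
Qed.

Lemma adjacent_off_rank A B i : flag A -> flag B -> A <> B ->
  {in A, forall x, rk x <> i -> x \in B} -> adjacent A B.
Proof.
move=> fA fB neq AB; have eqc : #|A :\: B| = #|B :\: A|.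
  apply/eqP; rewrite -(eqn_add2l #|A :&: B|) cardsID setIC cardsID.
  by rewrite !card_flag.
rewrite /adjacent fA fB -eqc andbb /= eqn_leq card_gt0 setD_eq0.
apply/andP; split; last first.
  by apply: contra_notN neq => sAB; apply: subset_flag_eq.
have rkD x : x \in A :\: B -> rk x = i.
  by case/setDP=> xA xB; apply: contraNeq xB => /eqP; apply: AB.
apply/card_le1_eqP => x y xD yD; have [[xA _] [yA _]] := (setDP xD, setDP yD).
by apply: (chain_rank_inj (flag_chain fA)); rewrite ?rkD.
Qed.

End RankedPoset.

Section Polytope.
Variables (n : nat) (P : polytope n).
Implicit Types (A B C : {set P}) (x y z : P).

Let P_polytope : is_polytope n (@rank n P) := polytopeP P.

Let rank_mono : {homo @rank n P : x y / (x < y)%O >-> x < y}.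
Proof. exact: polytope_rank_mono P_polytope. Qed.

Lemma flag_lt A x y : flag A -> x \in A -> y \in A ->
  (x < y)%O = (rank x < rank y).
Proof. by move/flag_chain; apply: (chain_lt rank_mono). Qed.

Lemma flag_le A x y : flag A -> x \in A -> y \in A ->
  (x <= y)%O = (rank x <= rank y).
Proof.
move=> fA xA yA; have /chainP cA := flag_chain fA.
by rewrite leNgt -(flag_lt fA) // comparable_leNgt ?cA.
Qed.

Lemma flag_rank_inj A : flag A -> {in A &, injective (@rank n P)}.
Proof. by move/flag_chain; apply: (chain_rank_inj rank_mono). Qed.

Lemma flag_sub_eq A B : flag A -> flag B -> A \subset B -> A = B.
Proof. exact: (subset_flag_eq (polytope_flag_size P_polytope)). Qed.

Lemma chain_flag A : chain A -> #|A| = n.+2 -> flag A.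
Proof. exact: (card_chain_flag (polytope_flag_size P_polytope)). Qed.

Lemma flag_face A (i : int) : flag A -> -1 <= i <= n%:Z ->
  exists2 x, x \in A & rank x = i.
Proof.
move=> fA ibounds; pose index (j : int) : 'I_n.+2 := inord `|j + 1|.
have indexK j : -1 <= j <= n%:Z -> (index j : nat)%:Z - 1 = j.
  by move=> ?; rewrite inordK; lia.
have index_inj : {in A &, injective (index \o @rank n P)}.
  move=> x y xA yA /(congr1 (fun j : 'I_n.+2 => (j : nat)%:Z - 1)) /=.
  rewrite !indexK ?(polytope_rank_bounds P_polytope) //; exact: (flag_rank_inj fA).
have index_onto : (index \o @rank n P) @: A = setT.
  apply/eqP; rewrite eqEcard subsetT cardsT card_ord card_in_imset //.
  by rewrite (polytope_flag_size P_polytope) ?leqnn.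
have : index i \in setT by [].
rewrite -index_onto => /imsetP[x xA ri]; exists x => //.
by rewrite -[RHS]indexK // ri indexK ?(polytope_rank_bounds P_polytope).
Qed.

Lemma least_of_rank x y : rank x = -1 -> (x <= y)%O.
Proof.
have [x0 x0P] := polytope_least P_polytope; move=> rx; suff <- : x0 = x by [].
apply/eqP/contraT => ne; have : (x0 < x)%O by rewrite lt_neqAle ne x0P.
move/rank_mono; have := polytope_rank_bounds P_polytope x0.
by rewrite rx; lia.
Qed.

Lemma greatest_of_rank x y : rank x = n%:Z -> (y <= x)%O.
Proof.
have [x1 x1P] := polytope_greatest P_polytope; move=> rx; suff -> : x = x1 by [].
apply/eqP/contraT => ne; have : (x < x1)%O by rewrite lt_neqAle ne x1P.
move/rank_mono; have := polytope_rank_bounds P_polytope x1.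
by rewrite rx; lia.
Qed.

Lemma lower_cover x : -1 < rank x -> exists2 y, (y < x)%O & rank y = rank x - 1.
Proof.
move=> rx; have [A fA xA] := face_in_flag x.
have rb := polytope_rank_bounds P_polytope x.
have [|y yA ry] := @flag_face A (rank x - 1) fA; first by lia.
by exists y => //; rewrite (flag_lt fA) // ry; lia.
Qed.

Lemma upper_cover x : rank x < n%:Z -> exists2 y, (x < y)%O & rank y = rank x + 1.
Proof.
move=> rx; have [A fA xA] := face_in_flag x.
have rb := polytope_rank_bounds P_polytope x.
have [|y yA ry] := @flag_face A (rank x + 1) fA; first by lia.
by exists y => //; rewrite (flag_lt fA) // ry; lia.
Qed.

Lemma rank_le_homo (f : P -> int) x : {homo f : y z / (y < z)%O >-> y < z} ->
  (forall y, -1 <= f y) -> rank x <= f x.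
Proof.
move=> f_mono f_ge; have [k] := ubnP (absz (rank x + 1)).
elim: k x => // k IH x rk.
have [rx0 _] := andP (polytope_rank_bounds P_polytope x).
have [rx|rx] := eqVneq (rank x) (-1); first by rewrite rx f_ge.
have [|y yx ry] := @lower_cover x; first by lia.
by have := IH y; have := f_mono _ _ yx; rewrite ry; lia.
Qed.

Lemma homo_le_rank (f : P -> int) x : {homo f : y z / (y < z)%O >-> y < z} ->
  (forall y, f y <= n%:Z) -> f x <= rank x.
Proof.
move=> f_mono f_le; have [k] := ubnP (absz (n%:Z - rank x)).
elim: k x => // k IH x rk.
have [_ rx0] := andP (polytope_rank_bounds P_polytope x).
have [rx|rx] := eqVneq (rank x) n%:Z; first by rewrite rx f_le.
have [|y xy ry] := @upper_cover x; first by lia.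
by have := IH y; have := f_mono _ _ xy; rewrite ry; lia.
Qed.

Lemma i_adjacentP (i : nat) A B : flag A -> flag B ->
  reflect (A <> B /\ {in A, forall x, rank x <> i%:Z -> x \in B})
          (i_adjacent i A B).
Proof.
move=> fA fB; apply: (iffP andP) => [[adj /forall_inP rD]|[neq AB]].
  split=> [eqAB|x xA rx].
    by case/and4P: adj => _ _; rewrite eqAB setDv cards0.
  by apply: contraT=> xB; case: rx; apply/eqP/rD; rewrite inE xB.
split; last first.
  apply/forall_inP=> x /setDP[xA xB]; apply: contraNT xB => /eqP.
  exact: AB.
exact: (adjacent_off_rank rank_mono (polytope_flag_size P_polytope) fA fB neq AB).
Qed.

Lemma i_adjacent_flag i A B : i_adjacent i A B -> flag A /\ flag B.
Proof. by case/andP=> /and4P[]. Qed.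

Lemma i_adjacent_mem i A B x :
  i_adjacent i A B -> x \in A -> rank x <> i%:Z -> x \in B.
Proof.
move=> ab; have [fA fB] := i_adjacent_flag ab.
by have /(i_adjacentP _ fA fB)[_] := ab; apply.
Qed.

Lemma i_adjacent_sym i A B : i_adjacent i A B -> i_adjacent i B A.
Proof.
move=> ab; have [fA fB] := i_adjacent_flag ab.
have /(i_adjacentP _ fA fB)[neq _] := ab.
apply/i_adjacentP => //; split=> [/esym//|x xB rx].
have [y yA ry] := flag_face fA (polytope_rank_bounds P_polytope x).
rewrite (flag_rank_inj fB xB _ (esym ry)) //.
by apply: (i_adjacent_mem ab); rewrite ?ry.
Qed.

Lemma i_adjacent_notin i A B x :
  i_adjacent i A B -> x \in A -> rank x = i%:Z -> x \notin B.
Proof.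
move=> ab xA rx; have [fA fB] := i_adjacent_flag ab.
have /(i_adjacentP _ fA fB)[neq _] := ab.
apply: contra_notN neq => xB; apply: flag_sub_eq => //.
apply/subsetP=> y yA; have [ry|/eqP] := eqVneq (rank y) i%:Z.
  by rewrite (flag_rank_inj fA yA xA) // rx.
exact: (i_adjacent_mem ab).
Qed.

Lemma flag_face_nat A i : (i < n)%N -> flag A -> exists2 x, x \in A & rank x = i%:Z.
Proof. by move=> lt_in fA; apply: flag_face => //; lia. Qed.

Lemma flag_neighbours A i : (i < n)%N -> flag A -> exists x y,
  [/\ x \in A, y \in A, rank x = i%:Z - 1, rank y = i%:Z + 1 & rank y = rank x + 2].
Proof.
move=> lt_in fA; have [|x xA rx] := @flag_face A (i%:Z - 1) fA; first by lia.
have [|y yA ry] := @flag_face A (i%:Z + 1) fA; first by lia.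
by exists x, y; split=> //; rewrite rx ry; lia.
Qed.

Lemma flag_between A i x y z : flag A -> x \in A -> y \in A -> z \in A ->
  rank x = i - 1 -> rank y = i + 1 -> rank z = i -> (x < z < y)%O.
Proof.
by move=> fA xA yA zA rx ry rz; rewrite !(flag_lt fA) // rx ry rz; clear; lia.
Qed.

Lemma diamond_unique x y a b c : (x < a < y)%O -> (x < b < y)%O ->
  (x < c < y)%O -> rank y = rank x + 2%:Z -> a <> b -> a <> c -> b = c.
Proof.
move=> xay xby xcy ry /eqP ab /eqP ac.
have /andP[xa ay] := xay; have xy := lt_trans xa ay.
have /eqP := polytope_diamond P_polytope xy ry; set S := [set z | _].
rewrite (cardsD1 a) inE xay add1n eqSS => /cards1P[z Sz].
have bS : b \in S :\ a by rewrite !inE eq_sym ab xby.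
have cS : c \in S :\ a by rewrite !inE eq_sym ac xcy.
by move: bS cS; rewrite Sz !inE => /eqP-> /eqP->.
Qed.

Lemma diamond_opposite x y a : (x < a < y)%O -> rank y = rank x + 2%:Z ->
  exists2 b, (x < b < y)%O & b != a.
Proof.
move=> xay ry; have /andP[xa ay] := xay.
have /eqP := polytope_diamond P_polytope (lt_trans xa ay) ry.
rewrite (cardsD1 a) inE xay add1n eqSS => /cards1P[b Sb].
have : b \in [set b] by apply: set11.
by rewrite -Sb !inE => /andP[ba xby]; exists b.
Qed.

(* The face of rank [i] of a flag is determined, by the diamond condition, by
   the neighbouring faces up to one exchange. *)
Lemma i_adjacent_face i A B C c : (i < n)%N -> i_adjacent i A B -> flag C ->
  {in A, forall x, rank x = i%:Z - 1 \/ rank x = i%:Z + 1 -> x \in C} ->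
  c \in C -> rank c = i%:Z -> c \notin A -> c \in B.
Proof.
move=> lt_in ab fC AC cC rc cA; have [fA fB] := i_adjacent_flag ab.
have [x [y [xA yA rx ry rxy]]] := flag_neighbours lt_in fA.
have [[a aA ra] [b bB rb]] := (flag_face_nat lt_in fA, flag_face_nat lt_in fB).
have [xC yC] : x \in C /\ y \in C by split; apply: AC; tauto.
have [xB yB] : x \in B /\ y \in B.
  by split; apply: (i_adjacent_mem ab); rewrite ?rx ?ry //; clear; lia.
suff -> : c = b by [].
apply: (@diamond_unique x y a) => //; first exact: (flag_between fA xA yA aA rx ry).
- exact: (flag_between fC xC yC cC rx ry).
- exact: (flag_between fB xB yB bB rx ry).
- by move=> ac; rewrite -ac aA in cA.
- by move=> eab; have := i_adjacent_notin ab aA ra; rewrite eab bB.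
Qed.

Lemma i_adjacent_uniq i A B C : (i < n)%N ->
  i_adjacent i A B -> i_adjacent i A C -> B = C.
Proof.
move=> lt_in ab ac; have [[fA fB] [_ fC]] := (i_adjacent_flag ab, i_adjacent_flag ac).
apply/esym/flag_sub_eq => //; apply/subsetP=> z zC.
have [rz|/eqP rz] := eqVneq (rank z) i%:Z; last first.
  exact: (i_adjacent_mem ab (i_adjacent_mem (i_adjacent_sym ac) zC rz) rz).
apply: (i_adjacent_face lt_in ab fC _ zC rz) => [x xA rx|].
  by apply: (i_adjacent_mem ac xA); case: rx => ->; clear; lia.
exact: (i_adjacent_notin (i_adjacent_sym ac) zC rz).
Qed.

Lemma i_adjacent_exists i A : (i < n)%N -> flag A -> exists B, i_adjacent i A B.
Proof.
move=> lt_in fA; have [x [y [xA yA rx ry rxy]]] := flag_neighbours lt_in fA.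
have [a aA ra] := flag_face_nat lt_in fA.
have [b /andP[xb yb] ba] := diamond_opposite (flag_between fA xA yA aA rx ry ra) rxy.
have rb : rank b = i%:Z.
  by have := rank_mono xb; have := rank_mono yb; rewrite rx ry; clear; lia.
have bA : b \notin A.
  by apply: contra ba => bA; apply/eqP/(flag_rank_inj fA); rewrite ?ra.
have b_comparable : {in A :\ a, forall z, (b >=< z)%O}.
  move=> z /setD1P[za zA]; have rz : rank z <> i%:Z.
    by rewrite -ra => /(flag_rank_inj fA zA aA)/eqP; rewrite (negPf za).
  have [zi|iz] := ltP (rank z) i%:Z; apply/orP; [right|left].
    by rewrite (le_trans _ (ltW xb)) // (flag_le fA) // rx; clear -zi; lia.
  by rewrite (le_trans (ltW yb)) // (flag_le fA) // ry; clear -iz rz; lia.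
have fB := flag_exchange (polytope_flag_size P_polytope) fA aA bA b_comparable.
exists (b |: A :\ a); apply/i_adjacentP => //; split=> [eqAB|z zA rz].
  by move: bA; rewrite eqAB setU11.
by rewrite !inE zA andbT; apply/orP; right; apply: contra_notN rz => /eqP->.
Qed.

Lemma i_adjacent_comm i j A B C D E : (i < n)%N -> (j < n)%N ->
    (i.+1 < j)%N || (j.+1 < i)%N ->
    i_adjacent i A B -> i_adjacent j B C ->
    i_adjacent j A D -> i_adjacent i D E -> C = E.
Proof.
move=> lt_in lt_jn ij ab bc ad de; apply: (i_adjacent_uniq lt_in _ de).
have [[fA _] [_ fC]] := (i_adjacent_flag ab, i_adjacent_flag bc).
have [_ fD] := i_adjacent_flag ad.
have neq_ij : i%:Z <> j%:Z by clear -ij; lia.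
apply/i_adjacentP => //; split=> [eqDC|z zD rz].
  have [a aA ra] := flag_face_nat lt_in fA.
  have aC : a \in C by rewrite -eqDC; apply: (i_adjacent_mem ad aA); rewrite ra.
  have := i_adjacent_notin ab aA ra.
  by rewrite (i_adjacent_mem (i_adjacent_sym bc) aC) // ra.
have [rzj|/eqP rzj] := eqVneq (rank z) j%:Z; last first.
  apply: (i_adjacent_mem bc _ rzj); apply: (i_adjacent_mem ab _ rz).
  exact: (i_adjacent_mem (i_adjacent_sym ad) zD rzj).
apply: (i_adjacent_face lt_jn bc fD _ zD rzj) => [x xB rx|].
  have [rxi rxj] : rank x <> i%:Z /\ rank x <> j%:Z by clear -ij rx; lia.
  by apply: (i_adjacent_mem ad) rxj; apply: (i_adjacent_mem (i_adjacent_sym ab)).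
apply: contra (i_adjacent_notin (i_adjacent_sym ad) zD rzj) => zB.
exact: (i_adjacent_mem (i_adjacent_sym ab) zB rz).
Qed.

Lemma adjacent_rank A B : adjacent A B -> exists2 i, i_adjacent i A B & (i < n)%N.
Proof.
move=> ab; have /and4P[fA fB /cards1P[x xE] _] := ab.
have /setDP[xA xB] : x \in A :\: B by rewrite xE set11.
have rb := polytope_rank_bounds P_polytope x.
have r_neq i : (i = -1 \/ i = n%:Z) -> rank x <> i.
  move=> i_ext rx; case/negP: xB; apply: flag_absorb => // y _.
  apply/orP; case: i_ext => iE; rewrite iE in rx.
    by left; apply: least_of_rank.
  by right; apply: greatest_of_rank.
have := r_neq (-1) (or_introl erefl); have := r_neq n%:Z (or_intror erefl).
move=> r_neq_n r_neq_N1; exists `|rank x|%N; last by lia.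
rewrite /i_adjacent ab /=; apply/forall_inP=> y; rewrite xE => /set1P->.
by apply/eqP; lia.
Qed.

Lemma GammaP (g : {perm P}) :
  reflect (forall x y, (g x <= g y)%O = (x <= y)%O) (g \in Gamma P).
Proof.
rewrite inE; apply: (iffP forallP) => [gE x y|gE x].
  exact: (eqP (forallP (gE x) y)).
by apply/forallP=> y; apply/eqP.
Qed.

Lemma Gamma_lt g : g \in Gamma P -> {mono g : x y / (x < y)%O}.
Proof. by move=> /GammaP gE x y; rewrite !lt_neqAle gE (inj_eq perm_inj). Qed.

Lemma Gamma_rank g x : g \in Gamma P -> rank (g x) = rank x.
Proof.
move=> gG; have g_mono : {homo @rank n P \o g : y z / (y < z)%O >-> y < z}.
  by move=> y z yz; apply: rank_mono; rewrite Gamma_lt.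
have bounds y := andP (polytope_rank_bounds P_polytope (g y)).
by apply/le_anti; rewrite (homo_le_rank _ g_mono) ?(rank_le_homo _ g_mono) // => y;
  case: (bounds y).
Qed.

Lemma Gamma_flag g A : g \in Gamma P -> flag A -> flag (g @: A).
Proof.
move=> /GammaP gE fA; apply: chain_flag; last first.
  by rewrite (card_imset _ perm_inj) (polytope_flag_size P_polytope).
by rewrite imset_chain ?flag_chain // => x y; rewrite /Order.comparable !gE.
Qed.

Lemma Gamma_i_adjacent g i A B : g \in Gamma P ->
  i_adjacent i A B -> i_adjacent i (g @: A) (g @: B).
Proof.
move=> gG ab; have [fA fB] := i_adjacent_flag ab.
have /(i_adjacentP _ fA fB)[neq AB] := ab.
apply/i_adjacentP; rewrite ?Gamma_flag //; split=> [/(imset_inj perm_inj)//|].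
by move=> _ /imsetP[x xA ->]; rewrite Gamma_rank // => /(AB _ xA)/imset_f->.
Qed.

Lemma duality_lt (g : {perm P}) x y : duality g -> (g x < g y)%O = (y < x)%O.
Proof. by move=> gE; rewrite !lt_neqAle gE (inj_eq perm_inj) eq_sym. Qed.

Lemma duality_rank (g : {perm P}) x : duality g -> rank (g x) = n%:Z - 1 - rank x.
Proof.
move=> gE; pose f y : int := n%:Z - 1 - rank (g y).
have f_mono : {homo f : y z / (y < z)%O >-> y < z}.
  by move=> y z yz; rewrite ltrD2l ltrN2 rank_mono // duality_lt.
have bounds y := andP (polytope_rank_bounds P_polytope (g y)).
have [f_ge f_le] : (forall y, -1 <= f y) /\ (forall y, f y <= n%:Z).
  by split=> y; case: (bounds y); rewrite /f; lia.
have := homo_le_rank x f_mono f_le; have := rank_le_homo x f_mono f_ge.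
by rewrite /f; lia.
Qed.

Lemma duality_flag (g : {perm P}) A : duality g -> flag A -> flag (g @: A).
Proof.
move=> gE fA; apply: chain_flag; last first.
  by rewrite (card_imset _ perm_inj) (polytope_flag_size P_polytope).
by rewrite imset_chain ?flag_chain // => x y; rewrite /Order.comparable !gE orbC.
Qed.

Lemma duality_i_adjacent (g : {perm P}) i j A B : duality g ->
  (i + j).+1 = n -> i_adjacent i A B -> i_adjacent j (g @: A) (g @: B).
Proof.
move=> gE ij ab; have [fA fB] := i_adjacent_flag ab.
have /(i_adjacentP _ fA fB)[neq AB] := ab.
apply/i_adjacentP; rewrite ?duality_flag //; split=> [/(imset_inj perm_inj)//|].
move=> _ /imsetP[x xA ->]; rewrite duality_rank // => rx.
by apply/imset_f/AB => // rx'; apply: rx; rewrite rx'; lia.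
Qed.

(* Fixing one flag propagates to the adjacent flags, hence to all flags by
   connectedness. *)
Lemma Gamma_free g A : g \in Gamma P -> flag A -> g @: A = A -> g = 1%g.
Proof.
move=> gG fA gA.
have fix_adjacent C D : adjacent C D -> g @: C = C -> g @: D = D.
  move=> cd gC; have [i icd lt_in] := adjacent_rank cd.
  apply: (i_adjacent_uniq lt_in _ icd).
  by rewrite -[X in i_adjacent _ X _]gC; apply: Gamma_i_adjacent.
have fix_flag B : flag B -> g @: B = B.
  move=> fB; have /connectP[s sP ->] := polytope_connected P_polytope fA fB.
  have {sP} : path (@adjacent _ P) A s by apply: sub_path sP => C D /and3P[].
  by elim: s A gA {fA} => //= C s IH A0 gA0 /andP[/fix_adjacent/(_ gA0)/IH].
apply/permP=> x; rewrite perm1; have [B fB xB] := face_in_flag x.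
apply: (flag_rank_inj fB) => //; last exact: Gamma_rank.
by rewrite -(fix_flag B fB); apply: imset_f.
Qed.

Lemma Gamma_eq g h A : g \in Gamma P -> h \in Gamma P -> flag A ->
  g @: A = h @: A -> g = h.
Proof.
move=> gG hG fA gh; apply/eqP; rewrite eq_mulgV1; apply/eqP.
apply: (Gamma_free (A := A)) => //; first by rewrite groupM ?groupV.
by rewrite imset_permM gh -imset_permM mulgV imset_perm1.
Qed.

End Polytope.

Lemma Gamma_plus_sub (n : nat) (P : polytope n) (A : {set P}) :
  Gamma_plus A \subset Gamma P.
Proof.
have rhoG i : rho A i \in Gamma P.
  by rewrite /rho; case: pickP => [g /andP[]|_] //=; apply: group1.
by rewrite gen_subG; apply/subsetP=> _ /imsetP[i _ ->]; apply: groupM.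
Qed.

(** * Rotations of regular polytopes *)

Definition sigma (n : nat) (P : polytope n) (A : {set P}) (i : nat) : {perm P} :=
  (rho A i.-1 * rho A i)%g.

Lemma Gamma_plus_sigma (P : polytope 4) (A : {set P}) :
  Gamma_plus A = <<[set sigma A 1; sigma A 2; sigma A 3]>>%g.
Proof.
congr <<_>>%g; apply/setP=> g; rewrite !inE; apply/imsetP/idP.
  by case=> -[[|[|[|//]]] lt3] _ -> /=; rewrite eqxx ?orbT.
case/orP=> [/orP[]|] /eqP->.
- by exists (@Ordinal 3 0 isT).
- by exists (@Ordinal 3 1 isT).
- by exists (@Ordinal 3 2 isT).
Qed.

Section Regular.
Variables (n : nat) (Q : polytope n) (Phi : {set Q}).
Hypothesis Phi_flag : flag Phi.
Hypothesis Q_regular : regular Q.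
Local Notation r := (rho Phi).

Lemma regular_flag_trans (A B : {set Q}) : flag A -> flag B ->
  exists2 g, g \in Gamma Q & g @: A = B.
Proof.
move=> fA fB; have tr : [transitive Gamma Q, on flags Q | 'P^*] := Q_regular.
have [||g gG ->] := atransP2 tr (x := A) (y := B); rewrite ?inE //; exists g => //.
Qed.

Lemma rhoP i : (i < n)%N -> r i \in Gamma Q /\ i_adjacent i Phi (r i @: Phi).
Proof.
move=> lt_in; rewrite /rho; case: pickP => [g /andP[gG ag]|none] //=.
have [B adj] := i_adjacent_exists lt_in Phi_flag.
have [_ fB] := i_adjacent_flag adj.
have [g gG gB] := regular_flag_trans Phi_flag fB.
by have := none g; rewrite gG gB adj.
Qed.

Lemma rho_Gamma i : (i < n)%N -> r i \in Gamma Q.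
Proof. by case/rhoP. Qed.

Lemma rho_adjacent i g : (i < n)%N -> g \in Gamma Q ->
  i_adjacent i (g @: Phi) ((r i * g)%g @: Phi).
Proof.
move=> lt_in gG; rewrite imset_permM; apply: Gamma_i_adjacent => //.
by have [] := rhoP lt_in.
Qed.

Lemma rho_flagE i g A : (i < n)%N -> g \in Gamma Q -> i_adjacent i (g @: Phi) A ->
  (r i * g)%g @: Phi = A.
Proof.
by move=> lt_in gG; apply: (i_adjacent_uniq lt_in (rho_adjacent lt_in gG)).
Qed.

Lemma rho_mul_rho i : (i < n)%N -> (r i * r i)%g = 1%g.
Proof.
move=> lt_in; have rG := rho_Gamma lt_in.
apply: (Gamma_eq (A := Phi)); rewrite ?groupM ?group1 // imset_perm1.
by apply: rho_flagE => //; apply: i_adjacent_sym; have [] := rhoP lt_in.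
Qed.

Lemma rhoV i : (i < n)%N -> ((r i)^-1 = r i)%g.
Proof. by move=> lt_in; apply: (mulgI (r i)); rewrite mulgV rho_mul_rho. Qed.

Lemma rho_comm i j : (i < n)%N -> (j < n)%N -> (i.+1 < j)%N || (j.+1 < i)%N ->
  (r i * r j = r j * r i)%g.
Proof.
move=> lt_in lt_jn ij; have [riG adi] := rhoP lt_in; have [rjG adj] := rhoP lt_jn.
apply: (Gamma_eq (A := Phi)); rewrite ?groupM //.
have ji : (j.+1 < i)%N || (i.+1 < j)%N by rewrite orbC.
exact: (i_adjacent_comm lt_jn lt_in ji adj (rho_adjacent lt_in rjG)
  adi (rho_adjacent lt_jn riG)).
Qed.

Lemma rho_fix_face i x : (i < n)%N -> x \in Phi -> rank x <> i%:Z -> r i x = x.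
Proof.
move=> lt_in xPhi rx; have [rG ad] := rhoP lt_in; have [_ fR] := i_adjacent_flag ad.
apply: (flag_rank_inj fR); first exact: imset_f; last exact: Gamma_rank.
exact: (i_adjacent_mem ad).
Qed.

Lemma duality_fixing_flag : self_dual Q ->
  exists2 d : {perm Q}, duality d & d @: Phi = Phi.
Proof.
case=> d0 dd.
have [g gG gPhi] := regular_flag_trans (duality_flag dd Phi_flag) Phi_flag.
exists (d0 * g)%g; last by rewrite imset_permM.
by move=> x y; rewrite !permM (GammaP _ gG) dd.
Qed.

Lemma rho_duality (d : {perm Q}) i j : duality d -> d @: Phi = Phi -> (i + j).+1 = n ->
  (r i ^ d)%g = r j.
Proof.
move=> dd dPhi ij.
have lt_in : (i < n)%N by rewrite -ij ltnS leq_addr.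
have lt_jn : (j < n)%N by rewrite -ij ltnS leq_addl.
have [riG adi] := rhoP lt_in; have [rjG adj] := rhoP lt_jn.
have dV : d^-1%g @: Phi = Phi by rewrite -{1}dPhi -imset_permM mulgV imset_perm1.
apply: (Gamma_eq (A := Phi)) => //.
  apply/GammaP=> x y; rewrite conjgE !permM dd (GammaP _ riG).
  by rewrite -dd !permKV.
apply: (i_adjacent_uniq lt_jn _ adj).
rewrite conjgE !imset_permM dV -{1}dPhi.
exact: (duality_i_adjacent dd ij adi).
Qed.

Lemma sigma_duality (d : {perm Q}) i j : duality d -> d @: Phi = Phi ->
  (0 < i)%N -> (0 < j)%N -> (i + j)%N = n -> (sigma Phi i ^ d = (sigma Phi j)^-1)%g.
Proof.
case: i j => // i [//|j] dd dPhi _ _ ij; rewrite /sigma conjMg invMg !rhoV; try lia.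
by rewrite (rho_duality dd dPhi (j := j.+1)) ?(rho_duality dd dPhi (j := j)) //; lia.
Qed.

End Regular.

(** * The triangular tessellation and its toroidal quotients *)

Local Arguments unit_vec k : simpl never.

Section Tessellation.
Implicit Types (u v t : point) (k l : nat) (f g : tess_face).

Lemma addpE (a b c d : int) : (a, b) + (c, d) = (a + c, b + d) :> point.
Proof. by []. Qed.

Lemma mulpE (a b c : int) : (a, b) *~ c = (a * c, b * c) :> point.
Proof.
have mulnpE (n : nat) : (a, b) *+ n = (a * n%:Z, b * n%:Z) :> point.
  elim: n => [|n IH]; first by rewrite !mulr0.
  by rewrite mulrS IH addpE intS !mulrDr !mulr1.
by case: c => n; rewrite ?NegzE ?mulrNz -pmulrn mulnpE ?mulrN.
Qed.

Lemma iter_rot60D k u v :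
  iter k rot60 (u + v) = iter k rot60 u + iter k rot60 v.
Proof.
elim: k => //= k ->; case: (iter k _ u) (iter k _ v) => a b [c d].
by rewrite /rot60 /= !addpE /= opprD addrACA.
Qed.

Lemma iter_rot60_0 k : iter k rot60 0 = 0.
Proof. by elim: k => //= k ->. Qed.

Lemma iter_rot60N k v : iter k rot60 (- v) = - iter k rot60 v.
Proof.
by apply: (addrI (iter k rot60 v)); rewrite -iter_rot60D !subrr iter_rot60_0.
Qed.

Lemma unit_vecD6 k : unit_vec (k + 6) = unit_vec k.
Proof. by rewrite /unit_vec iterD; congr iter. Qed.

Lemma unit_vec_mod6 k : unit_vec (k %% 6) = unit_vec k.
Proof.
rewrite [in RHS](divn_eq k 6); elim: (k %/ 6)%N => // n IH.
by rewrite mulSn -addnA addnC unit_vecD6.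
Qed.

Lemma unit_vecD3 k : unit_vec (k + 3) = - unit_vec k.
Proof. by rewrite /unit_vec iterD -iter_rot60N. Qed.

Lemma eq_unit_vec k l : (unit_vec k == unit_vec l) = (k == l %[mod 6]).
Proof.
rewrite -unit_vec_mod6 -(unit_vec_mod6 l); apply/eqP/eqP => [|-> //].
have /mkseq_uniqP inj : uniq (mkseq unit_vec 6) by [].
by apply: inj; rewrite inE ltn_mod.
Qed.

Lemma unit_vec_neq0 k : unit_vec k != 0.
Proof.
by rewrite -unit_vec_mod6; have := ltn_pmod k (isT : (0 < 6)%N);
  case: (k %% 6)%N => [|[|[|[|[|[|]]]]]].
Qed.

(** The edge from [v] in direction [unit_vec k], and the triangle at [v] between
    the directions [unit_vec k] and [unit_vec k.+1]. *)
Definition tedge v k : tess_face :=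
  if (k %% 6 < 3)%N then TEdge v (inord (k %% 6))
  else TEdge (v + unit_vec k) (inord (k %% 6 - 3)).

Definition ttri v k : tess_face :=
  match (k %% 6)%N with
  | 0 => TTriangle v (inord 0)
  | 1 => TTriangle v (inord 1)
  | 2 => TTriangle (v + unit_vec 3) (inord 0)
  | 3 => TTriangle (v + unit_vec 4) (inord 1)
  | 4 => TTriangle (v + unit_vec 4) (inord 0)
  | _ => TTriangle (v + unit_vec 5) (inord 1)
  end.

(** Each flag of the tessellation is the flag [(v, k)] of [v], [tedge v k] and
    [ttri v k], or its mirror image in that edge; the faces are indexed by
    their rank plus one. *)
Definition tface (i : nat) v k : tess_face :=
  match i with
  | 0 => TEmpty
  | 1 => TVertex v
  | 2 => tedge v k
  | 3 => ttri v k
  | _ => TPlane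
  end.

Definition tess_index f : nat :=
  match f with
  | TEmpty => 0
  | TVertex _ => 1
  | TEdge _ _ => 2
  | TTriangle _ _ => 3
  | TPlane => 4
  end.

Lemma tface_mod6 i v k : tface i v (k %% 6) = tface i v k.
Proof.
by case: i => [|[|[|[|i]]]] //=; rewrite /tedge /ttri modn_mod ?unit_vec_mod6.
Qed.

Lemma eq_mod6_tface i v k l : k = l %[mod 6] -> tface i v k = tface i v l.
Proof. by move=> kl; rewrite -tface_mod6 kl tface_mod6. Qed.

Lemma tess_index_tface i v k : (i <= 4)%N -> tess_index (tface i v k) = i.
Proof.
case: i => [|[|[|[|[|//]]]]] //= _; first by rewrite /tedge; case: ifP.
by rewrite /ttri; case: (k %% 6)%N => [|[|[|[|[|]]]]].
Qed.

Lemma tedge_ord v (l : 'I_3) : TEdge v l = tedge v l.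
Proof.
by case: l => -[|[|[|//]]] lt3; rewrite /tedge /=; congr TEdge;
  apply: val_inj; rewrite /= inordK.
Qed.

Lemma ttri_ord v (l : 'I_2) : TTriangle v l = ttri v l.
Proof.
by case: l => -[|[|//]] lt2; rewrite /ttri /=; congr TTriangle;
  apply: val_inj; rewrite /= inordK.
Qed.

Lemma tess_index_le4 f : (tess_index f <= 4)%N.
Proof. by case: f. Qed.

Lemma tfaceP f : exists v k, f = tface (tess_index f) v k.
Proof.
case: f => [|v|v l|v l|].
- by exists 0, 0.
- by exists v, 0.
- by exists v, l; rewrite /= -tedge_ord.
- by exists v, l; rewrite /= -ttri_ord.
- by exists 0, 0.
Qed.

Lemma mod6_ind (Pr : nat -> Prop) : (forall k, Pr (k %% 6)%N -> Pr k) ->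
  Pr 0 -> Pr 1 -> Pr 2 -> Pr 3 -> Pr 4 -> Pr 5 -> forall k, Pr k.
Proof.
move=> Pr_mod6 P0 P1 P2 P3 P4 P5 k; apply: Pr_mod6.
by have := ltn_pmod k (isT : (0 < 6)%N); case: (k %% 6)%N => [|[|[|[|[|[|]]]]]].
Qed.

Lemma tface_mod6D i v k l : tface i v (k %% 6 + l) = tface i v (k + l).
Proof. by apply: eq_mod6_tface; rewrite modnDml. Qed.

Lemma tedgeD3 v k : tedge (v + unit_vec k) (k + 3) = tedge v k.
Proof.
elim/mod6_ind: k => [k||||||].
  by rewrite unit_vec_mod6 -!/(tface 2 _ _) tface_mod6D tface_mod6.
all: rewrite /tedge /= -?addrA //; congr (TEdge _ _).
all: by rewrite -[RHS]addr0; congr (_ + _).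
Qed.

Lemma ttriD2 v k : ttri (v + unit_vec k) (k + 2) = ttri v k.
Proof.
elim/mod6_ind: k => [k||||||].
  by rewrite unit_vec_mod6 -!/(tface 3 _ _) tface_mod6D tface_mod6.
all: rewrite /ttri /= -?addrA //; congr (TTriangle _ _).
all: by rewrite -[RHS]addr0; congr (_ + _).
Qed.

Lemma ttriD6 v k : ttri v (k + 6) = ttri v k.
Proof. by apply: (@eq_mod6_tface 3); rewrite modnDr. Qed.

Lemma ttriD4 v k : ttri (v + unit_vec k.+1) (k + 4) = ttri v k.
Proof.
have -> : v + unit_vec k.+1 = v + unit_vec k + unit_vec (k + 2).
  rewrite -addrA; congr (_ + _); elim/mod6_ind: k => // k.
  by rewrite -[in unit_vec (_ + 2)]unit_vec_mod6 modnDml unit_vec_mod6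
    -addn1 -[in unit_vec (_ + 1)]unit_vec_mod6 modnDml !unit_vec_mod6 addn1.
by rewrite -[(k + 4)%N]/(k + (2 + 2))%N addnA !ttriD2.
Qed.

Lemma ttriD3 v k : ttri (v + unit_vec k) (k + 3) = ttri v (k + 5).
Proof.
rewrite -(ttriD4 v (k + 5)) -addnS unit_vecD6; apply: (@eq_mod6_tface 3).
by clear; lia.
Qed.

Lemma corners_tedge v k : corners (tedge v k) =i [:: v; v + unit_vec k].
Proof.
move=> x; rewrite /tedge; case: ifP => k3 /=.
  by rewrite inordK // unit_vec_mod6.
rewrite inordK; last by have := ltn_pmod k (isT : (0 < 6)%N); lia.
have -> : unit_vec (k %% 6 - 3) = - unit_vec k.
  by apply: oppr_inj; rewrite opprK -unit_vecD3 subnK ?unit_vec_mod6 // leqNgt k3.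
by rewrite addrK !inE orbC.
Qed.

Lemma corners_ttri v k :
  corners (ttri v k) =i [:: v; v + unit_vec k; v + unit_vec k.+1].
Proof.
elim/mod6_ind: k => [k||||||].
  rewrite -[ttri v k]/(tface 3 v k) -tface_mod6 unit_vec_mod6 => E x.
  rewrite E -[in unit_vec (_ %% _).+1]unit_vec_mod6 -addn1 modnDml.
  by rewrite unit_vec_mod6 addn1.
all: case: v => a b [x y]; rewrite /ttri /= ?inordK // !inE !xpair_eqE /=.
all: by clear; lia.
Qed.

Lemma corner_tedge v k l : (v + unit_vec l \in corners (tedge v k)) = (l == k %[mod 6]).
Proof.
rewrite corners_tedge !inE -[X in _ == X]addr0 !(inj_eq (addrI v)) eq_unit_vec.
by rewrite (negPf (unit_vec_neq0 l)).
Qed.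

Lemma corner_ttri v k l : (v + unit_vec l \in corners (ttri v k)) =
  (l == k %[mod 6]) || (l == k.+1 %[mod 6]).
Proof.
rewrite corners_ttri !inE -[X in _ == X]addr0 !(inj_eq (addrI v)) !eq_unit_vec.
by rewrite (negPf (unit_vec_neq0 l)).
Qed.

Lemma corner_tface v g : v \in corners g -> exists k, g = tface (tess_index g) v k.
Proof.
case: g => [|w|w l|w l|] //=; rewrite !inE.
- by move=> /eqP->; exists 0.
- case/orP=> /eqP->; first by exists l; rewrite tedge_ord.
  by exists (l + 3)%N; rewrite tedgeD3 tedge_ord.
- case/or3P=> /eqP->; first by exists l; rewrite ttri_ord.
    by exists (l + 2)%N; rewrite ttriD2 ttri_ord.
  by exists (l + 4)%N; rewrite ttriD4 ttri_ord.
Qed.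

Lemma corners_uniq f : uniq (corners f).
Proof.
have neq v k : v != v + unit_vec k.
  by rewrite -{1}[v]addr0 (inj_eq (addrI v)) eq_sym unit_vec_neq0.
case: f => //= [v l|v l]; rewrite !inE ?negb_or !neq //=.
by rewrite andbT (inj_eq (addrI v)) eq_unit_vec; have := ltn_ord l; clear; lia.
Qed.

Lemma tri_le_index f g : tri_le f g -> (tess_index f <= tess_index g)%N.
Proof.
have size_corners h : h <> TPlane -> size (corners h) = tess_index h by case: h.
have [->|fP] := pselect (f = TPlane); first by case: g.
have [->|gP] := pselect (g = TPlane); first by case: (f).
rewrite -!size_corners // => fg; apply: uniq_leq_size (corners_uniq f) _.
by move: fg gP fP; case: f => [|?|? ?|? ?|//]; case: g.
Qed.

Lemma tri_le_refl f : tri_le f f.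
Proof. by case: f => //= [v|v l|v l]. Qed.

Lemma tface_le i j v k : (i <= j <= 4)%N -> tri_le (tface i v k) (tface j v k).
Proof.
have tri_le_sub f g : {subset corners f <= corners g} -> f <> TPlane -> tri_le f g.
  by case: f => [|?|? ?|? ?|] //; case: g.
case/andP; rewrite leq_eqVlt => /orP[/eqP<- _|]; first exact: tri_le_refl.
rewrite [(j <= 4)%N]leq_eqVlt => ij /orP[/eqP jE|j4].
  by rewrite jE /=; case: (tface i v k).
apply: tri_le_sub => [x|iP]; last first.
  by have := @tess_index_tface i v k; rewrite iP /=; lia.
case: i j ij j4 => [|[|[|i]]] [|[|[|[|j]]]] // _ _ /=.
- by rewrite corners_tedge !inE => ->.
- by rewrite corners_ttri !inE => ->.
- by rewrite corners_ttri corners_tedge !inE => /orP[]->; rewrite ?orbT.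
Qed.

Lemma edge_le_tface v (l : 'I_3) g : g <> TPlane -> tri_le (TEdge v l) g ->
  exists w k, TEdge v l = tedge w k /\ g = tface (tess_index g) w k.
Proof.
move=> gP fg; have le_index := tri_le_index fg.
have sub : {subset [:: v; v + unit_vec l] <= corners g}.
  by move: fg gP; case: (g).
have [k gE] := corner_tface (sub v (mem_head _ _)).
have : v + unit_vec l \in corners g by apply: sub; rewrite !inE eqxx orbT.
have edgeE k' : l = k' %[mod 6] -> TEdge v l = tedge v k'.
  by move=> lk'; rewrite tedge_ord; apply: (@eq_mod6_tface 2).
case: (tess_index g) gE le_index (tess_index_le4 g) => [|[|[|[|[|]]]]] //= -> _ _.
- by rewrite corner_tedge => /eqP/edgeE->; exists v, k.
- rewrite corner_ttri => /orP[] /eqP/edgeE->; first by exists v, k.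
  exists (v + unit_vec k.+1), (k.+1 + 3)%N.
  by rewrite tedgeD3 addSnnS ttriD4.
Qed.

Lemma triangle_le_tface v (l : 'I_2) g : g <> TPlane -> tri_le (TTriangle v l) g ->
  exists k, TTriangle v l = ttri v k /\ g = ttri v k.
Proof.
move=> gP fg; have le_index := tri_le_index fg.
have sub : {subset [:: v; v + unit_vec l; v + unit_vec l.+1] <= corners g}.
  by move: fg gP; case: (g).
have [k gE] := corner_tface (sub v (mem_head _ _)); exists k.
have : v + unit_vec l \in corners g by apply: sub; rewrite !inE eqxx orbT.
have : v + unit_vec l.+1 \in corners g by apply: sub; rewrite !inE eqxx !orbT.
rewrite ttri_ord; case: g gP gE le_index {sub fg} => // w l' _ -> _.
rewrite !corner_ttri => l1k lk; split=> //.
by apply: (@eq_mod6_tface 3); move: l1k lk; clear; lia.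
Qed.

Lemma tri_le_tface f g : tri_le f g ->
  exists v k, f = tface (tess_index f) v k /\ g = tface (tess_index g) v k.
Proof.
move=> fg; have [->|gP] := pselect (g = TPlane).
  by have [v [k fE]] := tfaceP f; exists v, k.
case: f fg => [|v|v l|v l|] fg; last by case: g gP fg.
- by have [v [k gE]] := tfaceP g; exists v, k.
- have v_g : v \in corners g.
    have sub : {subset [:: v] <= corners g} by move: fg gP; case: (g).
    exact: (sub v (mem_head _ _)).
  by have [k gE] := corner_tface v_g; exists v, k.
- exact: edge_le_tface.
- have [k [-> ->]] := triangle_le_tface gP fg; exists v, k.
  by rewrite -[ttri v k]/(tface 3 v k) tess_index_tface.
Qed.

Lemma translate0 f : translate 0 f = f.
Proof. by case: f => //= *; rewrite addr0. Qed.

Lemma translateD s t f : translate s (translate t f) = translate (t + s) f.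
Proof. by case: f => //= *; rewrite addrA. Qed.

Lemma tess_index_translate t f : tess_index (translate t f) = tess_index f.
Proof. by case: f. Qed.

Lemma tface_translate i v k t : tface i (v + t) k = translate t (tface i v k).
Proof.
case: i => [|[|[|[|i]]]] //=.
  by rewrite /tedge; case: ifP => _ //=; rewrite addrAC.
by rewrite /ttri; case: (k %% 6)%N => [|[|[|[|[|j]]]]] //=; rewrite addrAC.
Qed.

Lemma corners_translate t f : corners (translate t f) = map (+%R^~ t) (corners f).
Proof. by case: f => //= *; rewrite ![_ + t + _]addrAC. Qed.

Lemma tri_le_translate t f g : tri_le f g -> tri_le (translate t f) (translate t g).
Proof.
move=> fg; have [v [k [-> ->]]] := tri_le_tface fg.
rewrite -!tface_translate; apply: tface_le.
by rewrite tri_le_index // tess_index_le4.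
Qed.

Lemma tedge_succ_neq v w k t : tedge v k.+1 <> translate t (tedge w k).
Proof.
have dir v1 k1 : exists v2, tedge v1 k1 = TEdge v2 (inord (k1 %% 3)).
  rewrite /tedge; case: ifP => k3; [exists v1|exists (v1 + unit_vec k1)];
    by congr (TEdge _ (inord _)); move: k3; clear; lia.
have [v1 ->] := dir v k.+1; have [v2 ->] := dir w k.
by move=> [_ /(congr1 val)]; rewrite /= !inordK ?ltn_mod //; clear; lia.
Qed.

Lemma ttri_parity v w k l t : odd k != odd l -> ttri v k <> translate t (ttri w l).
Proof.
have dir v1 k1 : exists v2, ttri v1 k1 = TTriangle v2 (inord (odd k1)).
  have -> : odd k1 = odd (k1 %% 6) by rewrite {1}(divn_eq k1 6) oddD oddM andbF.
  rewrite /ttri; have := ltn_pmod k1 (isT : (0 < 6)%N).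
  by case: (k1 %% 6)%N => [|[|[|[|[|[|]]]]]] //= _; eexists.
have [v1 ->] := dir v k; have [v2 ->] := dir w l.
move=> ne [_ /(congr1 val)]; rewrite /= !inordK ?ltnS ?leq_b1 //.
by case: (odd k) (odd l) ne => -[].
Qed.

Lemma in_lattice0 u : in_lattice u 0.
Proof. by exists 0, 0; rewrite !mulr0z addr0. Qed.

Lemma in_latticeB u s t : in_lattice u s -> in_lattice u t -> in_lattice u (s - t).
Proof.
case=> a [b ->] [c [d ->]]; exists (a - c), (b - d).
by rewrite !mulrzBr opprD addrACA.
Qed.

Lemma in_latticeN u t : in_lattice u t -> in_lattice u (- t).
Proof. by move=> ut; rewrite -sub0r; apply: in_latticeB ut; apply: in_lattice0. Qed.

Lemma in_latticeD u s t : in_lattice u s -> in_lattice u t -> in_lattice u (s + t).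
Proof. by move=> us ut; rewrite -[t]opprK; apply/in_latticeB/in_latticeN. Qed.

Lemma translation_orbit_refl u f : translation_orbit u f f.
Proof. by exists 0; [apply: in_lattice0|rewrite translate0]. Qed.

Lemma translation_orbit_sym u f g : translation_orbit u f g -> translation_orbit u g f.
Proof.
case=> t ut ->; exists (- t); first exact: in_latticeN.
by rewrite translateD subrr translate0.
Qed.

Lemma translation_orbit_trans u f g h :
  translation_orbit u f g -> translation_orbit u g h -> translation_orbit u f h.
Proof.
case=> t ut -> [s us ->]; exists (t + s); first exact: in_latticeD.
by rewrite translateD.
Qed.

Lemma eq_translation_orbit u f g : translation_orbit u f g ->
  translation_orbit u f = translation_orbit u g.
Proof.
move=> fg; apply/funext=> h; apply/propext; split; apply: translation_orbit_trans => //.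
exact: translation_orbit_sym.
Qed.

(** [h] identifies the quotient of the triangular tessellation by the lattice
    of [u] with the ordered set [S]. *)
Record torus_cover u (S : Type) (leS : S -> S -> Prop) (h : tess_face -> S) : Prop :=
  TorusCover {
    cover_surj : forall x, exists f, h f = x;
    cover_fiber : forall f g, h f = h g <-> translation_orbit u f g;
    cover_le : forall f g, leS (h f) (h g) <->
      exists2 g', translation_orbit u g g' & tri_le f g'
  }.

Lemma torus_cover_of_iso u (S : Type) (leS : S -> S -> Prop) :
  order_iso leS (@map36 u) -> exists h, torus_cover u leS h.
Proof.
case=> phi [psi phiK psiK] phi_le.
pose cls f : torus_face u := exist _ (translation_orbit u f) (ex_intro _ f erefl).
exists (psi \o cls); split=> [x|f g|f g] /=.
- have [f fE] := svalP (phi x); exists f.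
  by rewrite -[RHS]phiK; congr psi; case: (phi x) fE => A AP /= fE; apply: eq_exist.
- split=> [/(can_inj psiK)/(congr1 sval) /= E|fg].
    by rewrite E; apply: translation_orbit_refl.
  by congr psi; apply/eq_exist/eq_translation_orbit.
- rewrite phi_le !psiK; split=> [[_ [g1 [/= [t ut ->] gg1 le]]]|[g' gg' le]].
    exists (translate (- t) g1).
      by apply: translation_orbit_trans gg1 _; exists (- t) => //; apply: in_latticeN.
    by have := tri_le_translate (- t) le; rewrite translateD subrr translate0.
  by exists f, g'; split=> //=; apply: translation_orbit_refl.
Qed.

Lemma iso_of_torus_cover u (S : Type) (leS : S -> S -> Prop) h :
  torus_cover u leS h -> order_iso leS (@map36 u).
Proof.
case=> surj fib le.
have fiberE f : (fun g => h g = h f) = translation_orbit u f.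
  by apply/funext=> g; apply/propext; split=> [/esym/fib|/fib].
have clsP x : exists f, (fun g => h g = x) = translation_orbit u f.
  by have [f <-] := surj x; exists f.
exists (fun x => exist _ (fun g => h g = x) (clsP x)).
  exists (fun A : torus_face u => h (sval (cid (svalP A)))) => [x|[A AP]].
    case: cid => f /= E; have := translation_orbit_refl u f.
    by rewrite -E.
  by apply: eq_exist; rewrite fiberE; case: cid.
move=> x y; split=> [xy|[f [g [/= <- <- fg]]]].
  have [[f fx] [g gy]] := (surj x, surj y).
  have /le[g' gg' fg'] : leS (h f) (h g) by rewrite fx gy.
  by exists f, g'; split=> //=; rewrite -gy; apply/esym/fib.
by apply/le; exists g => //; apply: translation_orbit_refl.
Qed.

End Tessellation.

Section Facets.
Variables (n : nat) (P : polytope n).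

Definition below_le (F : P) (x y : {x : P | (x <= F)%O}) : Prop :=
  (sval x <= sval y)%O.

Definition has_facets (S : Type) (leS : S -> S -> Prop) : Prop :=
  forall F : P, rank F = n%:Z - 1 -> order_iso (@below_le F) leS.

Lemma self_dual_has_type (d : {perm P}) (S : Type) (leS leT : S -> S -> Prop) :
  duality d -> (forall x y, leT x y <-> leS y x) -> has_facets leS ->
  has_type P leS leT.
Proof.
move=> dd leT_dual facets; split=> // v rv.
have rF : rank (d v) = n%:Z - 1 by rewrite (duality_rank _ dd) rv subr0.
have [phi phi_bij phi_le] := facets _ rF.
have to_le (x : {x : P | (v <= x)%O}) : (d (sval x) <= d v)%O.
  by rewrite dd; apply: (svalP x).
have of_le (y : {y : P | (y <= d v)%O}) : (v <= (d^-1)%g (sval y))%O.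
  by rewrite -dd permKV; apply: (svalP y).
exists (fun x => phi (exist _ (d (sval x)) (to_le x))).
  apply: (bij_comp phi_bij); exists (fun y => exist _ ((d^-1)%g (sval y)) (of_le y)).
    by case=> x vx; apply: eq_exist; rewrite /= permK.
  by case=> y yv; apply: eq_exist; rewrite /= permKV.
by move=> x y; rewrite leT_dual -phi_le /below_le /= dd.
Qed.

End Facets.

Lemma map63_dual u (A B : torus_face u) : map63 A B <-> map36 B A.
Proof. by split=> -[f [g [Af Bg fg]]]; exists g, f. Qed.

(** * Group actions on the triangular lattice *)

Local Open Scope group_scope.

Section IntegerPowers.
Variable gT : finGroupType.
Implicit Types (x y g : gT) (a b : int).

Definition zpow x a : gT :=
  match a with Posz n => x ^+ n | Negz n => x ^- n.+1 end.

Lemma zpowB x (n m : nat) : zpow x (n%:Z - m%:Z)%R = x ^+ n * x ^- m.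
Proof.
have [mn|/ltnW nm] := leqP m n.
  by rewrite subzn //= -{2}(subnK mn) expgD mulgK.
have -> : (n%:Z - m%:Z)%R = (- (m - n)%N%:Z)%R by rewrite -subzn // opprB.
rewrite -{2}(subnK nm) expgD invMg mulKVg.
by case: (m - n)%N => //=; rewrite !expg0 invg1.
Qed.

Lemma int_diff a : exists n m : nat, a = (n%:Z - m%:Z)%R.
Proof.
case: a => n; first by exists n, 0; rewrite subr0.
by exists 0, n.+1; rewrite sub0r NegzE.
Qed.

Lemma zpow_mem (H : {group gT}) x a : x \in H -> zpow x a \in H.
Proof. by move=> xH; case: a => n /=; rewrite ?groupV groupX. Qed.

Lemma zpow_commute x y a b : commute x y -> commute (zpow x a) (zpow y b).
Proof.
move=> /cent1P xy; apply/commute_sym/cent1P/zpow_mem/cent1P/commute_sym/cent1P.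
exact: zpow_mem.
Qed.

Lemma zpowD x a b : zpow x (a + b)%R = zpow x a * zpow x b.
Proof.
have [n1 [m1 ->]] := int_diff a; have [n2 [m2 ->]] := int_diff b.
rewrite addrACA -opprD -!PoszD !zpowB !expgD invMg -!mulgA; congr (_ * _).
rewrite mulgA -(zpowB x n2 m2).
have -> : x ^- m1 = zpow x (0%:Z - m1%:Z)%R by rewrite zpowB expg0 mul1g.
exact: zpow_commute.
Qed.

Lemma zpowN x a : zpow x (- a)%R = (zpow x a)^-1.
Proof. by have [n [m ->]] := int_diff a; rewrite opprB !zpowB invMg invgK. Qed.

Lemma zpowV x a : zpow x^-1 a = zpow x (- a)%R.
Proof. by rewrite zpowN; case: a => n /=; rewrite expVgn ?invgK. Qed.

Lemma zpowJ x g a : zpow x a ^ g = zpow (x ^ g) a.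
Proof. by case: a => n /=; rewrite ?conjVg conjXg. Qed.

Lemma zpowMg x y a : commute x y -> zpow (x * y) a = zpow x a * zpow y a.
Proof.
move=> cxy; case: a => n /=; rewrite expgMn // invMg.
by apply: commuteV; apply/commute_sym/commuteV/commute_sym/commuteX2.
Qed.

End IntegerPowers.

Lemma morph_zpow (aT rT : finGroupType) (D : {group aT}) (f : {morphism D >-> rT}) x a :
  x \in D -> f (zpow x a) = zpow (f x) a.
Proof. by move=> xD; case: a => n /=; rewrite ?morphV ?morphX ?groupX. Qed.

(** [x] acts as the unit translation, and [q] as the rotation by 60 degrees, of
    a quotient of the triangular lattice. *)
Definition hex_action (gT : finGroupType) (q x : gT) : Prop :=
  [/\ commute x (x ^ q), x ^ (q ^+ 2) = x^-1 * x ^ q & q ^+ 6 = 1].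

Definition hex_tr (gT : finGroupType) (q x : gT) (v : point) : gT :=
  zpow x v.1 * zpow (x ^ q) v.2.

Definition hex_elt (gT : finGroupType) (q x : gT) (v : point) (k : nat) : gT :=
  q ^+ k * hex_tr q x v.

(** The rotation part of an element is well defined modulo 6. *)
Definition faithful_rotations (gT : finGroupType) (q x : gT) : Prop :=
  forall v k, hex_elt q x v k = 1 -> (6 %| k)%N.

Lemma hex_tr_mem (gT : finGroupType) (H : {group gT}) q x v :
  q \in H -> x \in H -> hex_tr q x v \in H.
Proof. by move=> qH xH; rewrite groupM ?zpow_mem ?groupJ. Qed.

Lemma morph_hex_tr (aT rT : finGroupType) (D : {group aT})
  (f : {morphism D >-> rT}) q x v :
  q \in D -> x \in D -> f (hex_tr q x v) = hex_tr (f q) (f x) v.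
Proof.
move=> qD xD; have xqD : x ^ q \in D by rewrite groupJ.
by rewrite /hex_tr morphM ?zpow_mem // !morph_zpow // morphJ.
Qed.

Lemma morph_hex_elt (aT rT : finGroupType) (D : {group aT})
  (f : {morphism D >-> rT}) q x v k :
  q \in D -> x \in D -> f (hex_elt q x v k) = hex_elt (f q) (f x) v k.
Proof.
move=> qD xD.
by rewrite /hex_elt morphM ?groupX ?hex_tr_mem // morphX // morph_hex_tr.
Qed.

Section HexAction.
Variables (gT : finGroupType) (q x : gT).
Hypothesis qx : hex_action q x.
Local Notation tr := (hex_tr q x).
Local Notation elt := (hex_elt q x).

Lemma hex_tr0 : tr 0%R = 1. Proof. by rewrite /hex_tr /= !expg0 mulg1. Qed.

Lemma hex_tr1 : tr (1, 0)%R = x. Proof. by rewrite /hex_tr /= expg0 mulg1. Qed.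

Lemma hex_trD u v : tr (u + v)%R = tr u * tr v.
Proof.
have [cxy _ _] := qx; rewrite /hex_tr /= !zpowD -!mulgA; congr (_ * _).
by rewrite !mulgA; congr (_ * _); apply: zpow_commute.
Qed.

Lemma hex_trN v : tr (- v)%R = (tr v)^-1.
Proof. by apply: (mulgI (tr v)); rewrite -hex_trD subrr hex_tr0 mulgV. Qed.

Lemma zpow_hex_tr v a : zpow (tr v) a = tr (v *~ a)%R.
Proof.
have expg_tr n : tr v ^+ n = tr (v *+ n)%R.
  by elim: n => [|n IH]; rewrite ?hex_tr0 // expgS IH -hex_trD mulrS.
case: a => n /=; first by rewrite expg_tr pmulrn.
by rewrite expg_tr -hex_trN NegzE mulrNz -pmulrn.
Qed.

Lemma hex_trJ v : tr v ^ q = tr (rot60 v).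
Proof.
have [cxy xqq _] := qx; rewrite /hex_tr conjMg !zpowJ -conjgM -expg2 xqq /=.
rewrite (@zpowMg _ x^-1 (x ^ q)); last exact: commute_sym (commuteV (commute_sym cxy)).
rewrite zpowV zpowD !mulgA; congr (_ * _).
exact/commute_sym/zpow_commute.
Qed.

Lemma hex_tr_mul_expg v k : tr v * q ^+ k = q ^+ k * tr (iter k rot60 v).
Proof.
elim: k v => [|k IH] v; first by rewrite expg0 mulg1 mul1g.
by rewrite expgS mulgA [tr v * q]conjgC hex_trJ -mulgA IH -iterSr mulgA.
Qed.

Lemma hex_eltM v k w l : elt v k * elt w l = elt (iter l rot60 v + w)%R (k + l).
Proof.
by rewrite /hex_elt mulgA -(mulgA (q ^+ k)) hex_tr_mul_expg expgD hex_trD !mulgA.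
Qed.

Lemma eq_mod6_hex_elt v k l : k = l %[mod 6] -> elt v k = elt v l.
Proof.
have [_ _ q6] := qx; move=> kl.
by rewrite /hex_elt -(expg_mod k q6) kl expg_mod.
Qed.

Lemma hex_elt_rot k : elt 0%R k = q ^+ k.
Proof. by rewrite /hex_elt hex_tr0 mulg1. Qed.

Lemma hex_elt_tr v : elt v 0 = tr v.
Proof. by rewrite /hex_elt expg0 mul1g. Qed.

Lemma rotV_mul_hex_elt v k : q^-1 * elt v k = elt v (k + 5).
Proof.
have [_ _ q6] := qx; rewrite addnC /hex_elt expgD mulgA; congr (_ * _ * _).
by apply: (mulgI q); rewrite mulgV -expgS.
Qed.

Definition triangle_rot : gT := q ^+ 3 * x * q.

Lemma triangle_rotE : triangle_rot = elt (unit_vec 1) 4.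
Proof.
rewrite /triangle_rot /hex_elt -mulgA [x * q]conjgC -{1}hex_tr1 hex_trJ.
by rewrite mulgA -expgSr.
Qed.

Lemma triangle_rot_mul_hex_elt v k :
  triangle_rot * elt v k = elt (v + unit_vec k.+1)%R (k + 4).
Proof. by rewrite triangle_rotE hex_eltM addrC addnC /unit_vec -iterD addn1. Qed.

Lemma triangle_rot_cube : triangle_rot ^+ 3 = 1.
Proof.
have -> : triangle_rot ^+ 3 = triangle_rot * (triangle_rot * triangle_rot) by [].
by rewrite triangle_rotE !hex_eltM (@eq_mod6_hex_elt _ _ 0) // hex_elt_tr hex_tr0.
Qed.

Lemma triangle_rotV : triangle_rot^-1 = triangle_rot * triangle_rot.
Proof.
by apply: (mulgI triangle_rot); rewrite mulgV -expg2 -expgS triangle_rot_cube.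
Qed.

(* The reflection that exchanges the two flags of the facet at the same edge and
   triangle maps the rotation [triangle_rot] to its inverse, and [q^-1] to the
   conjugate of [q] below. *)
Lemma reflected_unit_shift :
  (triangle_rot * q * triangle_rot^-1) ^+ 3 * triangle_rot^-1
    * (triangle_rot * q * triangle_rot^-1) = tr (-1, 0)%R.
Proof.
have compute a r : a = elt (unit_vec 1) 4 -> r = elt 0%R 1 ->
    (a * r * (a * a)) ^+ 3 * (a * a) * (a * r * (a * a)) = tr (-1, 0)%R.
  move=> -> ->; rewrite expgS expg2 !hex_eltM -hex_elt_tr.
  by rewrite (@eq_mod6_hex_elt _ _ 0).
by rewrite triangle_rotV (compute _ _ triangle_rotE) // hex_elt_rot.
Qed.

Lemma reflected_unit_shiftJ :
  tr (-1, 0)%R ^ (triangle_rot * q^-1 * triangle_rot^-1) = tr (-1, 1)%R.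
Proof.
have qV : q^-1 = elt 0%R 5.
  by have := rotV_mul_hex_elt 0%R 0; rewrite hex_elt_rot mulg1.
have compute a r : a = elt (unit_vec 1) 4 -> r = elt 0%R 5 ->
    tr (-1, 0)%R * (a * r * (a * a)) = a * r * (a * a) * tr (-1, 1)%R.
  by move=> -> ->; rewrite -!hex_elt_tr !hex_eltM; apply: eq_mod6_hex_elt.
apply: (mulgI (triangle_rot * q^-1 * triangle_rot^-1)); rewrite -conjgC.
by rewrite triangle_rotV (compute _ _ triangle_rotE).
Qed.

Lemma hex_eltP g : g \in <<[set q; x]>> <-> exists v k, g = elt v k.
Proof.
split=> [/gen_prodgP[n [c cP ->]]|[v [k ->]]]; last first.
  have [qG xG] : q \in <<[set q; x]>> /\ x \in <<[set q; x]>>.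
    by split; rewrite mem_gen // !inE eqxx ?orbT.
  by rewrite groupM ?groupX ?hex_tr_mem.
elim: n c cP => [|n IH] c cP.
  by exists 0%R, 0; rewrite big_ord0 hex_elt_rot.
rewrite big_ord_recl.
have [v [k ->]] := IH (fun i => c (lift ord0 i)) (fun i => cP _).
have := cP ord0; rewrite !inE => /orP[] /eqP->.
  by exists v, k.+1; rewrite /hex_elt mulgA -expgS.
exists (unit_vec k + v)%R, k.
by have := hex_eltM (1, 0)%R 0 v k; rewrite hex_elt_tr hex_tr1.
Qed.

Lemma hex_elt_inj : faithful_rotations q x ->
  forall v k w l, elt v k = elt w l -> tr (v - w)%R = 1 /\ k = l %[mod 6].
Proof.
move=> faith v k w l eqvw; have [_ _ q6] := qx.
have elt1 : elt (v - w)%R (5 * l + k) = 1.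
  have -> : elt (v - w)%R (5 * l + k) = q ^+ (5 * l) * (elt v k * (tr w)^-1).
    by rewrite /hex_elt hex_trD hex_trN expgD !mulgA.
  by rewrite eqvw /hex_elt mulgK -expgD -mulSnr expgM q6 expg1n.
have dvd6 := faith _ _ elt1; split; last by move: dvd6; clear; lia.
by have := elt1; rewrite /hex_elt -(expg_mod _ q6) (eqP dvd6) mul1g.
Qed.

End HexAction.

(** In terms of the rotations [s1] about a triangle and [s2] about a vertex of
    the tessellation, the rotation by 60 degrees is [s2^-1]. *)
Definition unit_shift (gT : finGroupType) (s1 s2 : gT) : gT := s2 ^+ 3 * s1 * s2.

Definition facet_tr (gT : finGroupType) (s1 s2 : gT) (v : point) : gT :=
  hex_tr s2^-1 (unit_shift s1 s2) v.

Lemma triangle_rot_unit_shift (gT : finGroupType) (s1 s2 : gT) :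
  triangle_rot s2^-1 (unit_shift s1 s2) = s1.
Proof. by rewrite /triangle_rot -(mulgA (s2^-1 ^+ 3)) mulgK expVgn mulKg. Qed.

(** The relations between the rotations [s1, s2, s3] of a self-dual 4-polytope
    with toroidal facets of type [{3,6}]: [L] is the lattice of the translations
    that act trivially on the facet, and [d] is a duality fixing the base flag. *)
Record rotation_system (gT : finGroupType) (s1 s2 s3 d : gT) (L : point -> Prop) :
    Prop := RotationSystem {
  rot_s1 : s1 ^+ 3 = 1;
  rot_s12 : (s1 * s2) ^+ 2 = 1;
  rot_s123 : (s1 * s2 * s3) ^+ 2 = 1;
  rot_hex : hex_action s2^-1 (unit_shift s1 s2);
  rot_tr : forall v, facet_tr s1 s2 v = 1 <-> L v;
  rot_tr_vertex : forall v, facet_tr s1 s2 v \in <<[set s2; s3]>> -> L v;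
  rot_dual1 : s1 ^ d = s3^-1;
  rot_dual2 : s2 ^ d = s2^-1;
  rot_dual3 : s3 ^ d = s1^-1
}.

Lemma eq_rotation_system (gT : finGroupType) (s1 s2 s3 d : gT) (L L' : point -> Prop) :
  (forall v, L v <-> L' v) ->
  rotation_system s1 s2 s3 d L -> rotation_system s1 s2 s3 d L'.
Proof.
move=> LL' [? ? ? ? trL vertexL ? ? ?]; split=> // v; first by rewrite -LL'.
by move/vertexL/LL'.
Qed.

Local Close Scope group_scope.

(** * Toroidal facets of regular polytopes *)

Section Facet.
Variables (Q : polytope 4) (u : point).
Implicit Types (v : point) (f g : tess_face) (x : Q).

Record facet_chart (h : tess_face -> Q) (F : Q) : Prop := FacetChart {
  chart_rank : rank F = 3%:Z;
  chart_onto : forall x, (x <= F)%O <-> exists f, h f = x;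
  chart_fiber : forall f g, h f = h g <-> translation_orbit u f g;
  chart_le : forall f g, (h f <= h g)%O <->
    exists2 g', translation_orbit u g g' & tri_le f g'
}.

Lemma facet_chart_exists F : rank F = 3%:Z ->
  has_facets Q (@map36 u) -> exists h, facet_chart h F.
Proof.
move=> rF facets; have [h [h_onto h_fiber h_le]] := torus_cover_of_iso (facets F rF).
exists (fun f => sval (h f)); split=> // [x|f g].
- split=> [xF|[f <-]]; last exact: (svalP (h f)).
  by have [f fx] := h_onto (exist _ x xF); exists f; rewrite fx.
- rewrite -h_fiber; split=> [E|->] //.
  by case: (h f) (h g) E => a aF [b bF] /= E; apply: eq_exist.
Qed.

Lemma facet_chart_Gamma h F (g : {perm Q}) : g \in Gamma Q -> facet_chart h F ->
  facet_chart (fun f => g (h f)) (g F).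
Proof.
move=> gG [rF h_onto h_fiber h_le]; split.
- by rewrite Gamma_rank.
- move=> x; rewrite -{1}[x](permKV g) (GammaP _ gG) h_onto.
  by split=> -[f fx]; exists f; rewrite ?fx ?permKV // -fx permK.
- by move=> f f'; rewrite -h_fiber; split=> [/perm_inj|->].
- by move=> f f'; rewrite (GammaP _ gG).
Qed.

(** [c i] is the face of rank [i - 1] of a flag of the tessellation. *)
Definition tess_flag (c : nat -> tess_face) : Prop :=
  forall i j, (i <= j <= 4)%N -> tess_index (c i) = i /\ tri_le (c i) (c j).

Definition pos_flag v k : nat -> tess_face := fun i => tface i v k.

(** The mirror image of [pos_flag v k] in the edge [tedge v k]. *)
Definition neg_flag v k : nat -> tess_face :=
  fun i => if i == 3 then ttri v (k + 5) else tface i v k.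

Lemma tess_flag_pos v k : tess_flag (pos_flag v k).
Proof.
move=> i j ij; split; last exact: tface_le.
by rewrite tess_index_tface //; case/andP: ij => /leq_trans; apply.
Qed.

Lemma tess_flag_neg v k : tess_flag (neg_flag v k).
Proof.
have edge_le : tri_le (tedge v k) (ttri v (k + 5)).
  by rewrite -tedgeD3 -ttriD3; apply: (@tface_le 2 3).
move=> i j ij; rewrite /neg_flag; split.
  case: eqP => [->|_]; first exact: (@tess_index_tface 3).
  by rewrite tess_index_tface //; case/andP: ij => /leq_trans; apply.
case: eqP ij => [->|i3]; case: eqP => [->|j3] ij.
- exact: tri_le_refl.
- have -> : j = 4%N by move: ij j3; clear; lia.
  exact: (@tface_le 3 4).
- have [->|i2] := eqVneq i 2%N; first exact: edge_le.
  have -> : tface i v k = tface i v (k + 5).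
    by case: i i3 i2 ij => [|[|[|[|]]]].
  exact: (@tface_le i 3).
- exact: tface_le.
Qed.

Section Chart.
Variables (h : tess_face -> Q) (F T : Q).
Hypotheses (hF : facet_chart h F) (rank_T : rank T = 4%:Z).

Lemma chart_plane : h TPlane = F.
Proof.
have [f fF] := (chart_onto hF F).1 (lexx F).
apply/le_anti/andP; split; first by apply/(chart_onto hF); exists TPlane.
rewrite -fF; apply/(chart_le hF); exists TPlane; first exact: translation_orbit_refl.
by case: f {fF}.
Qed.

Lemma chart_homo f g : tri_le f g -> (h f <= h g)%O.
Proof.
by move=> fg; apply/(chart_le hF); exists g => //; apply: translation_orbit_refl.
Qed.

Lemma chart_index f g : h f = h g -> tess_index f = tess_index g.
Proof. by move/(chart_fiber hF) => [t _ ->]; rewrite tess_index_translate. Qed.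

Lemma chart_lt i j v k : (i < j <= 4)%N -> (h (tface i v k) < h (tface j v k))%O.
Proof.
move=> /andP[ij j4]; have i4 := leq_trans (ltnW ij) j4.
rewrite lt_neqAle chart_homo ?andbT; last by apply: tface_le; rewrite ltnW.
apply: contraTneq ij => /chart_index.
by rewrite !tess_index_tface // => ->; rewrite ltnn.
Qed.

Lemma chart_rankE f : rank (h f) = (tess_index f)%:Z - 1.
Proof.
have [v [k ->]] := tfaceP f; have i4 := tess_index_le4 f.
rewrite tess_index_tface //.
have rank_lt i j ij := polytope_rank_mono (polytopeP Q) (@chart_lt i j v k ij).
have r01 := rank_lt 0%N 1%N isT; have r12 := rank_lt 1%N 2%N isT.
have r23 := rank_lt 2%N 3%N isT; have r34 := rank_lt 3%N 4%N isT.
have := chart_rank hF; rewrite -chart_plane -[TPlane]/(tface 4%N v k).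
have /andP[r0 _] := polytope_rank_bounds (polytopeP Q) (h (tface 0 v k)).
by case: (tess_index f) i4 => [|[|[|[|[|//]]]]] _;
  move: r01 r12 r23 r34 r0; clear; lia.
Qed.

Definition chart_flag (c : nat -> tess_face) : {set Q} :=
  T |: [set h (c i) | i : 'I_5].

Lemma eq_chart_flag c c' : (forall i, (i <= 4)%N -> h (c i) = h (c' i)) ->
  chart_flag c = chart_flag c'.
Proof.
by move=> cc'; congr (_ |: _); apply: eq_imset => i; apply: cc'; rewrite -ltnS.
Qed.

Lemma mem_chart_flag c i : (i <= 4)%N -> h (c i) \in chart_flag c.
Proof.
rewrite -ltnS => i5; rewrite !inE; apply/orP; right.
by apply/imsetP; exists (Ordinal i5).
Qed.

Lemma chart_flag_rank c i : tess_flag c -> (i <= 4)%N -> rank (h (c i)) = i%:Z - 1.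
Proof. by move=> cP i4; have [|ci _] := cP i i; rewrite ?leqnn // chart_rankE ci. Qed.

Lemma flag_chart_flag c : tess_flag c -> flag (chart_flag c).
Proof.
move=> cP; have rank_c := chart_flag_rank cP.
have ord4 (i : 'I_5) : (i <= 4)%N by rewrite -ltnS.
apply: chain_flag.
  apply: chain_setU1 => [|x _]; last first.
    by rewrite /Order.comparable (greatest_of_rank _ rank_T) orbT.
  apply/chainP=> _ _ /imsetP[i _ ->] /imsetP[j _ ->].
  case/orP: (leq_total i j) => ij; apply/orP; [left|right]; apply: chart_homo.
    by have [|_] := cP i j; rewrite ?ij ?ord4.
  by have [|_] := cP j i; rewrite ?ij ?ord4.
rewrite cardsU1 card_imset ?card_ord => [|i j /(congr1 (@rank 4 Q))].
  case: imsetP => // -[i _ TE]; have := congr1 (@rank 4 Q) TE.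
  by rewrite rank_T rank_c //; have := ord4 i; clear; lia.
by rewrite !rank_c // => /addIr[/val_inj].
Qed.

Lemma chart_flag_adjacent c c' i : (i < 3)%N -> tess_flag c -> tess_flag c' ->
  h (c i.+1) <> h (c' i.+1) ->
  (forall j, (j <= 4)%N -> j != i.+1 -> h (c j) = h (c' j)) ->
  i_adjacent i (chart_flag c) (chart_flag c').
Proof.
move=> i3 cP c'P neq agree; have fc := flag_chart_flag cP.
have fc' := flag_chart_flag c'P; have i4 : (i.+1 <= 4)%N by apply: ltnW.
apply/i_adjacentP => //; split=> [E|x].
  apply: neq; apply: (flag_rank_inj fc); rewrite ?mem_chart_flag //.
    by rewrite E mem_chart_flag.
  by rewrite !chart_flag_rank.
rewrite !inE => /orP[/eqP->|/imsetP[j _ ->] rx]; first by rewrite eqxx.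
have j4 : (j <= 4)%N by rewrite -ltnS.
rewrite chart_flag_rank // in rx; apply/orP; right; apply/imsetP; exists j => //.
by apply: agree => //; move: rx; clear; lia.
Qed.

Local Notation pos v k := (chart_flag (pos_flag v k)).
Local Notation neg v k := (chart_flag (neg_flag v k)).

Lemma flag_pos v k : flag (pos v k).
Proof. exact: flag_chart_flag (tess_flag_pos v k). Qed.

Lemma eq_mod6_pos v k l : k = l %[mod 6] -> pos v k = pos v l.
Proof.
by move=> kl; apply: eq_chart_flag => i _; congr h; apply: eq_mod6_tface.
Qed.

Lemma eq_mod6_neg v k l : k = l %[mod 6] -> neg v k = neg v l.
Proof.
move=> kl; apply: eq_chart_flag => i _; congr h; rewrite /neg_flag.
by case: eqP => _; [apply: (@eq_mod6_tface 3); rewrite -modnDml kl modnDml|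
  apply: eq_mod6_tface].
Qed.

Lemma pos_lattice v t k : in_lattice u t -> pos (v + t) k = pos v k.
Proof.
move=> ut; apply: eq_chart_flag => i _; apply/esym/(chart_fiber hF).
by exists t => //; rewrite -tface_translate.
Qed.

Lemma vertex_lattice v w : h (TVertex v) = h (TVertex w) -> in_lattice u (v - w).
Proof. by move/esym/(chart_fiber hF)=> [t ut [->]]; rewrite addrC addKr. Qed.

Lemma pos_vertex v k (g : {perm Q}) : g \in Gamma Q -> g @: pos 0 0 = pos v k ->
  g (h (TVertex 0)) = h (TVertex v).
Proof.
move=> gG gE; apply: (flag_rank_inj (flag_pos v k)).
- by rewrite -gE; apply/imset_f/(@mem_chart_flag _ 1).
- exact: (@mem_chart_flag _ 1).
- by rewrite Gamma_rank // !chart_rankE.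
Qed.

Lemma pos_adjacent2 v k : i_adjacent 2 (pos v k) (neg v k).
Proof.
apply: chart_flag_adjacent; rewrite //; [exact: tess_flag_pos|exact: tess_flag_neg| |].
  move/(chart_fiber hF) => [t _]; apply: ttri_parity.
  by rewrite oddD; case: (odd k).
by move=> j _ j3; rewrite /neg_flag (negPf j3).
Qed.

Lemma pos_adjacent1 v k : i_adjacent 1 (pos v k) (neg v k.+1).
Proof.
apply: chart_flag_adjacent; rewrite //; [exact: tess_flag_pos|exact: tess_flag_neg| |].
  by move/(chart_fiber hF) => [t _]; apply: tedge_succ_neq.
by case=> [|[|[|[|[|]]]]] //= _ _; rewrite /neg_flag /pos_flag /= addSnnS ttriD6.
Qed.

Lemma neg_adjacent1 v k : i_adjacent 1 (neg v k) (pos v (k + 5)).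
Proof.
have -> : neg v k = neg v (k + 5).+1 by apply: eq_mod6_neg; rewrite -addnS modnDr.
exact/i_adjacent_sym/pos_adjacent1.
Qed.

Lemma vertices_below_edge x v k : rank x = 0 -> (x <= h (tedge v k))%O ->
  x = h (TVertex v) \/ x = h (TVertex (v + unit_vec k)).
Proof.
move=> rx xe; have [f fx] : exists f, h f = x.
  by apply/(chart_onto hF); rewrite (le_trans xe) // -chart_plane chart_homo //
    /tedge; case: ifP.
move: xe; rewrite -fx => /(chart_le hF)[_ [t ut ->]] fe.
have [w fE] : exists w, f = TVertex w.
  by have := chart_rankE f; rewrite fx rx; case: (f) => [|w|? ?|? ?|] //; exists w.
have {fe} : w \in corners (translate t (tedge v k)).
  by move: fe; rewrite fE /tedge; case: ifP => _ /= fe; apply: fe; rewrite inE eqxx.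
rewrite corners_translate => /mapP[z ze wz].
have -> : h f = h (TVertex z).
  by apply/esym/(chart_fiber hF); exists t => //; rewrite fE wz.
by move: ze; rewrite corners_tedge !inE => /orP[]/eqP->; [left|right].
Qed.

(* Otherwise the edge would have only one vertex, against the diamond condition. *)
Lemma adjacent_vertices_neq v k : h (TVertex v) <> h (TVertex (v + unit_vec k)).
Proof.
have [B ad] := i_adjacent_exists (isT : (0 < 4)%N) (flag_pos v k).
have [_ fB] := i_adjacent_flag ad.
have [x xB rx] := flag_face_nat (isT : (0 < 4)%N) fB.
have eB : h (tedge v k) \in B.
  by apply: (i_adjacent_mem ad) (@mem_chart_flag _ 2 isT) _; rewrite chart_rankE
    (@tess_index_tface 2).
have xe : (x <= h (tedge v k))%O.
  by rewrite (flag_le fB) // rx chart_rankE (@tess_index_tface 2).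
have := i_adjacent_notin (i_adjacent_sym ad) xB rx.
have [->|->] := vertices_below_edge rx xe => + vE; rewrite -?vE;
  by rewrite (@mem_chart_flag _ 1).
Qed.

Lemma neg_adjacent0 v k : i_adjacent 0 (neg v k) (pos (v + unit_vec k) (k + 3)).
Proof.
apply: chart_flag_adjacent; rewrite //; [exact: tess_flag_neg|exact: tess_flag_pos| |].
  exact: adjacent_vertices_neq.
case=> [|[|[|[|[|]]]]] //= _ _; rewrite /neg_flag /pos_flag /=;
  first by rewrite tedgeD3.
by rewrite ttriD3.
Qed.

End Chart.

Section RotationAction.
Variable Phi : {set Q}.
Hypotheses (Phi_flag : flag Phi) (Q_regular : regular Q).
Variables (h : tess_face -> Q) (F T : Q).
Hypotheses (hF : facet_chart h F) (rank_T : rank T = 4%:Z).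
Local Notation pos v k := (chart_flag h T (pos_flag v k)).
Local Notation neg v k := (chart_flag h T (neg_flag v k)).
Hypothesis Phi_pos : Phi = pos 0 0.
Local Notation r := (rho Phi).
Local Notation s1 := (sigma Phi 1).
Local Notation s2 := (sigma Phi 2).
Local Notation s3 := (sigma Phi 3).
Local Open Scope group_scope.
Implicit Types p : {perm Q}.

(** [p] acts on the flags of the facet like the rotation taking the flag
    [(0, 0)] of the tessellation to [(v, k)]. *)
Definition acts_as p v k : Prop := p \in Gamma Q /\
  forall p0 v0 k0, p0 \in Gamma Q -> p0 @: Phi = pos v0 k0 ->
    (p * p0) @: Phi = pos (v0 + iter k0 rot60 v)%R (k0 + k)%N.

Lemma acts_as1 : acts_as 1 0%R 0.
Proof. by split=> // p0 v0 k0 _ E; rewrite mul1g E iter_rot60_0 addr0 addn0. Qed.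

Lemma acts_asM p v k p' v' k' : acts_as p v k -> acts_as p' v' k' ->
  acts_as (p * p') (v' + iter k' rot60 v)%R (k + k')%N.
Proof.
move=> [pG pP] [p'G p'P]; split=> [|p0 v0 k0 p0G E]; first exact: groupM.
rewrite -mulgA (pP _ _ _ _ (p'P _ _ _ p0G E)) ?groupM //.
by rewrite iter_rot60D addrA -iterD addnA addnAC.
Qed.

Lemma acts_as_mod6 p v k l : k = l %[mod 6] -> acts_as p v k -> acts_as p v l.
Proof.
move=> kl [pG pP]; split=> // p0 v0 k0 p0G E; rewrite (pP _ _ _ p0G E).
by apply: eq_mod6_pos; rewrite -modnDmr kl modnDmr.
Qed.

Lemma acts_as_flag p v k : acts_as p v k -> p @: Phi = pos v k.
Proof.
move=> [_ pP]; have := pP 1 0%R 0 (group1 _).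
by rewrite mulg1 imset_perm1 add0r; apply.
Qed.

Lemma acts_as_vertex p v k : acts_as p v k -> p (h (TVertex 0)) = h (TVertex v).
Proof.
move=> pP; apply: (pos_vertex hF rank_T (k := k)) pP.1 _.
by rewrite -Phi_pos (acts_as_flag pP).
Qed.

Lemma acts_as_eq p v k p' v' k' : acts_as p v k -> acts_as p' v' k' ->
  in_lattice u (v - v')%R -> k = k' %[mod 6] -> p = p'.
Proof.
move=> pP p'P uv kk'; apply: (Gamma_eq pP.1 p'P.1 Phi_flag).
rewrite (acts_as_flag pP) (acts_as_flag p'P) (eq_mod6_pos _ _ _ kk').
by rewrite -[v](subrK v') addrC (pos_lattice _ hF).
Qed.

Lemma acts_as_inj p v k p' k' : acts_as p v k -> acts_as p' v k' ->
  k = k' %[mod 6] -> p = p'.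
Proof.
by move=> pP p'P; apply: acts_as_eq pP p'P _; rewrite subrr; apply: in_lattice0.
Qed.

Lemma acts_asV p v : acts_as p v 0 -> acts_as p^-1 (- v)%R 0.
Proof.
move=> [pG pP]; split=> [|p0 v0 k0 p0G E]; first by rewrite groupV.
have fM := flag_pos hF rank_T (v0 - iter k0 rot60 v)%R k0.
have [p1 p1G E1] := regular_flag_trans Q_regular Phi_flag fM.
have := pP _ _ _ p1G E1; rewrite addn0 subrK -E => E2.
have <- : p * p1 = p0 by apply: Gamma_eq Phi_flag E2; rewrite ?groupM.
by rewrite mulKg E1 iter_rot60N ?addn0.
Qed.

Lemma acts_as_zpow p v (a : int) : acts_as p v 0 -> acts_as (zpow p a) (v *~ a)%R 0.
Proof.
have acts_as_expg (w : point) p1 n : acts_as p1 w 0 -> acts_as (p1 ^+ n) (w *+ n)%R 0.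
  move=> wP; elim: n => [|n IH]; first by rewrite expg0 mulr0n; apply: acts_as1.
  by rewrite expgSr mulrS; apply: (acts_asM IH wP).
move=> vP; case: a => n /=; first by rewrite -pmulrn; apply: acts_as_expg.
by rewrite -expVgn NegzE mulrNz -mulNrz -pmulrn; apply/acts_as_expg/acts_asV.
Qed.

Lemma acts_as_sigma1 : acts_as s1 (unit_vec 1) 4.
Proof.
have [G0 G1] : r 0 \in Gamma Q /\ r 1 \in Gamma Q by split; apply: rho_Gamma.
split=> [|p0 v0 k0 p0G E]; first by rewrite groupM.
rewrite -mulgA; apply: rho_flagE => //; first by rewrite groupM.
have -> : (r 1 * p0) @: Phi = neg v0 k0.+1.
  by apply: rho_flagE => //; rewrite E; apply: (pos_adjacent1 hF rank_T).
have -> : (v0 + iter k0 rot60 (unit_vec 1) = v0 + unit_vec k0.+1)%R.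
  by rewrite /unit_vec -iterD addn1.
have -> : (k0 + 4 = k0.+1 + 3)%N by rewrite addSnnS.
exact: (neg_adjacent0 hF rank_T).
Qed.

Lemma acts_as_sigma2 : acts_as s2 0%R 5.
Proof.
have [G1 G2] : r 1 \in Gamma Q /\ r 2 \in Gamma Q by split; apply: rho_Gamma.
split=> [|p0 v0 k0 p0G E]; first by rewrite groupM.
rewrite -mulgA; apply: rho_flagE => //; first by rewrite groupM.
have -> : (r 2 * p0) @: Phi = neg v0 k0.
  by apply: rho_flagE => //; rewrite E; apply: (pos_adjacent2 hF rank_T).
by rewrite iter_rot60_0 addr0; apply: (neg_adjacent1 hF rank_T).
Qed.

Lemma acts_as_sigma2X n : acts_as (s2 ^+ n) 0%R (n * 5).
Proof.
elim: n => [|n IH]; first by rewrite expg0; apply: acts_as1.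
rewrite expgSr mulSnr -[0%R](addr0 0%R) -{2}(iter_rot60_0 5).
exact: acts_asM acts_as_sigma2.
Qed.

Lemma sigma2_expg6 : s2 ^+ 6 = 1.
Proof. exact: acts_as_inj (acts_as_sigma2X 6) acts_as1 _. Qed.

Lemma acts_as_sigma2V : acts_as s2^-1 0%R 1.
Proof.
have -> : s2^-1 = s2 ^+ 5 by apply: (mulgI s2); rewrite mulgV -expgS sigma2_expg6.
exact: acts_as_mod6 (acts_as_sigma2X 5).
Qed.

Lemma acts_as_sigma12 : acts_as (s1 * s2) (1, 0)%R 9.
Proof. exact: acts_asM acts_as_sigma1 acts_as_sigma2. Qed.

Lemma acts_as_unit_shift : acts_as (unit_shift s1 s2) (1, 0)%R 0.
Proof.
rewrite /unit_shift -mulgA; have := acts_asM (acts_as_sigma2X 3) acts_as_sigma12.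
by rewrite iter_rot60_0 addr0; apply: acts_as_mod6.
Qed.

Lemma acts_as_conj p v : acts_as p v 0 -> acts_as (p ^ s2^-1) (rot60 v) 0.
Proof.
move=> pP; rewrite conjgE invgK.
have := acts_asM acts_as_sigma2 (acts_asM pP acts_as_sigma2V).
by rewrite iter_rot60_0 addr0 /= add0r; apply: acts_as_mod6.
Qed.

Lemma sigma_hex_action : hex_action s2^-1 (unit_shift s1 s2).
Proof.
have shiftP := acts_as_unit_shift; have shiftJ := acts_as_conj shiftP.
split.
- have := acts_asM shiftJ shiftP; rewrite /= addrC => shift_comm.
  exact: acts_as_inj (acts_asM shiftP shiftJ) shift_comm _.
- rewrite expg2 conjgM.
  exact: acts_as_inj (acts_as_conj shiftJ) (acts_asM (acts_asV shiftP) shiftJ) _.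
- by rewrite expVgn sigma2_expg6 invg1.
Qed.

Lemma acts_as_facet_tr v : acts_as (facet_tr s1 s2 v) v 0.
Proof.
have shiftP := acts_as_unit_shift.
have := acts_asM (acts_as_zpow v.1 shiftP) (acts_as_zpow v.2 (acts_as_conj shiftP)).
suff -> : (rot60 (1, 0) *~ v.2 + iter 0 rot60 ((1, 0) *~ v.1) = v)%R by [].
by case: v => a b; rewrite /= /rot60 /= !mulpE addpE !mul1r !mul0r addr0 add0r.
Qed.

Lemma facet_tr_eq1 v : facet_tr s1 s2 v = 1 <-> in_lattice u v.
Proof.
split=> [E|uv]; last first.
  by apply: acts_as_eq (acts_as_facet_tr v) acts_as1 _ _; rewrite ?subr0.
have := acts_as_vertex (acts_as_facet_tr v); rewrite E perm1.
by move=> /esym/(vertex_lattice hF); rewrite subr0.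
Qed.

Lemma facet_tr_vertex v : facet_tr s1 s2 v \in <<[set s2; s3]>> -> in_lattice u v.
Proof.
pose x0 := h (TVertex 0); have rx0 : rank x0 = 0%R by rewrite (chart_rankE hF).
have x0Phi : x0 \in Phi by rewrite Phi_pos; apply: (@mem_chart_flag _ _ _ 1).
have fix_r i : (0 < i < 4)%N -> r i x0 = x0.
  case/andP=> i0 i4; apply: rho_fix_face => //; rewrite rx0.
  by case: i i0 {i4}.
move=> trK; have /astab1P : facet_tr s1 s2 v \in 'C[x0 | 'P].
  move: trK; apply/subsetP; rewrite gen_subG; apply/subsetP=> p.
  by case/set2P=> ->; apply/astab1P; rewrite /= /aperm permM !fix_r.
rewrite /= /aperm (acts_as_vertex (acts_as_facet_tr v)) => /(vertex_lattice hF).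
by rewrite subr0.
Qed.

Lemma sigma_relations :
  [/\ s1 ^+ 3 = 1, (s1 * s2) ^+ 2 = 1 & (s1 * s2 * s3) ^+ 2 = 1].
Proof.
split.
- by apply: acts_as_inj (acts_asM acts_as_sigma1
    (acts_asM acts_as_sigma1 acts_as_sigma1)) acts_as1 _.
- by apply: acts_as_inj (acts_asM acts_as_sigma12 acts_as_sigma12) acts_as1 _.
have rr i : (i < 4)%N -> r i * r i = 1 by apply: rho_mul_rho.
have -> : s1 * s2 * s3 = r 0 * r 3.
  rewrite /sigma /= -!mulgA (mulgA (r 1)) rr // mul1g.
  by rewrite (mulgA (r 2)) rr // mul1g.
rewrite expg2 {1}(rho_comm Phi_flag Q_regular (i := 0) (j := 3)) //.
by rewrite -mulgA (mulgA (r 0)) rr // mul1g rr.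
Qed.

End RotationAction.
End Facet.

Lemma regular_rotation_system (Q : polytope 4) (Phi : {set Q}) (u : point) :
  flag Phi -> regular Q -> self_dual Q -> has_facets Q (@map36 u) ->
  exists d, rotation_system (sigma Phi 1) (sigma Phi 2) (sigma Phi 3) d (in_lattice u).
Proof.
move=> fPhi regQ sdQ facets.
have [d dd dPhi] := duality_fixing_flag fPhi regQ sdQ.
have [F FPhi rF] := flag_face_nat (isT : (3 < 4)%N) fPhi.
have [T TPhi rT] := flag_face (i := 4%:Z) fPhi isT.
have [h0 h0F] := facet_chart_exists rF facets.
have [g gG gPhi] := regular_flag_trans regQ (flag_pos h0F rT 0 0) fPhi.
have hF := facet_chart_Gamma gG h0F.
have Phi_pos : Phi = chart_flag (fun f => g (h0 f)) T (pos_flag 0 0).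
  rewrite -gPhi /chart_flag imsetU1 -imset_comp; congr (_ |: _).
  by apply/le_anti; rewrite !greatest_of_rank ?Gamma_rank.
have [s1_cube s12_sqr s123_sqr] := sigma_relations fPhi regQ hF rT Phi_pos.
have s_dual i j := sigma_duality fPhi regQ dd dPhi (i := i) (j := j).
exists d; split=> //; try by apply: s_dual.
- exact: sigma_hex_action hF rT Phi_pos.
- exact: facet_tr_eq1 hF rT Phi_pos.
- exact: facet_tr_vertex hF rT Phi_pos.
Qed.

(** * Sublattices of the triangular lattice *)

Lemma in_lattice_unit (v : point) : in_lattice (1, 0) v.
Proof.
case: v => v1 v2; exists v1, v2.
by rewrite /rot60 /= !mulpE addpE !mul1r !mul0r addr0 add0r.
Qed.

Lemma in_lattice_mulz (u v : point) (m : int) :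
  in_lattice (u *~ m) v <-> exists2 w, in_lattice u w & v = w *~ m.
Proof.
have rot60_mulz : rot60 (u *~ m) = rot60 u *~ m.
  by case: u => a b; rewrite /rot60 !mulpE /= mulNr mulrDl.
split=> [[r [s ->]]|[_ [r [s ->]] ->]].
  exists (u *~ r + rot60 u *~ s); first by exists r, s.
  by rewrite rot60_mulz mulrzDl ![_ *~ m *~ _]mulrzAC.
by exists r, s; rewrite rot60_mulz mulrzDl ![_ *~ m *~ _]mulrzAC.
Qed.

Section EisensteinPrime.
Variables (p b c : nat).
Hypotheses (p_prime : prime p) (b_gt0 : (0 < b)%N) (c_gt0 : (0 < c)%N)
  (p_eq : p = (b ^ 2 + b * c + c ^ 2)%N).

Lemma eisenstein_normE : p%:Z = b%:Z ^+ 2 + b%:Z * c%:Z + c%:Z ^+ 2.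
Proof. by rewrite p_eq !PoszD !PoszM !expr2 -!PoszM. Qed.

Lemma Euclid_dvdzM (x y : int) : (p%:Z %| x * y)%Z = (p%:Z %| x)%Z || (p%:Z %| y)%Z.
Proof. by rewrite !dvdzE abszM Euclid_dvdM. Qed.

Lemma prime_ndvd_coef : ~~ (p %| c)%N.
Proof.
apply/negP=> /(dvdn_leq c_gt0); rewrite p_eq; apply/negP; rewrite -ltnNge.
by move: b_gt0 c_gt0; clear; nia.
Qed.

(* The inverse of the matrix [[b, - c], [c, b + c]] of determinant [p]. *)
Lemma in_lattice_prime (v : point) :
  in_lattice (b%:Z, c%:Z) v <-> (p%:Z %| c%:Z * v.1 - b%:Z * v.2)%Z.
Proof.
have pE := eisenstein_normE; case: v => v1 v2 /=; split=> [[r [s]]|].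
  rewrite /rot60 !mulpE addpE /= => -[-> ->].
  by apply/dvdzP; exists (- s); rewrite pE; ring.
case/dvdzP=> k kE.
have : (p%:Z %| c%:Z * ((b%:Z + c%:Z) * v1 + c%:Z * v2))%Z.
  apply/dvdzP; exists ((b%:Z + c%:Z) * k + v2).
  have -> : c%:Z * ((b%:Z + c%:Z) * v1 + c%:Z * v2)
    = (b%:Z + c%:Z) * (c%:Z * v1 - b%:Z * v2) + v2 * p%:Z by rewrite pE; ring.
  by rewrite kE; ring.
rewrite Euclid_dvdzM dvdzE /= (negPf prime_ndvd_coef) => /dvdzP[l lE].
have p0 : p%:Z != 0 by rewrite eqz_nat -lt0n prime_gt0.
exists l, (- k); rewrite /rot60 /= !mulpE addpE /=; congr pair; apply: (mulIf p0).
  have -> : (b%:Z * l + - c%:Z * - k) * p%:Z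
    = b%:Z * (l * p%:Z) + c%:Z * (k * p%:Z) by ring.
  by rewrite -kE -lE pE; ring.
have -> : (c%:Z * l + (b%:Z + c%:Z) * - k) * p%:Z
  = c%:Z * (l * p%:Z) - (b%:Z + c%:Z) * (k * p%:Z) by ring.
by rewrite -kE -lE pE; ring.
Qed.

Lemma lattice_prime_generator : in_lattice (b%:Z, c%:Z) (b%:Z, c%:Z).
Proof. by apply/in_lattice_prime; rewrite /= mulrC subrr dvdz0. Qed.

Lemma lattice_prime_unit : ~ in_lattice (b%:Z, c%:Z) (1, 0).
Proof.
move/in_lattice_prime; rewrite /= mulr1 mulr0 subr0 dvdzE.
exact/negP/prime_ndvd_coef.
Qed.

(* [4 p = (2 b + c) ^ 2 + 3 c ^ 2]. *)
Lemma lattice_prime_mirror : ~~ (p %| 3)%N ->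
  ~ in_lattice (b%:Z, c%:Z) (- b%:Z - c%:Z, c%:Z).
Proof.
move=> p_ndvd3; move/in_lattice_prime => /=.
have -> : c%:Z * (- b%:Z - c%:Z) - b%:Z * c%:Z = - (c%:Z * (2 * b%:Z + c%:Z)) by ring.
rewrite rpredN Euclid_dvdzM dvdzE /= (negPf prime_ndvd_coef) /= => p_dvd.
have : (p%:Z %| 3 * (c%:Z * c%:Z))%Z.
  have -> : 3 * (c%:Z * c%:Z) = 4 * p%:Z - (2 * b%:Z + c%:Z) * (2 * b%:Z + c%:Z).
    by rewrite eisenstein_normE; ring.
  by rewrite rpredB // ?dvdz_mull // dvdz_mulr.
by rewrite !Euclid_dvdzM !dvdzE /= (negPf prime_ndvd_coef) (negPf p_ndvd3).
Qed.

Variable m : int.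

Lemma lattice_prime_mulz (w : point) :
  in_lattice (b%:Z, c%:Z) (w *~ m) <-> (p%:Z %| m)%Z \/ in_lattice (b%:Z, c%:Z) w.
Proof.
rewrite !in_lattice_prime; case: w => w1 w2; rewrite mulpE /= !mulrA -mulrBl.
by rewrite Euclid_dvdzM orbC; split=> /orP.
Qed.

Lemma lattice_prime_cap_dvd (v : point) : (p%:Z %| m)%Z ->
  (in_lattice (b%:Z, c%:Z) v /\ in_lattice (m, 0) v) <-> in_lattice (m, 0) v.
Proof.
have -> : (m, 0) = (1, 0) *~ m :> point by rewrite mulpE mul1r mul0r.
move=> pm; split=> [[]//|vm]; split=> //.
by have /in_lattice_mulz[w _ ->] := vm; apply/lattice_prime_mulz; left.
Qed.

Lemma lattice_prime_cap_ndvd (v : point) : ~~ (p%:Z %| m)%Z ->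
  (in_lattice (b%:Z, c%:Z) v /\ in_lattice (m, 0) v) <->
  in_lattice (m * b%:Z, m * c%:Z) v.
Proof.
have -> : (m, 0) = (1, 0) *~ m :> point by rewrite mulpE mul1r mul0r.
have -> : (m * b%:Z, m * c%:Z) = (b%:Z, c%:Z) *~ m :> point.
  by rewrite mulpE ![_ * m]mulrC.
move=> /negP pm; rewrite !in_lattice_mulz; split=> [[Lv [w _ vE]]|[w Lw ->]].
  by exists w => //; move: Lv; rewrite vE => /lattice_prime_mulz[].
split; first by apply/lattice_prime_mulz; right.
by exists w => //; apply: in_lattice_unit.
Qed.

End EisensteinPrime.

(** * Projective special linear groups *)

Lemma exists_expr_neq1 (F : finFieldType) n : (0 < n)%N -> (n.+1 < #|F|)%N ->
  exists2 x : F, x != 0 & x ^+ n != 1.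
Proof.
move=> n_gt0 ltnF; pose P : {poly F} := 'X^n - 1.
have sizeP : size P = n.+1 by rewrite size_XnsubC.
apply/exists_inP; apply: contraT; rewrite negb_exists_in => /forall_inP all1.
have rootP : seq.all (root P) (enum (predC1 (0 : F))).
  apply/allP=> x; rewrite mem_enum => /all1; rewrite negbK => /eqP x1.
  by rewrite /root !hornerE x1 subrr.
have P_neq0 : P != 0 by rewrite -size_poly_gt0 sizeP.
have := max_poly_roots P_neq0 rootP (enum_uniq _).
rewrite sizeP -cardE cardC1 prednK; last exact: leq_trans ltnF.
by rewrite leqNgt ltnF.
Qed.

Lemma exists_sqrtN1 (F : finFieldType) : (4 %| #|F|.-1)%N ->
  exists i : F, i * i = -1.
Proof.
move=> /dvdnP[k kE]; have F_gt1 := finNzRing_gt1 F.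
have k_gt0 : (0 < k)%N.
  by case: k kE => // F1; move: F_gt1; rewrite -subn_gt0 subn1 F1.
have [||x x0 x_neq1] := @exists_expr_neq1 F (k * 2); first by rewrite muln_gt0 k_gt0.
  by rewrite -(prednK (ltnW F_gt1)) kE; move: k_gt0; clear; lia.
exists (x ^+ k); have x4 : x ^+ (k * 4) = 1.
  apply: (mulfI x0); rewrite -exprS mulr1 -kE prednK ?(ltnW F_gt1) //.
  exact: expf_card.
have : (x ^+ (k * 2) - 1) * (x ^+ (k * 2) + 1) == 0.
  by rewrite -subr_sqr expr1n -exprM -mulnA x4 subrr.
rewrite mulf_eq0 subr_eq0 (negPf x_neq1) /= addr_eq0 => /eqP <-.
by rewrite -exprD addnn -muln2.
Qed.

Section PSL2.
Variable F : finFieldType.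
Implicit Types (a b c d u v x y : F) (g : {'GL_2[F]}).

Definition mx2 a b c d : 'M[F]_2 :=
  \matrix_(i < 2, j < 2) if i == 0 then (if j == 0 then a else b)
                         else (if j == 0 then c else d).

Lemma mx2M a b c d a' b' c' d' : mx2 a b c d *m mx2 a' b' c' d' =
  mx2 (a * a' + b * c') (a * b' + b * d') (c * a' + d * c') (c * b' + d * d').
Proof.
apply/matrixP=> i j; rewrite !mxE big_ord_recl big_ord1 !mxE /=.
by case: (i == 0); case: (j == 0).
Qed.

Lemma det_mx2 a b c d : \det (mx2 a b c d) = a * d - b * c.
Proof.
rewrite (expand_det_row _ 0) big_ord_recl big_ord1 /cofactor !det_mx11 !mxE /=.
by ring.
Qed.

Lemma mx2_eta (A : 'M[F]_2) : A = mx2 (A 0 0) (A 0 1) (A 1 0) (A 1 1).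
Proof.
apply/matrixP=> i j; rewrite !mxE.
by case: i => -[|[|//]] ii; case: j => -[|[|//]] jj; congr (A _ _); apply: val_inj.
Qed.

Lemma mx2_inj a b c d a' b' c' d' : mx2 a b c d = mx2 a' b' c' d' ->
  [/\ a = a', b = b', c = c' & d = d'].
Proof.
move/matrixP=> E; have := E 0 0; have := E 0 1; have := E 1 0; have := E 1 1.
by rewrite !mxE.
Qed.

Definition gl2 a b c d : {'GL_2[F]} := insubd (1%g : {'GL_2[F]}) (mx2 a b c d).

Lemma gl2E a b c d : a * d - b * c != 0 -> GLval (gl2 a b c d) = mx2 a b c d.
Proof. by move=> nz; apply: insubdK; rewrite -topredE /= unitmxE det_mx2 unitfE. Qed.

Lemma gl2P g : exists a b c d, a * d - b * c != 0 /\ g = gl2 a b c d.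
Proof.
exists (GLval g 0 0), (GLval g 0 1), (GLval g 1 0), (GLval g 1 1).
have nz : \det (GLval g) != 0 by apply: GL_det.
rewrite [GLval g]mx2_eta det_mx2 in nz; split=> //.
by apply: val_inj; rewrite -[RHS]/(GLval _) gl2E // -mx2_eta.
Qed.

Lemma gl2M a b c d a' b' c' d' : a * d - b * c != 0 -> a' * d' - b' * c' != 0 ->
  (gl2 a b c d * gl2 a' b' c' d')%g =
  gl2 (a * a' + b * c') (a * b' + b * d') (c * a' + d * c') (c * b' + d * d').
Proof.
move=> nz nz'; apply: val_inj.
rewrite -[LHS]/(GLval _) -[RHS]/(GLval _) GL_MxE !gl2E //; first exact: mx2M.
by rewrite -det_mx2 -mx2M det_mulmx !det_mx2 mulf_neq0.
Qed.

Lemma gl2_1 : gl2 1 0 0 1 = 1%g.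
Proof.
apply: val_inj; rewrite -[LHS]/(GLval _) -[RHS]/(GLval _) gl2E.
  by rewrite -[RHS]/(1 : 'M_2) [RHS]mx2_eta !mxE.
by rewrite mulr1 mulr0 subr0 oner_eq0.
Qed.

Lemma gl2_inj a b c d a' b' c' d' : a * d - b * c != 0 -> a' * d' - b' * c' != 0 ->
  gl2 a b c d = gl2 a' b' c' d' -> [/\ a = a', b = b', c = c' & d = d'].
Proof. by move=> nz nz' /(congr1 (@GLval _ _)); rewrite !gl2E //; apply: mx2_inj. Qed.

(** [SL2_over 'F_p] is convertible to [SL2 p], and likewise for [PSL2_over]. *)
Definition SL2_over : {set {'GL_2[F]}} := [set g : {'GL_2[F]} | \det (GLval g) == 1].

Lemma SL2_over_group_set : group_set SL2_over.
Proof.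
apply/group_setP; split=> [|g h]; first by rewrite inE /= det1.
by rewrite !inE GL_MxE det_mulmx => /eqP-> /eqP->; rewrite mulr1.
Qed.

Canonical SL2_over_group : {group {'GL_2[F]}} := Group SL2_over_group_set.

(** The equation [a * d - b * c = 1] is stated as [a * d = 1 + b * c], which
    [ring] can use as a rewrite rule. *)
Lemma det1_neq0 a b c d : a * d = 1 + b * c -> a * d - b * c != 0.
Proof. by move->; rewrite addrK oner_eq0. Qed.

Lemma det1M a b c d a' b' c' d' : a * d = 1 + b * c -> a' * d' = 1 + b' * c' ->
  (a * a' + b * c') * (c * b' + d * d') = 1 + (a * b' + b * d') * (c * a' + d * c').
Proof. by move=> D D'; ring: D D'. Qed.

Lemma det1_upper x : 1 * 1 = 1 + x * 0 :> F.
Proof. by rewrite mulr0 addr0 mulr1. Qed.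

Lemma det1_lower x : 1 * 1 = 1 + 0 * x :> F.
Proof. by rewrite mul0r addr0 mulr1. Qed.

Lemma det1_N1 : -1 * -1 = 1 + 0 * 0 :> F.
Proof. by ring. Qed.

Lemma gl2_SL2 a b c d : a * d = 1 + b * c -> gl2 a b c d \in SL2_over.
Proof. by move=> D; rewrite inE gl2E ?det1_neq0 // det_mx2 D addrK. Qed.

Lemma SL2P g : g \in SL2_over -> exists a b c d, a * d = 1 + b * c /\ g = gl2 a b c d.
Proof.
have [a [b [c [d [nz ->]]]]] := gl2P g.
by rewrite inE gl2E // det_mx2 subr_eq => /eqP D; exists a, b, c, d.
Qed.

Local Notation Z := 'Z(SL2_over)%g.

Lemma scalar_det1 a d : a = d -> a * d = 1 + 0 * 0 -> a = 1 \/ a = -1.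
Proof.
move=> <- D; have : (a - 1) * (a + 1) == 0 by apply/eqP; ring: D.
by rewrite mulf_eq0 subr_eq0 addr_eq0 => /orP[] /eqP->; [left|right].
Qed.

(* The centre is determined by commutation with the two elementary matrices. *)
Lemma center_SL2 g : g \in Z -> g = 1%g \/ g = gl2 (-1) 0 0 (-1).
Proof.
case/centerP=> /SL2P[a [b [c [d [D ->]]]]] cent; have nz := det1_neq0 D.
have upper := cent _ (gl2_SL2 (det1_upper 1)).
have lower := cent _ (gl2_SL2 (det1_lower 1)).
have nzU := det1_neq0 (det1_upper 1); have nzL := det1_neq0 (det1_lower 1).
move: upper lower; rewrite /commute !(gl2M nz) // !(gl2M _ nz) // => upper lower.
have [E1 E2 _ _] := gl2_inj (det1_neq0 (det1M D (det1_upper 1)))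
  (det1_neq0 (det1M (det1_upper 1) D)) upper.
have [E3 _ _ _] := gl2_inj (det1_neq0 (det1M D (det1_lower 1)))
  (det1_neq0 (det1M (det1_lower 1) D)) lower.
have c0 : c = 0 by apply: (addrI a); move: E1; rewrite !mulr1 !mulr0 !mul1r !addr0.
have b0 : b = 0 by apply: (addrI a); move: E3; rewrite !mulr1 !mul0r !mul1r !addr0.
have ad : a = d by move: E2; rewrite b0 !mulr1 !mul1r addr0 add0r.
rewrite b0 c0 in D *; rewrite -ad in D *.
by have [->|->] := scalar_det1 erefl D; [left; apply: gl2_1|right].
Qed.

Lemma commute_N1 g : commute g (gl2 (-1) 0 0 (-1)).
Proof.
have [a [b [c [d [nz ->]]]]] := gl2P g.
rewrite /commute (gl2M nz (det1_neq0 det1_N1)) (gl2M (det1_neq0 det1_N1) nz).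
by congr gl2; ring.
Qed.

Lemma N1_center : gl2 (-1) 0 0 (-1) \in Z.
Proof.
apply/centerP; split=> [|g _]; first exact/gl2_SL2/det1_N1.
exact/commute_sym/commute_N1.
Qed.

Lemma norm_center_SL2 g : g \in 'N(Z)%g.
Proof.
apply: (subsetP (cent_sub Z)); apply/centP=> z /center_SL2[->|->].
  exact: commute1.
exact: commute_N1.
Qed.

Definition PSL2_over : {set coset_of Z} := (SL2_over / Z)%g.

Canonical PSL2_over_group : {group coset_of Z} :=
  Eval hnf in [group of PSL2_over].

Lemma card_SL2_over : #|SL2_over| = (#|F| * (#|F| ^ 2 - 1))%N.
Proof.
pose detu g : {unit F} := insubd (1%g : {unit F}) (\det (GLval g)).
have detuE g : val (detu g) = \det (GLval g).
  have nz : \det (GLval g) != 0 by apply: GL_det.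
  by apply: insubdK; rewrite -topredE /= unitfE.
have detuM : {in [set: {'GL_2[F]}] &, {morph detu : g h / (g * h)%g}}.
  by move=> g h _ _; apply: val_inj; rewrite /= !detuE GL_MxE det_mulmx.
pose f := Morphism detuM.
have kerf : ('ker f = SL2_over)%g.
  apply/setP=> g; rewrite !inE /=; apply/eqP/eqP => [/(congr1 val)|E].
    by rewrite /= detuE.
  by apply: val_inj; rewrite /= detuE.
have imf : (f @* setT = setT)%g.
  apply/setP=> z; rewrite inE; apply/morphimP.
  have z0 : val z != 0 by rewrite -unitfE (valP z).
  have nz : val z * 1 - 0 * 0 != 0 by rewrite mulr1 mulr0 subr0.
  exists (gl2 (val z) 0 0 1) => //; apply: val_inj.
  by rewrite /= detuE gl2E // det_mx2 mulr1 mulr0 subr0.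
have : (#|SL2_over| * #|F|.-1 = #|F| * #|F|.-1 ^ 2 * #|F|.+1)%N.
  rewrite -card_GL_2 -card_finField_unit -imf card_morphim setIT -kerf.
  exact: (Lagrange (subsetT ('ker f)%G)).
have := finNzRing_gt1 F; move: #|SL2_over| => n; case: #|F| => [|[|q]] //= _.
by move: n q; clear; nia.
Qed.

Lemma dvdn_card_PSL2_over : (#|F| * (#|F| ^ 2 - 1) %| 2 * #|PSL2_over|)%N.
Proof.
have nZ : SL2_over \subset 'N(Z)%g by apply/subsetP=> g _; apply: norm_center_SL2.
rewrite -card_SL2_over -(Lagrange (center_sub SL2_over_group)) -(card_quotient nZ).
apply: dvdn_mul => //.
have : (#|Z| <= 2)%N.
  apply: (@leq_trans #|[set (1%g : {'GL_2[F]}); gl2 (-1) 0 0 (-1)]|).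
    by apply/subset_leq_card/subsetP=> z /center_SL2[]->; rewrite !inE eqxx ?orbT.
  by rewrite cards2 ltnS leq_b1.
by have := cardG_gt0 Z; case: #|Z| => [|[|[|]]].
Qed.

Definition pmx a b c d : coset_of Z := coset Z (gl2 a b c d).
Arguments pmx (a b c d)%_ring_scope.

Lemma pmx_PSL2 a b c d : a * d = 1 + b * c -> pmx a b c d \in PSL2_over.
Proof. by move=> D; apply: mem_quotient; apply: gl2_SL2. Qed.

Lemma PSL2P (t : coset_of Z) : t \in PSL2_over ->
  exists a b c d, a * d = 1 + b * c /\ t = pmx a b c d.
Proof.
case/morphimP=> g _ /SL2P[a [b [c [d [D ->]]]]] ->.
by exists a, b, c, d.
Qed.

Lemma coset_centerM g h : coset Z (g * h)%g = (coset Z g * coset Z h)%g.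
Proof. by rewrite morphM ?norm_center_SL2. Qed.

Lemma pmxM a b c d a' b' c' d' a2 b2 c2 d2 :
  a * d = 1 + b * c -> a' * d' = 1 + b' * c' ->
  a * a' + b * c' = a2 -> a * b' + b * d' = b2 ->
  c * a' + d * c' = c2 -> c * b' + d * d' = d2 ->
  (pmx a b c d * pmx a' b' c' d')%g = pmx a2 b2 c2 d2.
Proof.
by move=> /det1_neq0 D /det1_neq0 D' <- <- <- <-;
  rewrite /pmx -coset_centerM (gl2M D D').
Qed.

Lemma pmx1 : pmx 1 0 0 1 = 1%g.
Proof. by rewrite /pmx gl2_1 morph1. Qed.

Lemma pmxN1 : pmx (-1) 0 0 (-1) = 1%g.
Proof. exact: coset_id N1_center. Qed.

Lemma pmx_eq a b c d a' b' c' d' : a * d = 1 + b * c -> a' * d' = 1 + b' * c' ->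
  pmx a b c d = pmx a' b' c' d' ->
  [/\ a = a', b = b', c = c' & d = d'] \/
  [/\ a = - a', b = - b', c = - c' & d = - d'].
Proof.
move=> D D' E.
have : gl2 a b c d \in (coset Z (gl2 a' b' c' d') : {set _}).
  by rewrite -[coset _ _]E /pmx val_coset ?norm_center_SL2 // rcoset_refl.
rewrite val_coset ?norm_center_SL2 // => /rcosetP[z /center_SL2[]->].
  by rewrite mul1g => E2; left; apply: gl2_inj E2; apply: det1_neq0.
rewrite (gl2M (det1_neq0 det1_N1) (det1_neq0 D')) => E2; right.
have [-> -> -> ->] := gl2_inj (det1_neq0 D) (det1_neq0 (det1M det1_N1 D')) E2.
by split; ring.
Qed.

Lemma pmx_conj_antidiag a b c d y : y != 0 -> a * d = 1 + b * c ->
  (pmx a b c d ^ pmx 0 1 y 0)%g = pmx d (c / y) (b * y) a.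
Proof.
move=> y0 D; apply: (mulgI (pmx 0 1 y 0)); rewrite -conjgC.
have Dy : 0 * 0 - 1 * y != 0 by rewrite mul0r add0r mul1r oppr_eq0.
have D1 : d * a = 1 + c / y * (b * y) by rewrite mulrC D; field.
rewrite /pmx -!coset_centerM (gl2M (det1_neq0 D) Dy) (gl2M Dy (det1_neq0 D1)).
by congr (coset _ (gl2 _ _ _ _)); field.
Qed.

Local Opaque pmx.

Lemma pmxV a b c d : a * d = 1 + b * c -> (pmx a b c d)^-1%g = pmx d (- b) (- c) a.
Proof.
move=> D; apply: (mulgI (pmx a b c d)); rewrite mulgV -pmx1.
by apply/esym/pmxM; ring: D.
Qed.

Lemma pmx_conj_diag a b c d u v : u * v = 1 -> a * d = 1 + b * c ->
  (pmx a b c d ^ pmx u 0 0 v)%g = pmx a (b * v ^+ 2) (c * u ^+ 2) d.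
Proof.
move=> uv D; apply: (mulgI (pmx u 0 0 v)); rewrite -conjgC.
rewrite (pmxM (a2 := a * u) (b2 := b * v) (c2 := c * u) (d2 := d * v));
  try by ring: D uv.
by apply/esym/pmxM; ring: D uv.
Qed.

Definition upper x : coset_of Z := pmx 1 x 0 1.
Definition lower x : coset_of Z := pmx 1 0 x 1.
Arguments upper x%_ring_scope.
Arguments lower x%_ring_scope.

Lemma upperD x y : (upper x * upper y)%g = upper (x + y).
Proof. by apply: pmxM; ring. Qed.

Lemma lowerD x y : (lower x * lower y)%g = lower (x + y).
Proof. by apply: pmxM; ring. Qed.

Lemma upper0 : upper 0 = 1%g. Proof. exact: pmx1. Qed.
Lemma lower0 : lower 0 = 1%g. Proof. exact: pmx1. Qed.

Lemma upperN x : upper (- x) = (upper x)^-1%g.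
Proof. by apply: (mulgI (upper x)); rewrite mulgV upperD subrr upper0. Qed.

Lemma upper_expg x (n : nat) : (upper x ^+ n)%g = upper (x *+ n).
Proof. by elim: n => [|n IH]; rewrite ?expg0 ?upper0 // expgS IH upperD mulrS. Qed.

Lemma lower_expg x (n : nat) : (lower x ^+ n)%g = lower (x *+ n).
Proof. by elim: n => [|n IH]; rewrite ?expg0 ?lower0 // expgS IH lowerD mulrS. Qed.

Lemma zpow_upper x (a : int) : zpow (upper x) a = upper (x *~ a).
Proof.
case: a => n /=; first by rewrite upper_expg pmulrn.
by rewrite upper_expg -upperN NegzE mulrNz -pmulrn.
Qed.

Lemma upper_inj : injective upper.
Proof.
move=> x y /(pmx_eq (det1_upper x) (det1_upper y))[[]|[E1 xNy _ _]] //.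
by rewrite xNy -mulN1r -E1 mul1r.
Qed.

Lemma lower_conj_weyl x : (lower x ^ pmx 0 1 (-1) 0)%g = upper (- x).
Proof.
rewrite (pmx_conj_antidiag _ (det1_lower x)) ?oppr_eq0 ?oner_eq0 //.
by congr pmx; [rewrite invrN1 mulrN1|rewrite mul0r].
Qed.

Lemma weyl_PSL2 : pmx 0 1 (-1) 0 \in PSL2_over.
Proof. by apply: pmx_PSL2; ring. Qed.

Lemma PSL2_sub_unipotent (N : {group coset_of Z}) :
  (forall x, upper x \in N) -> (forall x, lower x \in N) -> PSL2_over \subset N.
Proof.
move=> upper_in lower_in; apply/subsetP=> t /PSL2P[a [b [c [d [D ->]]]]].
have mem_c_neq0 a' b' c' d' : a' * d' = 1 + b' * c' -> c' != 0 ->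
    pmx a' b' c' d' \in N.
  move=> D' c0; have bE : b' = (a' * d' - 1) / c' by rewrite D' addrC addKr mulfK.
  have <- : (upper ((a' - 1) / c')%R * lower c' * upper ((d' - 1) / c')%R)%g
      = pmx a' b' c' d'.
    have -> : (upper ((a' - 1) / c')%R * lower c')%g = pmx a' ((a' - 1) / c')%R c' 1.
      by apply: pmxM; field.
    by apply: pmxM; rewrite ?bE; field.
  by rewrite !groupM.
have [c0|] := eqVneq c 0; last exact: mem_c_neq0.
have a0 : a != 0.
  by apply: contraTneq (oner_neq0 F) => a0; move: D;
    rewrite c0 a0 mul0r mulr0 addr0 => <-; rewrite eqxx.
have <- : (lower (-1) * (lower 1 * pmx a b c d))%g = pmx a b c d.
  by rewrite mulgA lowerD addNr lower0 mul1g.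
rewrite groupM // (_ : (_ * _)%g = pmx a b (a + c) (b + d)); last first.
  by apply: pmxM; ring: D.
by apply: mem_c_neq0; [ring: D|rewrite c0 addr0].
Qed.

Section NormalSubgroup.
Variable N : {group coset_of Z}.
Hypothesis nsN : (N <| PSL2_over)%g.

Lemma normal_memJ t s : t \in N -> s \in PSL2_over -> (t ^ s)%g \in N.
Proof. by move=> tN sP; rewrite memJ_norm // (subsetP (normal_norm nsN)). Qed.

Lemma normal_not_upper_triangular : (N :!=: 1)%g ->
  exists a b c d, [/\ a * d = 1 + b * c, c != 0 & pmx a b c d \in N].
Proof.
case/trivgPn=> t tN t1.
have [a [b [c [d [D tE]]]]] := PSL2P (subsetP (normal_sub nsN) t tN).
rewrite {}tE in tN t1.
have [c0|c0] := eqVneq c 0; last by exists a, b, c, d.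
have [b0|b0] := eqVneq b 0; last first.
  exists d, (c / -1), (b * -1), a; split; first by rewrite mulrC D c0; ring.
    by rewrite mulrN1 oppr_eq0.
  by rewrite -pmx_conj_antidiag ?oppr_eq0 ?oner_eq0 // normal_memJ ?weyl_PSL2.
rewrite {}b0 {}c0 in tN t1 D.
have ad : a != d.
  apply: contra t1 => /eqP ad; rewrite -ad in D *.
  by have [->|->] := scalar_det1 erefl D; rewrite (pmx1, pmxN1).
exists a, 0, (d - a), d; split; first by rewrite D; ring.
  by rewrite subr_eq0 eq_sym.
have := normal_memJ tN (pmx_PSL2 (det1_lower 1)); rewrite conjgE (pmxV (det1_lower 1)).
have -> : (pmx a 0 0 d * pmx 1 0 1 1)%g = pmx a 0 d d by apply: pmxM; ring: D.
have -> // : (pmx 1 (- 0) (- 1) 1 * pmx a 0 d d)%g = pmx a 0 (d - a) d.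
by apply: pmxM; ring: D.
Qed.

(* With [u] such that [u ^ 4 <> 1], the commutator of an antitriangular element
   with [diag(u, 1 / u)] is lower triangular, and the commutator of the latter
   with [lower 1] is [lower (u ^ 4 - 1)]. *)
Lemma normal_lower u : u != 0 -> u ^+ 4 != 1 -> (N :!=: 1)%g ->
  exists2 y, y != 0 & lower y \in N.
Proof.
move=> u0 u4 /normal_not_upper_triangular[a [b [c [d [D c0 tN]]]]].
set v := u^-1; have uv : u * v = 1 by rewrite mulfV.
have [e sN] : exists e, pmx 0 (- c^-1) c e \in N.
  exists (a + d); have := normal_memJ tN (pmx_PSL2 (det1_upper (a / c))).
  rewrite conjgE (pmxV (det1_upper _)) oppr0.
  have -> : (pmx a b c d * pmx 1 (a / c) 0 1)%g = pmx a (a / c * a + b) c (a + d).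
    by apply: pmxM; [exact: D|ring|ring|ring|ring|field].
  have bE : b = (a * d - 1) / c by rewrite D addrC addKr mulfK.
  by rewrite (_ : (_ * _)%g = pmx 0 (- c^-1) c (a + d)) //;
    apply: pmxM; rewrite ?bE; field.
have Ds : 0 * e = 1 + - c^-1 * c by field.
have [f rN] : exists f, pmx (v ^+ 2) 0 f (u ^+ 2) \in N.
  exists (c * e * (u ^+ 2 - 1)).
  have diag : pmx u 0 0 v \in PSL2_over by apply: pmx_PSL2; rewrite uv mulr0 addr0.
  have := groupM (normal_memJ sN diag) (groupVr sN).
  rewrite (pmx_conj_diag uv Ds) (pmxV Ds) opprK.
  by rewrite (_ : (_ * _)%g = pmx (v ^+ 2) 0 (c * e * (u ^+ 2 - 1)) (u ^+ 2)) //;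
    apply: pmxM; rewrite ?opprK /v; field; rewrite ?u0 ?c0.
have Dr : v ^+ 2 * u ^+ 2 = 1 + 0 * f by rewrite -exprMn mulrC uv expr1n mul0r addr0.
exists (u ^+ 4 - 1); first by rewrite subr_eq0.
have := groupM (normal_memJ rN (pmx_PSL2 (det1_lower 1))) (groupVr rN).
rewrite conjgE (pmxV (det1_lower 1)) (pmxV Dr) oppr0.
have -> : (pmx (v ^+ 2) 0 f (u ^+ 2) * pmx 1 0 1 1)%g =
    pmx (v ^+ 2) 0 (f + u ^+ 2) (u ^+ 2) by apply: pmxM; ring: Dr.
have -> : (pmx 1 0 (-1) 1 * pmx (v ^+ 2) 0 (f + u ^+ 2) (u ^+ 2))%g =
    pmx (v ^+ 2) 0 (f + u ^+ 2 - v ^+ 2) (u ^+ 2) by apply: pmxM; ring: Dr.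
by rewrite (_ : (_ * _)%g = lower (u ^+ 4 - 1)) //; apply: pmxM; ring: Dr.
Qed.

(* Conjugation by [diag(s, 1 / s)] multiplies the parameter by [s ^ 2], and every
   element of the field is a difference of two squares. *)
Lemma normal_all_lower y : 2%:R != 0 :> F -> y != 0 -> lower y \in N ->
  forall x, lower x \in N.
Proof.
move=> two_neq0 y0 yN x; have sqrN s : lower (y * s ^+ 2) \in N.
  have [->|s0] := eqVneq s 0; first by rewrite expr0n mulr0 lower0 group1.
  have ss : s * s^-1 = 1 by rewrite mulfV.
  have diag : pmx s 0 0 s^-1 \in PSL2_over by apply: pmx_PSL2; rewrite ss mulr0 addr0.
  by have := normal_memJ yN diag; rewrite (pmx_conj_diag ss (det1_lower y)) mul0r.
have -> : x = y * ((x / y + 1) / 2%:R) ^+ 2 + - (y * ((x / y - 1) / 2%:R) ^+ 2).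
  by field; rewrite y0 two_neq0.
have lowerN z : lower (- z) = (lower z)^-1%g.
  by apply: (mulgI (lower z)); rewrite mulgV lowerD subrr lower0.
by rewrite -lowerD groupM // lowerN groupV.
Qed.

Lemma normal_PSL2_sub : 2%:R != 0 :> F -> (5 < #|F|)%N -> (N :!=: 1)%g ->
  PSL2_over \subset N.
Proof.
move=> two_neq0 F_gt5 ntN; have [u u0 u4] := exists_expr_neq1 (isT : (0 < 4)%N) F_gt5.
have [y y0 yN] := normal_lower u0 u4 ntN.
have lowerN := normal_all_lower two_neq0 y0 yN.
apply: PSL2_sub_unipotent => // x.
by rewrite -[x]opprK -lower_conj_weyl normal_memJ ?weyl_PSL2.
Qed.

End NormalSubgroup.

Theorem simple_PSL2_over : 2%:R != 0 :> F -> (5 < #|F|)%N -> simple PSL2_over.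
Proof.
move=> two_neq0 F_gt5; apply/simpleP; split=> [|N nsN].
  apply/trivgPn; exists (upper 1); first exact: pmx_PSL2 (det1_upper 1).
  by rewrite -upper0 (inj_eq upper_inj) oner_eq0.
have [->|ntN] := eqVneq (N : {set _}) 1%g; [by left|right].
by apply/eqP; rewrite eqEsubset normal_sub // normal_PSL2_sub.
Qed.

End PSL2.

Section PSL2Rotations.
Variable F : finFieldType.
Local Notation Z := 'Z(SL2_over F)%g.
Local Opaque pmx.

Variables w i : F.
Hypothesis w_sqr : w * w = w - 1.
Hypothesis i_sqr : i * i = -1.
Hypothesis two_neq0 : 2%:R != 0 :> F.
Hypothesis three_neq0 : 3%:R != 0 :> F.

(* The diagonal entries of [psl_rot2] have ratio [w], so that conjugation by
   [psl_rot2] multiplies the parameter of [upper x] by a primitive sixth root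
   of unity. *)
Definition psl_rot1 : coset_of Z := pmx (- w) (1 - w) 0 (w - 1).
Definition psl_rot2 : coset_of Z := pmx (i * (w - 1)) 0 0 (i * w).
Definition psl_rot3 : coset_of Z := pmx (- w) 0 (2%:R * w - 1) (w - 1).
Definition psl_dual : coset_of Z := pmx 0 1 (2%:R - w) 0.
Local Notation s1 := psl_rot1.
Local Notation s2 := psl_rot2.
Local Notation s3 := psl_rot3.

Lemma det1_rot1 : - w * (w - 1) = 1 + (1 - w) * 0. Proof. by ring: w_sqr. Qed.
Lemma det1_rot2 : i * (w - 1) * (i * w) = 1 + 0 * 0. Proof. by ring: w_sqr i_sqr. Qed.
Lemma det1_rot3 : - w * (w - 1) = 1 + 0 * (2%:R * w - 1). Proof. by ring: w_sqr. Qed.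

Lemma prim6_root : 6.-primitive_root w.
Proof.
have w0 : w != 0.
  apply: contra_neq (oner_neq0 F) => w0.
  by have -> : 1 = w - w * w by [rewrite w_sqr; ring]; rewrite w0 mul0r subrr.
have w3 : w ^+ 3 = -1 by ring: w_sqr.
have w_neq1 : w != 1.
  apply: contraNneq w0 => w1; have := w_sqr; rewrite w1 mulr1 subrr => ->.
  exact: eqxx.
have wN1 : w != -1.
  apply: contraNneq three_neq0 => w_N1.
  have -> : 3%:R = w * w - (w - 1) :> F by rewrite w_N1; ring.
  by rewrite w_sqr subrr.
have w_2 : w != 2%:R.
  apply: contraNneq three_neq0 => wE.
  have -> : 3%:R = w * w - (w - 1) :> F by rewrite wE; ring.
  by rewrite w_sqr subrr.
apply/andP; split=> //; apply/forallP=> -[[|[|[|[|[|[|//]]]]]] lt6];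
  rewrite unity_rootE; apply/eqP; [apply: negbTE..|apply/eqP].
- by rewrite expr1.
- by rewrite expr2 w_sqr subr_eq.
- by rewrite w3 eq_sym -subr_eq0 opprK.
- by rewrite exprS w3 mulrN1 eqr_oppLR.
- rewrite (exprD _ 3 2) w3 expr2 w_sqr mulN1r opprB -subr_eq0 addrAC subrr.
  by rewrite sub0r oppr_eq0.
- by rewrite (exprM _ 3 2) w3 sqrrN expr1n.
Qed.

Lemma psl_rot12 : (s1 * s2)%g = pmx i i 0 (- i).
Proof. by apply: pmxM; ring: w_sqr i_sqr. Qed.

Lemma psl_rot2_cube : (s2 ^+ 3)%g = pmx (- i) 0 0 i.
Proof.
have sqr : (s2 * s2)%g = pmx w 0 0 (1 - w) by apply: pmxM; ring: w_sqr i_sqr.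
by rewrite expgSr expg2 sqr; apply: pmxM; ring: w_sqr i_sqr.
Qed.

Lemma psl_unit_shift : unit_shift s1 s2 = upper 1.
Proof.
by rewrite /unit_shift psl_rot2_cube -mulgA psl_rot12; apply: pmxM; ring: w_sqr i_sqr.
Qed.

Lemma psl_rot2V : s2^-1%g = pmx (i * w) 0 0 (i * (w - 1)).
Proof. by rewrite (pmxV det1_rot2) oppr0. Qed.

Lemma upper_conj_rot x : (upper x ^ s2^-1)%g = upper (w * x).
Proof.
have uv : i * w * (i * (w - 1)) = 1 by ring: w_sqr i_sqr.
rewrite psl_rot2V (pmx_conj_diag uv (det1_upper x)) mul0r.
by congr pmx; ring: w_sqr i_sqr.
Qed.

Lemma upper_conj_rotX x k : (upper x ^ (s2^-1 ^+ k))%g = upper (w ^+ k * x).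
Proof.
elim: k => [|k IH]; first by rewrite expg0 conjg1 expr0 mul1r.
by rewrite expgSr conjgM IH upper_conj_rot exprS mulrA.
Qed.

Lemma psl_rot2_expg6 : (s2 ^+ 6 = 1)%g.
Proof.
rewrite -[6%N]/(3 * 2)%N expgM psl_rot2_cube expg2 -pmxN1.
by apply: pmxM; ring: w_sqr i_sqr.
Qed.

Lemma psl_hex_action : hex_action s2^-1%g (upper 1).
Proof.
split.
- by rewrite upper_conj_rot /commute !upperD addrC.
- by rewrite upper_conj_rotX upper_conj_rot -upperN upperD; congr upper; ring: w_sqr.
- by rewrite expVgn psl_rot2_expg6 invg1.
Qed.

Lemma psl_hex_tr v : hex_tr s2^-1%g (upper 1) v = upper (v.1%:~R + w * v.2%:~R).
Proof. by rewrite /hex_tr upper_conj_rot !zpow_upper upperD mulr1 mulrzr. Qed.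

(* If the product of a rotation and a translation is trivial, then the rotation
   centralises the translations. *)
Lemma psl_faithful_rotations : faithful_rotations s2^-1%g (upper 1).
Proof.
move=> v k; rewrite /hex_elt psl_hex_tr; set y := _ + _ => elt1.
have rotE : (s2^-1 ^+ k)%g = upper (- y).
  by apply: (mulIg (upper y)); rewrite elt1 upperD addNr upper0.
have := upper_conj_rotX 1 k; rewrite rotE conjgE -upperN !upperD mulr1.
rewrite (prim_order_dvd prim6_root) => /upper_inj <-.
by apply/eqP; ring.
Qed.

Lemma psl_vertex_stab_lower (t : coset_of Z) : t \in <<[set s2; s3]>>%g ->
  exists a c d, a * d = 1 + 0 * c /\ t = pmx a 0 c d.
Proof.
case/gen_prodgP=> n [f fP ->]; elim: n f fP => [|n IH] f fP.
  by exists 1, 0, 1; rewrite big_ord0 pmx1; split=> //; ring.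
rewrite big_ord_recl.
have [a [c [d [D ->]]]] := IH (fun j => f (lift ord0 j)) (fun j => fP _).
have /set2P[] := fP ord0 => ->.
  exists (i * (w - 1) * a), (i * w * c), (i * w * d); split.
    by ring: w_sqr i_sqr D.
  by apply: pmxM => //; [exact: det1_rot2|..]; ring.
exists (- w * a), ((2%:R * w - 1) * a + (w - 1) * c), ((w - 1) * d); split.
  by ring: w_sqr D.
by apply: pmxM => //; [exact: det1_rot3|..]; ring.
Qed.

Lemma dual_coef_neq0 : 2%:R - w != 0.
Proof.
apply: contra three_neq0 => /eqP y0; apply/eqP.
have -> : 3%:R = (2%:R - w) * (1 + w) by ring: w_sqr.
by rewrite y0 mul0r.
Qed.

Lemma psl_rotation_system :
  rotation_system s1 s2 s3 psl_dual (fun v => v.1%:~R + w * v.2%:~R = 0).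
Proof.
have y0 := dual_coef_neq0; split; rewrite /facet_tr ?psl_unit_shift.
- rewrite expgSr expg2.
  have -> : (s1 * s1)%g = pmx (w - 1) (w - 1) 0 (- w) by apply: pmxM; ring: w_sqr.
  by rewrite -pmx1; apply: pmxM; ring: w_sqr.
- by rewrite psl_rot12 expg2 -pmxN1; apply: pmxM; ring: w_sqr i_sqr.
- rewrite psl_rot12 expg2.
  have -> : (pmx i i 0 (- i) * s3)%g =
      pmx (i * (w - 1)) (i * (w - 1)) (i * (1 - 2%:R * w)) (i * (1 - w)).
    by apply: pmxM; ring: w_sqr i_sqr.
  by rewrite -pmxN1; apply: pmxM; ring: w_sqr i_sqr.
- exact: psl_hex_action.
- by move=> v; rewrite psl_hex_tr; rewrite -upper0; split=> [/upper_inj|->].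
- move=> v; rewrite psl_hex_tr => /psl_vertex_stab_lower[a [c [d [D E]]]].
  by have [[_ -> _ _]|[_ -> _ _]] := pmx_eq (det1_upper _) D E; rewrite ?oppr0.
- rewrite (pmx_conj_antidiag y0 det1_rot1) (pmxV det1_rot3) oppr0 mul0r.
  by congr pmx; ring: w_sqr.
- by rewrite (pmx_conj_antidiag y0 det1_rot2) (pmxV det1_rot2) !mul0r oppr0.
- rewrite (pmx_conj_antidiag y0 det1_rot3) (pmxV det1_rot1) oppr0 mul0r.
  by congr pmx; apply: (mulIf y0); rewrite divfK //; ring: w_sqr.
Qed.

(* The dual of the unit translation [upper 1] is lower triangular. *)
Lemma psl_rotations_generate : (forall x : F, exists n : nat, x = n%:R) ->
  <<[set s1; s2; s3]>>%g = PSL2_over F.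
Proof.
move=> F_prime; pose H := <<[set s1; s2; s3]>>%G.
have [s1H s2H s3H] : [/\ s1 \in H, s2 \in H & s3 \in H].
  by split; rewrite mem_gen // !inE eqxx ?orbT.
have upperH : upper 1 \in H by rewrite -psl_unit_shift !groupM ?groupX.
have [_ _ _ _ _ _ s1d s2d s3d] := psl_rotation_system.
have lowerH : lower (2%:R - w) \in H.
  have -> : lower (2%:R - w) = (upper 1%R ^ psl_dual)%g.
    by rewrite (pmx_conj_antidiag dual_coef_neq0 (det1_upper 1)) mul0r mul1r.
  rewrite -psl_unit_shift 2!conjMg conjXg s1d s2d.
  by rewrite !groupM ?groupV // groupX // groupV.
apply/eqP; rewrite eqEsubset gen_subG; apply/andP; split.
  apply/subsetP=> t /setUP[/set2P[]->|/set1P->]; apply: pmx_PSL2.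
  - exact: det1_rot1.
  - exact: det1_rot2.
  - exact: det1_rot3.
have multiple (x y : F) : y != 0 -> exists n : nat, x = y *+ n.
  move=> y_neq0; have [n xyE] := F_prime (x / y); exists n.
  by rewrite -mulr_natr -xyE mulrC divfK.
apply: (@PSL2_sub_unipotent F H) => x.
  by have [n ->] := multiple x 1 (oner_neq0 F); rewrite -upper_expg groupX.
by have [n ->] := multiple x _ dual_coef_neq0; rewrite -lower_expg groupX.
Qed.

End PSL2Rotations.

Lemma PSL2_rotation_system (p b c : nat) : prime p -> p = 1 %[mod 12] ->
    (0 < b)%N -> (0 < c)%N -> p = (b ^ 2 + b * c + c ^ 2)%N ->
  exists s1 s2 s3 d : coset_of 'Z(SL2 p)%g,
  [/\ rotation_system s1 s2 s3 d (in_lattice (b%:Z, c%:Z)),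
      <<[set s1; s2; s3]>>%g = PSL2 p
    & faithful_rotations s2^-1%g (unit_shift s1 s2)].
Proof.
move=> p_pr p12 b0 c0 pE; have p_gt1 := prime_gt1 p_pr.
have natr_neq0 n : ~~ (p %| n)%N -> n%:R != 0 :> 'F_p.
  by rewrite (dvdn_pcharf (pchar_Fp p_pr)).
have small n : (0 < n < 13)%N -> n%:R != 0 :> 'F_p.
  case/andP=> n0 n13; apply: natr_neq0; apply: contraL n13 => /dvdn_leq-/(_ n0).
  by move: p12 p_gt1; clear; lia.
have nzc : c%:R != 0 :> 'F_p := natr_neq0 _ (prime_ndvd_coef b0 c0 pE).
have norm0 : b%:R * b%:R + b%:R * c%:R + c%:R * c%:R = 0 :> 'F_p.
  by rewrite -!natrM -!natrD !mulnn -pE pchar_Fp_0.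
pose w : 'F_p := - (b%:R / c%:R).
have w_sqr : w * w = w - 1.
  apply/eqP; rewrite -subr_eq0; apply/eqP.
  by apply: (mulIf (mulf_neq0 nzc nzc)); rewrite mul0r -norm0 /w; field.
have [|i i_sqr] := @exists_sqrtN1 'F_p.
  by rewrite card_Fp //; move: p12 p_gt1; clear; lia.
have [two_neq0 three_neq0] := (small 2%N isT, small 3%N isT).
exists (psl_rot1 w), (psl_rot2 w i), (psl_rot3 w), (psl_dual w); split.
- apply: eq_rotation_system (psl_rotation_system w_sqr i_sqr three_neq0) => v.
  rewrite (in_lattice_prime p_pr b0 c0 pE) (dvdz_pcharf (pchar_Fp p_pr)).
  have -> : (c%:Z * v.1 - b%:Z * v.2)%:~R = c%:R * (v.1%:~R + w * v.2%:~R) :> 'F_p.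
    by rewrite rmorphB !rmorphM /= -!pmulrn /w; field.
  by rewrite mulf_eq0 (negPf nzc) /=; split=> [->|/eqP].
- by apply: psl_rotations_generate => // x; exists (x : nat); rewrite natr_Zp.
- by rewrite psl_unit_shift //; apply: psl_faithful_rotations.
Qed.

(** * Coset geometries *)

Local Open Scope group_scope.

Definition proper_index (i : nat) : bool := (0 < i < 5)%N.

Definition free_index (J : pred nat) : {set 'I_6} :=
  [set i : 'I_6 | proper_index i && ~~ J i].

Definition rotations_off (gT : finGroupType) (a : nat -> gT) (J : pred nat) :
    {set gT} :=
  [set (a i)^-1 * a j | i : 'I_6 in free_index J, j : 'I_6 in free_index J].

(** The groups [cg_stab 1, ..., cg_stab 4] are the stabilisers in [cg_group] of
    the faces of ranks 0, ..., 3 of a base flag, so that ranks are shifted by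
    one; the two improper faces have index 0 and 5. The flag adjacent to the base
    flag at index [i] is the image under [cg_adj i] of the one adjacent at index
    1. *)
Record coset_geometry := CosetGeometry {
  cg_type : finGroupType;
  cg_group : {group cg_type};
  cg_stab : nat -> {group cg_type};
  cg_adj : nat -> cg_type;
  cg_stab_sub : forall i, cg_stab i \subset cg_group;
  cg_stab0 : cg_stab 0 = cg_group :> {set cg_type};
  cg_stab5 : cg_stab 5 = cg_group :> {set cg_type};
  cg_factor : forall i j k, (i < j < k)%N -> (k <= 5)%N ->
    cg_stab j \subset (cg_stab j :&: cg_stab i) * (cg_stab j :&: cg_stab k);
  cg_diamond : forall i, (i < 4)%N -> exists x,
    [/\ x \in cg_stab i :&: cg_stab i.+2, x \notin cg_stab i.+1 &
        cg_stab i :&: cg_stab i.+2 \subset cg_stab i.+1 :|: cg_stab i.+1 :* x];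
  cg_adj1 : cg_adj 1 = 1;
  cg_adj_group : forall i, cg_adj i \in cg_group;
  cg_adj_stab : forall i j l, proper_index i -> proper_index j -> proper_index l ->
    l != i -> l != j -> (cg_adj i)^-1 * cg_adj j \in cg_stab l;
  cg_adj2 : cg_adj 2 \in cg_stab 2 * cg_stab 1;
  cg_adj2_notin : cg_adj 2 \notin cg_stab 1;
  cg_generated : forall (J : pred nat) g, g \in cg_group ->
    (forall j, proper_index j -> J j -> g \in cg_stab j) ->
    g \in <<rotations_off cg_adj J>>
}.

Section Faces.
Variable X : coset_geometry.
Local Notation gT := (cg_type X).
Local Notation G := (cg_group X).
Local Notation K := (@cg_stab X).
Local Notation a := (@cg_adj X).

Definition cface_pred : pred ('I_6 * {set gT}) := fun x => x.2 \in rcosets (K x.1) G.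
Definition cface : Type := {x | cface_pred x}.
HB.instance Definition _ := Finite.copy cface {x | cface_pred x}.

Implicit Types (x y z : cface) (g h : gT) (i j k l : 'I_6) (A B : {set cface}).

Definition face_index x : 'I_6 := (val x).1.
Definition face_coset x : {set gT} := (val x).2.

Lemma cface_ext x y :
  face_index x = face_index y -> face_coset x = face_coset y -> x = y.
Proof.
rewrite /face_index /face_coset => ixy cxy; apply: val_inj.
by rewrite [val x]surjective_pairing [val y]surjective_pairing ixy cxy.
Qed.

Lemma face_cosetE x g : g \in face_coset x -> face_coset x = K (face_index x) :* g.
Proof.
have /rcosetsP[h hG] := valP x; rewrite -/(face_index x) -/(face_coset x) => -> gx.
exact/esym/rcoset_eqP.
Qed.

Lemma face_coset_sub x : face_coset x \subset G.
Proof.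
have /rcosetsP[h hG] := valP x; rewrite -/(face_index x) -/(face_coset x) => ->.
apply/subsetP=> _ /rcosetP[k kK ->].
by rewrite groupM // (subsetP (cg_stab_sub _ _) _ kK).
Qed.

Lemma face_coset_group x g : g \in face_coset x -> g \in G.
Proof. exact/subsetP/face_coset_sub. Qed.

Lemma face_coset_nonempty x : exists g, g \in face_coset x.
Proof.
have /rcosetsP[h hG] := valP x; rewrite -/(face_index x) -/(face_coset x) => ->.
by exists h; apply: rcoset_refl.
Qed.

Lemma mem_face_coset x g h :
  g \in face_coset x -> (h \in face_coset x) = (h * g^-1 \in K (face_index x)).
Proof. by move=> gx; rewrite (face_cosetE gx) mem_rcoset. Qed.

Lemma cface_eq x y g :
  face_index x = face_index y -> g \in face_coset x -> g \in face_coset y -> x = y.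
Proof.
by move=> ixy gx gy; apply: cface_ext; rewrite // (face_cosetE gx) (face_cosetE gy) ixy.
Qed.

Lemma face_coset_improper x : ~~ proper_index (face_index x) -> face_coset x = G.
Proof.
have [g gx] := face_coset_nonempty x; rewrite (face_cosetE gx) => px.
suff -> : K (face_index x) = G by rewrite rcoset_id // (face_coset_group gx).
apply: val_inj; rewrite /=.
case: (face_index x) px => -[|[|[|[|[|[|//]]]]]] //= _ _; first exact: cg_stab0.
exact: cg_stab5.
Qed.

Definition cface_le x y : bool :=
  (face_index x <= face_index y)%N && (face_coset x :&: face_coset y != set0).

Lemma cface_leP x y : reflect
  ((face_index x <= face_index y)%N /\
     exists2 g, g \in face_coset x & g \in face_coset y)
  (cface_le x y).
Proof.
apply: (iffP andP) => [[ixy /set0Pn[g /setIP[gx gy]]]|[ixy [g gx gy]]].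
  by split=> //; exists g.
by split=> //; apply/set0Pn; exists g; rewrite inE gx.
Qed.

Lemma cface_le_eq x y : cface_le x y -> face_index x = face_index y -> x = y.
Proof. by case/cface_leP=> _ [g gx gy] ixy; apply: (cface_eq ixy gx). Qed.

(* This uses the factorisation [cg_factor] of the middle group. *)
Lemma cface_le_common x y z : cface_le x y -> cface_le y z ->
  exists g, [/\ g \in face_coset x, g \in face_coset y & g \in face_coset z].
Proof.
move=> xy yz; have /cface_leP[ixy [g gx gy]] := xy.
have /cface_leP[iyz [h hy hz]] := yz.
case: (eqVneq (face_index x) (face_index y)) => [exy|nxy].
  by exists h; rewrite (cface_le_eq xy exy).
case: (eqVneq (face_index y) (face_index z)) => [eyz|nyz].
  by exists g; rewrite -(cface_le_eq yz eyz).
have lt : (face_index x < face_index y < face_index z)%N.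
  by rewrite !ltn_neqAle ixy iyz nxy nyz.
have hg : h * g^-1 \in K (face_index y) by rewrite -(mem_face_coset _ gy).
have /subsetP/(_ (g * h^-1)) := cg_factor X lt (ltn_ord (face_index z)).
rewrite -groupV invMg invgK => /(_ hg).
case/mulsgP=> u v /setIP[uy ux] /setIP[vy vz] uvE.
have ugE : u^-1 * g = v * h by rewrite -[g](mulgKV h) uvE !mulgA mulVg mul1g.
exists (u^-1 * g); rewrite (mem_face_coset _ gx) (mem_face_coset _ gy) mulgK !groupV.
by rewrite uy ux; split=> //; rewrite ugE (mem_face_coset _ hz) mulgK.
Qed.

Lemma cface_le_refl : reflexive cface_le.
Proof.
move=> x; apply/cface_leP; split=> //.
by have [g gx] := face_coset_nonempty x; exists g.
Qed.

Lemma cface_le_anti : antisymmetric cface_le.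
Proof.
move=> x y /andP[xy yx]; apply: (cface_le_eq xy); apply/val_inj/anti_leq.
by case/andP: xy yx => -> _ /andP[].
Qed.

Lemma cface_le_trans : transitive cface_le.
Proof.
move=> y x z xy yz; have [g [gx _ gz]] := cface_le_common xy yz.
apply/cface_leP; split; last by exists g.
by case/andP: xy yz => xy _ /andP[/(leq_trans xy)].
Qed.

HB.instance Definition _ := Order.Le_isPOrder.Build (Order.Disp tt tt) cface
  cface_le_refl cface_le_anti cface_le_trans.

Lemma cface_leE x y : (x <= y)%O = cface_le x y. Proof. by []. Qed.

Lemma face_index_le x y : (x <= y)%O -> (face_index x <= face_index y)%N.
Proof. by case/andP. Qed.

Lemma face_index_lt x y : (x < y)%O -> (face_index x < face_index y)%N.
Proof.
rewrite lt_neqAle => /andP[ne xy]; rewrite ltn_neqAle face_index_le // andbT.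
by apply: contra ne => /eqP/val_inj/(cface_le_eq xy)->.
Qed.

Lemma lt_of_face_index x y : (x <= y)%O -> (face_index x < face_index y)%N -> (x < y)%O.
Proof.
rewrite lt_neqAle => -> ixy; rewrite andbT.
by apply: contraTneq ixy => ->; rewrite ltnn.
Qed.

Lemma comparable_face_le x y :
  (x >=< y)%O -> (face_index x <= face_index y)%N -> (x <= y)%O.
Proof.
case/orP=> // yx ixy; have iyx := face_index_le yx.
by rewrite (cface_le_eq yx) //; apply/val_inj/anti_leq; rewrite ixy iyx.
Qed.

Lemma improper_face_le x y :
  ~~ proper_index (face_index x) || ~~ proper_index (face_index y) ->
  (face_index x <= face_index y)%N -> (x <= y)%O.
Proof.
move=> improper ixy; apply/cface_leP; split=> //.
case/orP: improper => /face_coset_improper ->.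
  by have [g gy] := face_coset_nonempty y; exists g => //; apply: face_coset_group gy.
by have [g gx] := face_coset_nonempty x; exists g => //; apply: face_coset_group gx.
Qed.

(** The face [K i :* g]; outside of [G], where that is not a face, [g] is
    replaced by 1. *)
Definition in_group g : gT := if g \in G then g else 1.

Lemma in_group_mem g : in_group g \in G.
Proof. by rewrite /in_group; case: ifP. Qed.

Lemma coset_face_subproof i g : cface_pred (i, K i :* in_group g).
Proof. by apply/rcosetsP; exists (in_group g); rewrite ?in_group_mem. Qed.

Definition coset_face i g : cface :=
  exist (fun w : 'I_6 * {set gT} => is_true (cface_pred w)) _ (coset_face_subproof i g).

Lemma face_coset_coset_face i g : g \in G -> face_coset (coset_face i g) = K i :* g.
Proof. by move=> gG; rewrite /face_coset /= /in_group gG. Qed.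

Lemma mem_coset_face i g : g \in G -> g \in face_coset (coset_face i g).
Proof. by move=> gG; rewrite face_coset_coset_face // rcoset_refl. Qed.

Lemma coset_faceE x g : g \in face_coset x -> x = coset_face (face_index x) g.
Proof.
by move=> gx; apply: (cface_eq _ gx) => //; apply/mem_coset_face/(face_coset_group gx).
Qed.

Lemma coset_face_eqP i g h : g \in G -> h \in G ->
  reflect (coset_face i g = coset_face i h) (g * h^-1 \in K i).
Proof.
move=> gG hG; apply: (iffP idP) => [gh|E].
  by apply: (@cface_eq _ _ g);
    rewrite ?mem_coset_face // face_coset_coset_face // mem_rcoset.
by rewrite -mem_rcoset -face_coset_coset_face // -E mem_coset_face.
Qed.

Lemma coset_faceM i g h : g \in G -> h \in K i -> coset_face i (h * g) = coset_face i g.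
Proof.
move=> gG hK; apply/coset_face_eqP; rewrite ?mulgK // groupM //.
exact: subsetP (cg_stab_sub _ _) _ hK.
Qed.

Lemma coset_face_le i j g : g \in G -> (i <= j)%N ->
  (coset_face i g <= coset_face j g)%O.
Proof.
by move=> gG ij; apply/cface_leP; split=> //; exists g; rewrite mem_coset_face.
Qed.

Definition face_rank x : int := ((face_index x : nat)%:Z - 1)%R.

Lemma face_rank_mono : {homo face_rank : x y / (x < y)%O >-> (x < y)%R}.
Proof. by move=> x y /face_index_lt; rewrite /face_rank; clear; lia. Qed.

Lemma chain_index_inj A : chain A -> {in A &, injective face_index}.
Proof.
move=> cA x y xA yA ixy; apply: (chain_rank_inj face_rank_mono cA) => //.
by rewrite /face_rank ixy.
Qed.

Lemma flag_improper A x : flag A -> ~~ proper_index (face_index x) -> x \in A.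
Proof.
move=> fA px; apply: flag_absorb => // y _.
by case/orP: (leq_total (face_index x) (face_index y)) => ixy; apply/orP; [left|right];
  apply: improper_face_le => //; rewrite px ?orbT.
Qed.

(* Between two incident faces there is a face of any intermediate rank: take
   the coset of a common element. *)
Lemma flag_index A i : flag A -> exists2 x, x \in A & face_index x = i.
Proof.
move=> fA; have /chainP cA := flag_chain fA.
have [pi|npi] := boolP (proper_index i); last first.
  by exists (coset_face i 1) => //; apply: flag_improper.
have [/existsP[x /andP[xA /eqP]]|] := boolP [exists x in A, face_index x == i].
  by exists x.
rewrite negb_exists_in => /forall_inP nA; have [/= i0 i5] := andP pi.
have botA : coset_face ord0 1 \in A by apply: flag_improper.
have topA : coset_face ord_max 1 \in A by apply: flag_improper.
have [|x /andP[xA xi] xmax] := @arg_maxnP _ (coset_face ord0 1)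
    (fun x => (x \in A) && (face_index x < i)%N) (fun x => face_index x : nat).
  by rewrite botA.
have [|y /andP[yA yi] ymin] := @arg_minnP _ (coset_face ord_max 1)
    (fun x => (x \in A) && (i < face_index x)%N) (fun x => face_index x : nat).
  by rewrite topA.
have /cface_leP[_ [g gx gy]] : (x <= y)%O.
  by apply: comparable_face_le; rewrite ?cA // ltnW // (ltn_trans xi).
have gG := face_coset_group gx.
have xz : (x <= coset_face i g)%O by rewrite (coset_faceE gx) coset_face_le // ltnW.
have zy : (coset_face i g <= y)%O by rewrite (coset_faceE gy) coset_face_le // ltnW.
exists (coset_face i g) => //; apply: flag_absorb => // w wA.
have := nA w wA; rewrite -val_eqE /= neq_ltn => /orP[wi|iw]; apply/orP; [right|left].
  apply: le_trans xz; apply: comparable_face_le; rewrite ?cA //.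
  by apply: xmax; rewrite wA.
apply: le_trans zy _; apply: comparable_face_le; rewrite ?cA //.
by apply: ymin; rewrite wA.
Qed.

Lemma card_cface_flag A : flag A -> #|A| = 6%N.
Proof.
move=> fA; rewrite -(card_in_imset (chain_index_inj (flag_chain fA))).
rewrite -[RHS](card_ord 6) -cardsT; congr #|pred_of_set _|.
by apply/setP=> i; rewrite !inE; have [x xA <-] := flag_index i fA; rewrite imset_f.
Qed.

Lemma adjacent_off_index A B i : flag A -> flag B -> A <> B ->
  {in A, forall x, face_index x != i -> x \in B} -> adjacent A B.
Proof.
move=> fA fB neq AB.
apply: (adjacent_off_rank face_rank_mono card_cface_flag (i := (i%:Z - 1)%R) fA fB neq).
by move=> x xA rx; apply: AB => //; apply: contra_not_neq rx; rewrite /face_rank => ->.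
Qed.

Lemma flag_of_faces (f : 'I_6 -> cface) : (forall i, face_index (f i) = i) ->
  (forall i j, (i < j)%N -> (f i <= f j)%O) -> flag [set f i | i : 'I_6].
Proof.
move=> f_index f_le; apply: (card_chain_flag card_cface_flag).
  apply/chainP=> _ _ /imsetP[i _ ->] /imsetP[j _ ->].
  case: (ltngtP i j) => [ij|ji|/val_inj->]; last exact: comparablexx.
    by apply/orP; left; apply: f_le.
  by apply/orP; right; apply: f_le.
by rewrite card_imset ?card_ord // => i j /(congr1 face_index); rewrite !f_index.
Qed.

(** [flag_at g] is the image under [g] of the base flag, and [mirror_flag g] that
    of the flag adjacent to the base flag at index 1. *)
Definition flag_at g : {set cface} := [set coset_face i g | i : 'I_6].

Definition mirror_face i g : cface :=
  if i == 1%N :> nat then coset_face i ((a 2)^-1 * g) else coset_face i g.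

Definition mirror_flag g : {set cface} := [set mirror_face i g | i : 'I_6].

Lemma flag_flag_at g : g \in G -> flag (flag_at g).
Proof. by move=> gG; apply: flag_of_faces => // i j /ltnW/coset_face_le->. Qed.

Lemma mirror_face_index i g : face_index (mirror_face i g) = i.
Proof. by rewrite /mirror_face; case: ifP. Qed.

Lemma mirror_face_le i j g : g \in G -> (i < j)%N ->
  (mirror_face i g <= mirror_face j g)%O.
Proof.
move=> gG; rewrite /mirror_face; case: eqP => [i1|_]; case: eqP => [j1|_] ij.
- by rewrite i1 j1 in ij.
- have hG : (a 2)^-1 * g \in G by rewrite groupM // groupV cg_adj_group.
  have [pj|npj] := boolP (proper_index j); last first.
    by apply: improper_face_le; rewrite ?npj ?orbT // ltnW.
  have [j2|j2] := eqVneq (j : nat) 2%N.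
    have /mulsgP[u v u2 v1 a2E] := cg_adj2 X.
    apply/cface_leP; split; first exact: ltnW.
    exists (v * (a 2)^-1 * g).
      by rewrite face_coset_coset_face // -mulgA mem_rcoset mulgK i1.
    rewrite face_coset_coset_face // mem_rcoset mulgK a2E.
    by rewrite invMg mulgA mulgV mul1g groupV j2.
  have <- : coset_face j ((a 2)^-1 * g) = coset_face j g.
    rewrite coset_faceM // groupV.
    have := @cg_adj_stab X 1 2 j isT isT pj; rewrite cg_adj1 invg1 mul1g; apply=> //.
    by apply: contraTneq ij => ->; rewrite i1.
  exact/coset_face_le/ltnW.
- apply: improper_face_le; last exact: ltnW.
  by case: (i : nat) j1 ij => //= i' ->.
- exact/coset_face_le/ltnW.
Qed.

Lemma flag_mirror_flag g : g \in G -> flag (mirror_flag g).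
Proof.
by move=> gG; apply: flag_of_faces => [i|i j];
  [apply: mirror_face_index|apply: mirror_face_le].
Qed.

Lemma coset_face_flag_at i g : coset_face i g \in flag_at g. Proof. exact: imset_f. Qed.

Lemma mirror_face_mirror_flag i g : mirror_face i g \in mirror_flag g.
Proof. exact: imset_f. Qed.

Lemma mem_flag_at g x : g \in G -> (x \in flag_at g) = (g \in face_coset x).
Proof.
move=> gG; apply/imsetP/idP=> [[i _ ->]|gx]; first exact: mem_coset_face.
by exists (face_index x) => //; apply: coset_faceE.
Qed.

Lemma mirror_face_adj i l g : g \in G -> proper_index i -> l != i ->
  mirror_face l (a i * g) = coset_face l g.
Proof.
move=> gG pi li; have aG := cg_adj_group X.
have [pl|npl] := boolP (proper_index l); last first.
  apply: (@cface_eq _ _ g); rewrite ?mirror_face_index // ?mem_coset_face //.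
  by rewrite face_coset_improper ?mirror_face_index.
rewrite /mirror_face; case: eqP => [l1|l1].
  rewrite mulgA coset_faceM //.
  have [i2|i2] := eqVneq (i : nat) 2%N; first by rewrite i2 mulVg group1.
  by apply: cg_adj_stab => //; rewrite l1.
rewrite coset_faceM // -[a i]mul1g -invg1 -(cg_adj1 X).
by apply: cg_adj_stab => //; apply/eqP.
Qed.

Lemma stab_trivial g (i : nat) : g \in G -> proper_index i ->
  (forall j : nat, proper_index j -> j != i -> g \in K j) -> g = 1.
Proof.
move=> gG pi gK; have := @cg_generated X [pred j : nat | j != i] g gG gK.
suff -> : << rotations_off a [pred j : nat | j != i] >> = 1 by move/set1gP.
apply/trivgP; rewrite gen_subG; apply/subsetP=> x /imset2P[k l].
rewrite !inE /= !negbK => /andP[_ /eqP->] /andP[_ /eqP->] ->.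
by rewrite mulVg.
Qed.

Lemma index_nat_face (j : nat) : proper_index j -> (j < 6)%N.
Proof. by case/andP=> _ /ltnW. Qed.

Lemma flag_at_eq_mirror_flag g h : g \in G -> h \in G -> flag_at g <> mirror_flag h.
Proof.
move=> gG hG eqgh.
have face_eq i : coset_face i g = mirror_face i h.
  apply: (chain_index_inj (flag_chain (flag_flag_at gG))).
  - exact: coset_face_flag_at.
  - by rewrite eqgh mirror_face_mirror_flag.
  - by rewrite mirror_face_index.
have gh : g = h.
  apply/eqP; rewrite eq_mulgV1; apply/eqP.
  apply: (@stab_trivial _ 1); rewrite ?groupM ?groupV // => j pj j1.
  have := face_eq (Ordinal (index_nat_face pj)); rewrite /mirror_face /= (negPf j1).
  by move/(coset_face_eqP (Ordinal (index_nat_face pj)) gG hG).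
have := face_eq (inord 1); rewrite /mirror_face inordK //= -gh => face1_eq.
have := cg_adj2_notin X; rewrite -groupV.
have aG : (a 2)^-1 * g \in G by rewrite groupM // groupV cg_adj_group.
by have /esym/coset_face_eqP := face1_eq; rewrite inordK // mulgK => ->.
Qed.

(* The remaining three proper faces of the flag form a chain. *)
Lemma flag_common_elt A i : flag A -> proper_index i ->
  exists2 g, g \in G & {in A, forall x, face_index x != i -> g \in face_coset x}.
Proof.
move=> fA pi; have /chainP cA := flag_chain fA.
have inj := chain_index_inj (flag_chain fA).
have common (j k l : nat) : (j < k < l)%N -> (l < 6)%N ->
    (forall m : nat, proper_index m -> m != i -> [|| m == j, m == k | m == l]) ->
    exists2 g, g \in G & {in A, forall x, face_index x != i -> g \in face_coset x}.
  move=> /andP[jk kl] l6 exhaust; have k6 := ltn_trans kl l6.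
  have [x xA ix] := flag_index (Ordinal (ltn_trans jk k6)) fA.
  have [y yA iy] := flag_index (Ordinal k6) fA.
  have [z zA iz] := flag_index (Ordinal l6) fA.
  have xy : cface_le x y by apply: comparable_face_le; rewrite ?cA // ix iy ltnW.
  have yz : cface_le y z by apply: comparable_face_le; rewrite ?cA // iz iy ltnW.
  have [g [gx gy gz]] := cface_le_common xy yz.
  exists g => [|w wA wi]; first exact: face_coset_group gx.
  have [pw|npw] := boolP (proper_index (face_index w)); last first.
    by rewrite face_coset_improper // (face_coset_group gx).
  have /or3P[] := exhaust _ pw wi => /eqP iw.
  - by rewrite (inj w x) // ix; apply: val_inj.
  - by rewrite (inj w y) // iy; apply: val_inj.
  - by rewrite (inj w z) // iz; apply: val_inj.
case: i pi common => -[|[|[|[|[|[|//]]]]]] // lti _ common.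
- by apply: (common 2 3 4)%N => // -[|[|[|[|[|]]]]].
- by apply: (common 1 3 4)%N => // -[|[|[|[|[|]]]]].
- by apply: (common 1 2 4)%N => // -[|[|[|[|[|]]]]].
- by apply: (common 1 2 3)%N => // -[|[|[|[|[|]]]]].
Qed.

Section Connectedness.
Variables (S : {set cface}) (J : pred nat).
Hypothesis S_index : {in S, forall x, J (face_index x)}.

Definition link : rel {set cface} :=
  [rel A B | [&& adjacent A B, S \subset A & S \subset B]].

Lemma link_off_index A B i : flag A -> flag B -> S \subset A -> S \subset B ->
  {in A, forall x, face_index x != i -> x \in B} -> connect link A B.
Proof.
move=> fA fB SA SB AB; have [->|/eqP neq] := eqVneq A B; first exact: connect0.
by apply: connect1; rewrite /link /= SA SB (adjacent_off_index fA fB neq AB).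
Qed.

Lemma link_mirror_flag i g : i \in free_index J -> g \in G ->
  (S \subset mirror_flag (a i * g)) = (S \subset flag_at g) /\
  (S \subset flag_at g -> connect link (flag_at g) (mirror_flag (a i * g)) /\
     connect link (mirror_flag (a i * g)) (flag_at g)).
Proof.
rewrite inE => /andP[pi Ji] gG.
have agG : a i * g \in G by rewrite groupM ?cg_adj_group.
have S_neq x : x \in S -> face_index x != i.
  by move/S_index=> Jx; apply: contraNneq Ji => <-.
have to_mirror l : l != i -> coset_face l g \in mirror_flag (a i * g).
  by move=> li; rewrite -(mirror_face_adj gG pi li) mirror_face_mirror_flag.
have of_mirror l : l != i -> mirror_face l (a i * g) \in flag_at g.
  by move=> li; rewrite (mirror_face_adj gG pi li) coset_face_flag_at.
have subE : (S \subset mirror_flag (a i * g)) = (S \subset flag_at g).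
  apply/subsetP/subsetP => sub x xS; have /imsetP[l _ xE] := sub x xS;
    have := S_neq x xS; rewrite xE ?mirror_face_index;
      [exact: of_mirror|exact: to_mirror].
split=> // SA; split; apply: (@link_off_index _ _ i); rewrite ?subE //;
  rewrite ?flag_flag_at ?flag_mirror_flag //.
  by move=> _ /imsetP[l _ ->]; apply: to_mirror.
by move=> _ /imsetP[l _ ->]; rewrite mirror_face_index; apply: of_mirror.
Qed.

Lemma link_rotation k l g : k \in free_index J -> l \in free_index J -> g \in G ->
  S \subset flag_at g -> S \subset flag_at ((a k)^-1 * a l * g) /\
    connect link (flag_at g) (flag_at ((a k)^-1 * a l * g)).
Proof.
move=> kJ lJ gG Sg; set h := _ * g.
have hG : h \in G by rewrite !groupM ?groupV ?cg_adj_group.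
have akh : a k * h = a l * g by rewrite /h !mulgA mulgV mul1g.
have [Sl /(_ Sg)[gl _]] := link_mirror_flag lJ gG.
have [Sk kh] := link_mirror_flag kJ hG; rewrite akh in Sk kh.
have Sh : S \subset flag_at h by rewrite -Sk Sl.
by split=> //; apply: connect_trans gl (kh Sh).2.
Qed.

Lemma link_rotations g h : h \in <<rotations_off a J>> -> g \in G ->
  S \subset flag_at g ->
  S \subset flag_at (h * g) /\ connect link (flag_at g) (flag_at (h * g)).
Proof.
case/gen_prodgP=> n [c cP ->] gG Sg; elim: n c cP => [|n IH] c cP.
  by rewrite big_ord0 mul1g connect0.
rewrite big_ord_recl -mulgA; set h' := \prod_(o < n) _ * g.
have [Sh' gh'] := IH (fun o => c (lift ord0 o)) (fun o => cP _).
have h'G : h' \in G.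
  rewrite groupM // group_prod // => o _.
  have /imset2P[k l _ _ ->] := cP (lift ord0 o).
  by rewrite groupM ?groupV ?cg_adj_group.
have /imset2P[k l kJ lJ ->] := cP ord0.
have [Sh h'h] := link_rotation kJ lJ h'G Sh'.
by split=> //; apply: connect_trans gh' h'h.
Qed.

Lemma link_near_flag_at A i : proper_index i -> {in S, forall x, face_index x != i} ->
  flag A -> S \subset A -> exists2 g, g \in G &
    [/\ S \subset flag_at g, connect link A (flag_at g) & connect link (flag_at g) A].
Proof.
move=> pi Si fA SA; have [g gG gA] := flag_common_elt fA pi; exists g => //.
have fg := flag_flag_at gG.
have A_flag_at : {in A, forall x, face_index x != i -> x \in flag_at g}.
  by move=> x xA xi; rewrite mem_flag_at // gA.
have Sg : S \subset flag_at g.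
  by apply/subsetP=> x xS; apply: A_flag_at (subsetP SA x xS) (Si x xS).
split=> //; first exact: (link_off_index fA fg SA Sg A_flag_at).
apply: (link_off_index (i := i) fg fA Sg SA) => x.
rewrite mem_flag_at // => gx xi; have [y yA ixy] := flag_index (face_index x) fA.
by rewrite (cface_eq (esym ixy) gx) // gA // ixy.
Qed.

End Connectedness.

Lemma cface_connected : strongly_flag_connected cface.
Proof.
move=> A B fA fB; rewrite -[rel_of_simpl _]/(link (A :&: B)).
have [->|neq] := eqVneq A B; first exact: connect0.
have inj := chain_index_inj (flag_chain fA).
have [x xA xB] : exists2 x, x \in A & x \notin B.
  apply/subsetPn; apply: contra neq => sAB.
  by rewrite eqEcard sAB !card_cface_flag.
have px : proper_index (face_index x).
  by apply: contraNT xB => npx; apply: flag_improper.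
have x_free : {in A :&: B, forall y, face_index y != face_index x}.
  move=> y /setIP[yA yB]; apply: contraNneq xB => iyx.
  by rewrite -(inj y x yA xA iyx).
have [g gG [Sg Ag _]] := link_near_flag_at px x_free fA (subsetIl A B).
have [h hG [Sh _ hB]] := link_near_flag_at px x_free fB (subsetIr A B).
apply: connect_trans Ag (connect_trans _ hB).
pose J : pred nat := [pred j | [exists y in A :&: B, (face_index y : nat) == j]].
have S_index : {in A :&: B, forall y, J (face_index y)}.
  by move=> y yS; apply/existsP; exists y; rewrite yS eqxx.
have hgJ : h * g^-1 \in <<rotations_off a J>>.
  apply: cg_generated => [|j pj /existsP[y /andP[yS /eqP<-]]].
    by rewrite groupM ?groupV.
  have gy : g \in face_coset y by rewrite -mem_flag_at // (subsetP Sg).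
  by rewrite -(mem_face_coset _ gy) -mem_flag_at // (subsetP Sh).
by have [_] := link_rotations S_index hgJ gG Sg; rewrite mulgKV.
Qed.

Lemma coset_face_between x y z g i : i = (face_index x).+1 :> nat ->
  face_index y = i.+1 :> nat -> g \in face_coset x -> g \in face_coset y ->
  reflect (exists2 u, u \in K (face_index x) :&: K (face_index y) &
                      z = coset_face i (u * g))
          (x < z < y)%O.
Proof.
move=> ix iy gx gy; apply: (iffP andP) => [[xz zy]|[u /setIP[ux uy] ->]].
  have [h [hx hz hy]] := cface_le_common (ltW xz) (ltW zy).
  have iz : face_index z = i.
    apply: val_inj; have := face_index_lt xz; have := face_index_lt zy.
    by rewrite iy /= ix; clear; lia.
  exists (h * g^-1).
    by rewrite inE -(mem_face_coset _ gx) hx -(mem_face_coset _ gy) hy.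
  by rewrite mulgKV -iz; apply: coset_faceE.
have ugx : u * g \in face_coset x by rewrite (mem_face_coset _ gx) mulgK.
have ugy : u * g \in face_coset y by rewrite (mem_face_coset _ gy) mulgK.
have ugG := face_coset_group ugx.
by split; apply: lt_of_face_index; rewrite /= ?ix ?iy ?ix //;
  apply/cface_leP; split; rewrite /= ?ix ?iy ?ix ?leqnSn //;
  exists (u * g); rewrite ?mem_coset_face.
Qed.

Lemma cface_diamond x y : (x < y)%O -> face_rank y = (face_rank x + 2%:Z)%R ->
  #|[set z | (x < z < y)%O]| = 2%N.
Proof.
move=> xy rxy; have iy : face_index y = (face_index x).+2 :> nat.
  by move: rxy; rewrite /face_rank; clear; lia.
have /cface_leP[_ [g gx gy]] := ltW xy; have gG := face_coset_group gx.
have ltx : (face_index x < 4)%N by move: (ltn_ord (face_index y)); rewrite iy.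
pose i : 'I_6 := Ordinal (leqW ltx : ((face_index x).+1 < 6)%N).
have [u [uK un sub]] := cg_diamond X ltx.
have ugG : u * g \in G.
  by rewrite groupM //; have /setIP[/(subsetP (cg_stab_sub X _))] := uK.
have -> : [set z | (x < z < y)%O] = [set coset_face i g; coset_face i (u * g)].
  apply/setP=> z; rewrite !inE.
  apply/(coset_face_between z (i := i) erefl iy gx gy)/orP; rewrite iy.
    move=> [v vK ->].
    have vG : v \in G by have /setIP[/(subsetP (cg_stab_sub X _))] := vK.
    case/(subsetP sub)/setUP: vK => vi; [left|right]; apply/eqP.
      by rewrite coset_faceM.
    by apply/(coset_face_eqP i (groupM vG gG) ugG);
      rewrite invMg mulgA mulgK -mem_rcoset.
  by case=> /eqP->; [exists 1; rewrite ?group1 ?mul1g|exists u].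
rewrite cards2; case: eqP => // /esym/(coset_face_eqP i ugG gG); rewrite mulgK.
by rewrite (negPf un).
Qed.

Lemma cface_polytope : is_polytope 4 face_rank.
Proof.
split.
- by move=> x; rewrite /face_rank; have := ltn_ord (face_index x); clear; lia.
- exact: face_rank_mono.
- by exists (coset_face ord0 1) => x; apply: improper_face_le.
- exists (coset_face ord_max 1) => x; apply: improper_face_le; rewrite ?orbT //.
  exact: leq_ord.
- exact: card_cface_flag.
- exact: cface_connected.
- exact: cface_diamond.
Qed.

End Faces.

Definition coset_polytope (X : coset_geometry) : polytope 4 :=
  Polytope (cface_polytope X).

Section Automorphisms.
Variable X : coset_geometry.
Local Notation gT := (cg_type X).
Local Notation G := (cg_group X).
Local Notation K := (@cg_stab X).
Local Notation a := (@cg_adj X).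
Local Notation P := (coset_polytope X).
Implicit Types (x y z : P) (g h : gT) (i : 'I_6) (A B : {set P}).

Lemma rcoset_face_subproof x g : cface_pred (face_index x, face_coset x :* in_group g).
Proof.
have [h hx] := face_coset_nonempty x; rewrite (face_cosetE hx); apply/rcosetsP.
exists (h * in_group g); last by rewrite rcosetM.
exact: (groupM (face_coset_group hx) (in_group_mem g)).
Qed.

Definition rcoset_face g x : P :=
  exist (fun w : 'I_6 * {set gT} => is_true (cface_pred w)) _
    (rcoset_face_subproof x g).

Lemma rcoset_face_inj g : injective (rcoset_face g).
Proof.
move=> x y /(congr1 val)[ixy cxy]; apply: (cface_ext ixy).
exact: (can_inj (rcosetK (in_group g))).
Qed.

Definition rmul_perm g : {perm P} := perm (@rcoset_face_inj g).

Lemma face_coset_rmul g x : g \in G -> face_coset (rmul_perm g x) = face_coset x :* g.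
Proof. by move=> gG; rewrite permE /face_coset /= /in_group gG. Qed.

Lemma face_index_rmul g x : face_index (rmul_perm g x) = face_index x.
Proof. by rewrite permE. Qed.

Lemma rmul_coset_face g h i : g \in G -> h \in G ->
  rmul_perm g (coset_face i h) = coset_face i (h * g).
Proof.
move=> gG hG; apply: (@cface_eq _ _ _ (h * g)).
- by rewrite face_index_rmul.
- by rewrite face_coset_rmul // mem_rcoset mulgK mem_coset_face.
- by rewrite mem_coset_face // groupM.
Qed.

Lemma rmul_Gamma g : g \in G -> rmul_perm g \in Gamma P.
Proof.
move=> gG; apply/GammaP=> x y.
rewrite !cface_leE /cface_le !face_index_rmul !face_coset_rmul //.
congr (_ && _); apply/set0Pn/set0Pn=> -[h]; rewrite !inE.
  by rewrite !mem_rcoset => hh; exists (h * g^-1); rewrite inE.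
by exists (h * g); rewrite !inE !mem_rcoset mulgK.
Qed.

Lemma rmul_permM : {in G &, {morph rmul_perm : g h / g * h}}.
Proof.
move=> g h gG hG; apply/permP=> x; rewrite permM.
have [k kx] := face_coset_nonempty x; have kG := face_coset_group kx.
by rewrite (coset_faceE kx) !rmul_coset_face ?groupM // mulgA.
Qed.

Canonical rmul_morphism : {morphism G >-> {perm P}} := Morphism rmul_permM.

Lemma rmul_flag_at g h : g \in G -> h \in G ->
  rmul_perm g @: flag_at h = flag_at (h * g).
Proof.
move=> gG hG; rewrite /flag_at -imset_comp; apply: eq_imset => i /=.
exact: rmul_coset_face.
Qed.

Lemma rmul_mirror_flag g h : g \in G -> h \in G ->
  rmul_perm g @: mirror_flag h = mirror_flag (h * g).
Proof.
move=> gG hG; rewrite /mirror_flag -imset_comp; apply: eq_imset => i /=.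
rewrite /mirror_face; case: ifP => _; rewrite rmul_coset_face ?mulgA //.
by rewrite groupM ?groupV ?cg_adj_group.
Qed.

Lemma flag_at_inj : {in G &, injective (@flag_at X)}.
Proof.
move=> g h gG hG eqgh; apply/eqP; rewrite eq_mulgV1; apply/eqP.
apply: (@stab_trivial _ _ 1); rewrite ?groupM ?groupV // => j pj _.
pose i := Ordinal (index_nat_face pj); apply/(coset_face_eqP i gG hG).
apply: (chain_index_inj (flag_chain (flag_flag_at gG))) => //.
  exact: coset_face_flag_at.
by rewrite eqgh coset_face_flag_at.
Qed.

Lemma injm_rmul : 'injm rmul_perm.
Proof.
apply/injmP=> g h gG hG eqgh; apply: flag_at_inj => //.
by rewrite -[g]mul1g -[h]mul1g -!rmul_flag_at // eqgh.
Qed.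

Lemma i_adjacent_off_index i (k : nat) A B : flag A -> flag B -> A <> B ->
  i = k.+1 :> nat -> {in A, forall x, face_index x != i -> x \in B} -> i_adjacent k A B.
Proof.
move=> fA fB neq ik AB; apply/i_adjacentP => //; split=> // x xA rx.
apply: AB => //; apply: contra_notN rx => /eqP ix.
by rewrite -[rank x]/(face_rank x) /face_rank ix ik; clear; lia.
Qed.

Lemma flag_at_adjacent (k : nat) g : (k < 4)%N -> g \in G ->
  i_adjacent k (flag_at g : {set P}) (mirror_flag (a k.+1 * g)).
Proof.
move=> k4 gG; pose i := Ordinal (index_nat_face (k4 : proper_index k.+1)).
have aG : a k.+1 * g \in G by rewrite groupM ?cg_adj_group.
apply: (@i_adjacent_off_index i); rewrite ?flag_flag_at ?flag_mirror_flag //.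
  exact: flag_at_eq_mirror_flag.
move=> _ /imsetP[l _ ->] li.
by rewrite -(mirror_face_adj gG (i := i)) ?mirror_face_mirror_flag.
Qed.

Lemma flag_cases A : flag A ->
  exists2 g, g \in G & A = flag_at g \/ A = mirror_flag g.
Proof.
move=> fA; have proper1 : proper_index (inord 1 : 'I_6) by rewrite inordK.
have [g gG gA] := flag_common_elt fA proper1.
exists g => //; have [->|/eqP neq] := eqVneq A (flag_at g); [by left|right].
have := @flag_at_adjacent 0 g isT gG; rewrite cg_adj1 mul1g.
apply: i_adjacent_uniq => //; apply: i_adjacent_sym.
apply: (@i_adjacent_off_index (inord 1)); rewrite ?flag_flag_at ?inordK //.
by move=> x xA ix; rewrite mem_flag_at // gA.
Qed.

Lemma flag_at_not_adjacent g h (k : nat) : (k < 4)%N -> g \in G -> h \in G ->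
  ~~ i_adjacent k (flag_at g : {set P}) (flag_at h).
Proof.
move=> k4 gG hG; apply/negP=> adj.
have := i_adjacent_uniq k4 adj (flag_at_adjacent k4 gG).
by apply: flag_at_eq_mirror_flag; rewrite // groupM ?cg_adj_group.
Qed.

Lemma mirror_flag_not_adjacent g h (k : nat) : (k < 4)%N -> g \in G -> h \in G ->
  ~~ i_adjacent k (mirror_flag g : {set P}) (mirror_flag h).
Proof.
move=> k4 gG hG; apply/negP=> adj.
have aG : (a k.+1)^-1 * g \in G by rewrite groupM ?groupV ?cg_adj_group.
have := flag_at_adjacent k4 aG; rewrite mulKVg => /i_adjacent_sym adj'.
by have := i_adjacent_uniq k4 adj' adj; apply: flag_at_eq_mirror_flag.
Qed.

(** The group has an automorphism that exchanges the rotations about the base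
    flag with the rotations about the flag adjacent to it at index 1. *)
Definition mirror_symmetric : Prop := exists2 alpha : {morphism G >-> gT},
  alpha @* G = G & forall k l : nat, (k < 4)%N -> (l < 4)%N ->
    alpha ((a k.+1)^-1 * a l.+1) = a k.+1 * (a l.+1)^-1.

Lemma rotations_generate : G \subset <<rotations_off a pred0>>.
Proof.
by apply/subsetP=> g gG; apply: cg_generated.
Qed.

(* Automorphisms commute with taking adjacent flags. *)
Lemma reflection_conj_rotation (gam : {perm P}) (k l : nat) : gam \in Gamma P ->
    gam @: (flag_at 1 : {set P}) = mirror_flag 1 -> (k < 4)%N -> (l < 4)%N ->
  rmul_perm ((a k.+1)^-1 * a l.+1) ^ gam = rmul_perm (a k.+1 * (a l.+1)^-1).
Proof.
move=> gamG gam1 k4 l4; set u := _ * _; set v := _ * _; have aG := cg_adj_group X.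
have uG : u \in G by rewrite groupM ?groupV.
have vG : v \in G by rewrite groupM ?groupV.
apply: (mulgI gam); rewrite -conjgC.
apply: (@Gamma_eq 4 P _ _ (flag_at 1)); rewrite ?groupM ?rmul_Gamma ?flag_flag_at //.
rewrite !imset_permM rmul_flag_at // gam1 rmul_mirror_flag // !mul1g.
have := Gamma_i_adjacent gamG (flag_at_adjacent l4 (group1 G)); rewrite mulg1 gam1.
have lV : (a l.+1)^-1 \in G by rewrite groupV.
have := i_adjacent_sym (flag_at_adjacent l4 lV); rewrite mulgV => adjl adjl'.
have gam_al := i_adjacent_uniq l4 adjl' adjl.
have := i_adjacent_sym (flag_at_adjacent k4 uG); rewrite /u mulKVg -/u.
move/(Gamma_i_adjacent gamG); rewrite gam_al => adjk.
exact: (i_adjacent_uniq k4 adjk (flag_at_adjacent k4 lV)).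
Qed.

Lemma reflection_mirror_symmetric (gam : {perm P}) : gam \in Gamma P ->
  gam @: (flag_at 1 : {set P}) = mirror_flag 1 -> mirror_symmetric.
Proof.
move=> gamG gam1; have aG := cg_adj_group X.
have normG : (rmul_perm @* G) :^ gam = rmul_perm @* G.
  apply/eqP; rewrite eqEcard cardJg leqnn andbT sub_conjg.
  apply: subset_trans (morphimS _ rotations_generate) _.
  have sub : rotations_off a pred0 \subset G.
    by apply/subsetP=> _ /imset2P[k l _ _ ->]; rewrite groupM ?groupV.
  rewrite morphim_gen // gen_subG.
  apply/subsetP=> _ /morphimP[_ _ /imset2P[k l + + ->] ->].
  rewrite !inE => /andP[pk _] /andP[pl _]; rewrite mem_conjgV.
  case: k l pk pl => -[|k] ltk [[|l] ltl] // pk pl /=.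
  by rewrite reflection_conj_rotation // mem_morphim // groupM ?groupV.
have conjP g : g \in G -> rmul_perm g ^ gam \in rmul_perm @* G.
  by move=> gG; rewrite -normG memJ_conjg mem_morphim.
pose conj_gam g := invm injm_rmul (rmul_perm g ^ gam).
have alphaM : {in G &, {morph conj_gam : g h / g * h}}.
  by move=> g h gG hG; rewrite /conj_gam rmul_permM // conjMg morphM //= conjP.
exists (Morphism alphaM) => [|k l k4 l4] /=; last first.
  by rewrite /conj_gam reflection_conj_rotation // invmE // groupM ?groupV.
apply/setP=> h; apply/morphimP/idP => [[g _ gG ->] /=|hG].
  by rewrite -(im_invm injm_rmul) mem_morphim ?conjP.
have : rmul_perm h \in (rmul_perm @* G) :^ gam by rewrite normG mem_morphim.
rewrite mem_conjg => /morphimP[g _ gG gE]; exists g => //=.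
by rewrite /conj_gam -gE conjgKV invmE.
Qed.

Section NotMirrorSymmetric.
Hypothesis asymmetric : ~ mirror_symmetric.

Lemma Gamma_flag_at gam : gam \in Gamma P ->
  exists2 g, g \in G & gam @: (flag_at 1 : {set P}) = flag_at g.
Proof.
move=> gamG.
have fA : flag (gam @: (flag_at 1 : {set P})).
  by apply: Gamma_flag => //; apply: flag_flag_at.
have [g gG [E|E]] := flag_cases fA; first by exists g.
case: asymmetric; apply: (@reflection_mirror_symmetric (gam * rmul_perm g^-1)).
  by rewrite groupM // rmul_Gamma ?groupV.
by rewrite imset_permM E rmul_mirror_flag ?groupV // mulgV.
Qed.

Lemma Gamma_rmul : Gamma P = rmul_perm @* G.
Proof.
apply/eqP; rewrite eqEsubset; apply/andP; split; last first.
  by apply/subsetP=> _ /morphimP[g _ gG ->]; apply: rmul_Gamma.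
apply/subsetP=> gam gamG; have [g gG gam1] := Gamma_flag_at gamG.
suff -> : gam = rmul_perm g by apply: mem_morphim.
apply: (@Gamma_eq 4 P _ _ (flag_at 1)); rewrite ?rmul_Gamma ?flag_flag_at //.
by rewrite gam1 rmul_flag_at // mul1g.
Qed.

Lemma Gamma_isog : Gamma P \isog G.
Proof. by rewrite Gamma_rmul isog_sym sub_isog // injm_rmul. Qed.

Lemma orbit_rmul (f : gT -> {set P}) :
  {in G &, forall g h, rmul_perm g @: f h = f (h * g)} ->
  orbit 'P^* (Gamma P) (f 1) = f @: G.
Proof.
move=> f_rmul; rewrite Gamma_rmul; apply/setP=> A; apply/orbitP/imsetP.
  case=> _ /morphimP[g _ gG ->] <-; exists g => //.
  by rewrite /= setactE (eq_imset _ (g := rmul_perm g)) // f_rmul // mul1g.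
case=> g gG ->; exists (rmul_perm g); first exact: mem_morphim.
by rewrite /= setactE (eq_imset _ (g := rmul_perm g)) // f_rmul // mul1g.
Qed.

Lemma flag_orbitsE : flag_orbits P = [set @flag_at X @: G; @mirror_flag X @: G].
Proof.
have orbit1 : orbit 'P^* (Gamma P) (flag_at 1 : {set P}) = @flag_at X @: G.
  by apply: orbit_rmul => g h; apply: rmul_flag_at.
have orbit2 : orbit 'P^* (Gamma P) (mirror_flag 1 : {set P}) = @mirror_flag X @: G.
  by apply: orbit_rmul => g h; apply: rmul_mirror_flag.
apply/setP=> O; rewrite !inE; apply/imsetP/orP.
  case=> A; rewrite inE => /flag_cases[g gG [] -> ->]; [left|right].
    by rewrite -orbit1; apply/eqP/orbit_eqP; rewrite orbit1; apply: imset_f.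
  by rewrite -orbit2; apply/eqP/orbit_eqP; rewrite orbit2; apply: imset_f.
case=> /eqP->; first by exists (flag_at 1); rewrite ?orbit1 // inE flag_flag_at.
by exists (mirror_flag 1); rewrite ?orbit2 // inE flag_mirror_flag.
Qed.

Lemma coset_chiral : chiral P.
Proof.
split=> [|A B ab].
  rewrite flag_orbitsE cards2; case: eqP => // eq_orbits.
  have : flag_at 1 \in @mirror_flag X @: G by rewrite -eq_orbits imset_f.
  by case/imsetP=> g gG /flag_at_eq_mirror_flag-/(_ (group1 G)).
have [k kab k4] := adjacent_rank ab; have [fA fB] := i_adjacent_flag kab.
apply/negP=> BA; have OA : orbit 'P^* (Gamma P) A \in flag_orbits P.
  by apply: imset_f; rewrite inE.
have AO := orbit_refl 'P^* (Gamma P) A.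
move: OA; rewrite flag_orbitsE !inE => /orP[] /eqP E; rewrite E in BA AO;
  have [g gG Ag] := imsetP AO; have [h hG Bh] := imsetP BA; move: kab; rewrite Ag Bh.
  exact/negP/flag_at_not_adjacent.
exact/negP/mirror_flag_not_adjacent.
Qed.

End NotMirrorSymmetric.

Definition cg_duality (d : gT) : Prop :=
  forall i : nat, (i <= 5)%N -> K i :^ d = K (5 - i).

Section Duality.
Variable d : gT.
Hypothesis d_dual : cg_duality d.

Lemma cg_duality_mem g : (g ^ d \in G) = (g \in G).
Proof.
have GdE : G :^ d = G by rewrite -[in LHS](cg_stab0 X) -(cg_stab5 X) (d_dual (leq0n 5)).
by rewrite -{1}GdE memJ_conjg.
Qed.

Lemma dual_face_subproof x : cface_pred (rev_ord (face_index x), face_coset x :^ d).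
Proof.
have [h hx] := face_coset_nonempty x; rewrite (face_cosetE hx); apply/rcosetsP.
exists (h ^ d); first by rewrite cg_duality_mem (face_coset_group hx).
by rewrite /= conjsMg conjg_set1 d_dual ?subSS // -ltnS ltn_ord.
Qed.

Definition dual_face x : P :=
  exist (fun w : 'I_6 * {set gT} => is_true (cface_pred w)) _ (dual_face_subproof x).

Lemma dual_face_inj : injective dual_face.
Proof.
move=> x y /(congr1 val)[ixy cxy]; apply: cface_ext.
  by apply: (can_inj (@rev_ordK 6)); apply: val_inj.
exact: (can_inj (conjsgK d)) cxy.
Qed.

Definition dual_perm : {perm P} := perm dual_face_inj.

Lemma dual_perm_duality : duality dual_perm.
Proof.
move=> x y; rewrite !permE !cface_leE /cface_le /= /face_index /face_coset /=.
rewrite -!/(face_index _) -!/(face_coset _) !subSS -conjIg setIC -!card_gt0 cardJg;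
  congr (_ && _).
by have := ltn_ord (face_index x); have := ltn_ord (face_index y); clear; lia.
Qed.

Lemma dual_flag_at g : g \in G -> dual_perm @: flag_at g = flag_at (g ^ d).
Proof.
move=> gG; have fg : flag (dual_perm @: (flag_at g : {set P})).
  by apply: (duality_flag dual_perm_duality); apply: flag_flag_at.
have gdG : g ^ d \in G by rewrite cg_duality_mem.
apply: flag_sub_eq => //; first exact: flag_flag_at.
apply/subsetP=> _ /imsetP[x xg ->]; rewrite mem_flag_at //.
by rewrite permE /face_coset /= memJ_conjg -/(face_coset x) -mem_flag_at.
Qed.

Lemma coset_properly_self_dual : ~ mirror_symmetric -> properly_self_dual P.
Proof.
move=> asymmetric; exists dual_perm; first exact: dual_perm_duality.
have dual_inj : injective (fun A : {set P} => dual_perm @: A).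
  by move=> A B /(imset_inj perm_inj).
have dual_orbit (O : {set {set P}}) :
    (forall A, A \in O -> dual_perm @: A \in O) ->
      [set dual_perm @: A | A : {set P} in O] = O.
  move=> stable; apply/eqP; rewrite eqEcard (card_imset _ dual_inj) leqnn andbT.
  by apply/subsetP=> _ /imsetP[A AO ->]; apply: stable.
have flag_at_orbit :
    [set dual_perm @: A | A : {set P} in @flag_at X @: G] = @flag_at X @: G.
  apply: dual_orbit => _ /imsetP[g gG ->].
  by rewrite dual_flag_at // imset_f // cg_duality_mem.
move=> O; rewrite flag_orbitsE // !inE => /orP[] /eqP-> //.
apply: dual_orbit => _ /imsetP[g gG ->].
have fA : flag (dual_perm @: (mirror_flag g : {set P})).
  by apply: (duality_flag dual_perm_duality); apply: flag_mirror_flag.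
have [h hG [E|E]] := flag_cases fA; last by rewrite E imset_f.
have : flag_at h \in @flag_at X @: G by rewrite imset_f.
rewrite -flag_at_orbit => /imsetP[_ /imsetP[k kG ->]]; rewrite -E => /dual_inj/esym.
by move/(flag_at_eq_mirror_flag kG gG).
Qed.

End Duality.
End Automorphisms.

Section CosetFacets.
Variable X : coset_geometry.
Local Notation gT := (cg_type X).
Local Notation G := (cg_group X).
Local Notation K := (@cg_stab X).
Local Notation P := (coset_polytope X).
Variables (q x : gT) (u : point).
Local Notation elt := (hex_elt q x).
Local Notation s1 := (triangle_rot q x).
Hypotheses (qx : hex_action q x) (faithful : faithful_rotations q x).
Hypothesis tr_lattice : forall v, hex_tr q x v = 1 <-> in_lattice u v.
Hypothesis stab4 : K 4 = <<[set q; x]>> :> {set gT}.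
Hypothesis stab14 : K 1 :&: K 4 = <[q]>.
Hypothesis stab24 : K 2 :&: K 4 = <[s1 * q^-1]>.
Hypothesis stab34 : K 3 :&: K 4 = <[s1]>.

Definition face_rot (i : nat) : gT :=
  match i with 1 => q | 2 => s1 * q^-1 | _ => s1 end.

Lemma face_rot_cycle i : (0 < i < 4)%N -> K i :&: K 4 = <[face_rot i]>.
Proof. by case: i => [|[|[|[|]]]]. Qed.

Lemma face_rot_stab i : (0 < i < 4)%N -> face_rot i \in K i.
Proof.
by move=> i4; have := cycle_id (face_rot i); rewrite -face_rot_cycle // => /setIP[].
Qed.

Lemma hex_elt_stab4 v k : elt v k \in K 4.
Proof. by rewrite stab4; apply/hex_eltP => //; exists v, k. Qed.

Lemma hex_elt_group v k : elt v k \in G.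
Proof. exact: subsetP (cg_stab_sub X 4) _ (hex_elt_stab4 v k). Qed.

Lemma edge_rot_mul_hex_elt v k : s1 * q^-1 * elt v k = elt (v + unit_vec k)%R (k + 3).
Proof.
rewrite -mulgA rotV_mul_hex_elt // triangle_rot_mul_hex_elt // -addnS unit_vecD6.
by apply: eq_mod6_hex_elt => //; clear; lia.
Qed.

Lemma face_rot_mul_hex_elt i v k : (0 < i < 4)%N -> exists w l,
  face_rot i * elt v k = elt w l /\ tface i w l = tface i v k.
Proof.
case: i => [|[|[|[|]]]] //= _.
- by exists v, k.+1; rewrite /hex_elt mulgA -expgS.
- by exists (v + unit_vec k)%R, (k + 3)%N; rewrite edge_rot_mul_hex_elt tedgeD3.
- by exists (v + unit_vec k.+1)%R, (k + 4)%N;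
    rewrite triangle_rot_mul_hex_elt // ttriD4.
Qed.

Lemma face_rotX_mul_hex_elt i n v k : (0 < i < 4)%N -> exists w l,
  face_rot i ^+ n * elt v k = elt w l /\ tface i w l = tface i v k.
Proof.
move=> i4; elim: n => [|n [v1 [k1 [eltE tE]]]]; first by exists v, k; rewrite mul1g.
have [w [l [eltE' tE']]] := face_rot_mul_hex_elt v1 k1 i4; exists w, l.
by rewrite expgS -mulgA eltE eltE' tE'.
Qed.

Definition facet_map (g : gT) (f : tess_face) : P :=
  match f with
  | TEmpty => coset_face ord0 g
  | TVertex v => coset_face (inord 1) (hex_tr q x v * g)
  | TEdge v k => coset_face (inord 2) (elt v k * g)
  | TTriangle v k => coset_face (inord 3) (elt v k * g)
  | TPlane => coset_face (inord 4) g
  end.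

Section FacetMap.
Variable g : gT.
Hypothesis gG : g \in G.
Local Notation h := (facet_map g).

Lemma hex_elt_mul_group v k : elt v k * g \in G.
Proof. exact: groupM (hex_elt_group v k) gG. Qed.

Lemma coset_face_rot i v k : (0 < i < 4)%N ->
  coset_face (inord i) (face_rot i * elt v k * g) = coset_face (inord i) (elt v k * g).
Proof.
move=> i4; rewrite -mulgA; apply: coset_faceM; first exact: hex_elt_mul_group.
by rewrite inordK ?face_rot_stab //; move: i4; clear; lia.
Qed.

Lemma facet_map_tedge v k : h (tedge v k) = coset_face (inord 2) (elt v k * g).
Proof.
rewrite /tedge; have := ltn_pmod k (isT : 0 < 6)%N; case: ifP => k3 k6 /=.
  by rewrite inordK // (eq_mod6_hex_elt _ _ (modn_mod k 6)).
rewrite inordK; last by move: k6 k3; clear; lia.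
rewrite -(coset_face_rot (i := 2) v k) // edge_rot_mul_hex_elt.
congr (coset_face _ (_ * _)); apply: eq_mod6_hex_elt => //.
by move: k6 k3; clear; lia.
Qed.

Lemma facet_map_ttri v k : h (ttri v k) = coset_face (inord 3) (elt v k * g).
Proof.
have rotE w l : coset_face (inord 3) (elt w l * g) =
    coset_face (inord 3) (elt (w + unit_vec l.+1)%R (l + 4) * g).
  by rewrite -triangle_rot_mul_hex_elt // -(coset_face_rot (i := 3)).
rewrite -[ttri v k]/(tface 3 v k) -tface_mod6 -(eq_mod6_hex_elt _ _ (modn_mod k 6)) //.
have := ltn_pmod k (isT : 0 < 6)%N.
case: (k %% 6)%N => [|[|[|[|[|[|//]]]]]] _; rewrite /tface /ttri /= ?inordK //.
- by rewrite [RHS]rotE; congr (coset_face _ (_ * _)); apply: eq_mod6_hex_elt.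
- by rewrite [RHS]rotE; congr (coset_face _ (_ * _)); apply: eq_mod6_hex_elt.
- rewrite [RHS]rotE [RHS]rotE -[in RHS]addrA.
  by congr (coset_face _ (_ * _)); apply: eq_mod6_hex_elt.
- rewrite [RHS]rotE [RHS]rotE -[in RHS]addrA.
  by congr (coset_face _ (_ * _)); apply: eq_mod6_hex_elt.
Qed.

Lemma facet_map_tface i v k : (i <= 4)%N ->
  h (tface i v k) = coset_face (inord i) (elt v k * g).
Proof.
case: i => [|[|[|[|[|//]]]]] _ /=.
- apply: (@cface_eq _ _ _ g); rewrite ?mem_coset_face //.
    by apply: val_inj; rewrite /= inordK.
  by rewrite face_coset_improper //= inordK.
- rewrite /hex_elt -(mulgA (q ^+ k)); apply/esym/coset_faceM.
    by have := hex_elt_mul_group v 0; rewrite hex_elt_tr.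
  by rewrite inordK //; apply/groupX/(@face_rot_stab 1).
- exact: facet_map_tedge.
- exact: facet_map_ttri.
- apply/esym; rewrite coset_faceM // inordK //; exact: hex_elt_stab4.
Qed.

Lemma facet_map_index f : face_index (h f) = tess_index f :> nat.
Proof.
have [v [k ->]] := tfaceP f; have i4 := tess_index_le4 f.
by rewrite facet_map_tface ?tess_index_tface //= inordK // ltnS leqW.
Qed.

Lemma facet_map_le f : (h f <= coset_face (inord 4) g)%O.
Proof.
have [v [k ->]] := tfaceP f; have i4 := tess_index_le4 f.
have -> : coset_face (inord 4) g = h (tface 4 v k) by [].
rewrite !facet_map_tface // coset_face_le //; first exact: hex_elt_mul_group.
by rewrite !inordK // ltnS (leq_trans i4).
Qed.

Lemma facet_map_translate t f : in_lattice u t -> h (translate t f) = h f.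
Proof.
move=> ut; have [v [k ->]] := tfaceP f; have i4 := tess_index_le4 f.
rewrite -tface_translate !facet_map_tface //.
by congr (coset_face _ (_ * _)); rewrite /hex_elt hex_trD // (tr_lattice t).2 // mulg1.
Qed.

Lemma facet_map_fiber f f' : h f = h f' <-> translation_orbit u f f'.
Proof.
split=> [eqh|[t ut ->]]; last by rewrite facet_map_translate.
have := congr1 (fun y => face_index y : nat) eqh; rewrite !facet_map_index => eq_index.
have [v [k fE]] := tfaceP f; have [v' [k' fE']] := tfaceP f'.
have i4 := tess_index_le4 f; rewrite -eq_index in fE'.
have [i03|improper] := boolP (0 < tess_index f < 4)%N; last first.
  rewrite fE fE'; case: (tess_index f) i4 improper => [|[|[|[|[|]]]]] //= _ _;
  exact: translation_orbit_refl.
move: eqh; rewrite {1}fE fE' !facet_map_tface //.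
move/(coset_face_eqP _ (hex_elt_mul_group _ _) (hex_elt_mul_group _ _)).
rewrite (inordK (leqW i4 : (_ < 6)%N)) invMg mulgA mulgK => eltK.
have : elt v k * (elt v' k')^-1 \in <[face_rot (tess_index f)]>.
  rewrite -face_rot_cycle // inE eltK /=.
  exact: groupM (hex_elt_stab4 _ _) (groupVr (hex_elt_stab4 _ _)).
case/cycleP=> n rotE; have [w [l [eltE <-]]] := face_rotX_mul_hex_elt n v' k' i03.
have : elt v k = elt w l by rewrite -eltE -rotE mulgKV.
case/(hex_elt_inj qx faithful) => /tr_lattice uvw kl; rewrite {1}fE.
exists (w - v)%R; first by rewrite -opprB; apply: in_latticeN.
by rewrite -tface_translate addrC subrK; apply: eq_mod6_tface.
Qed.

Lemma mem_coset_face4 c :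
  c \in face_coset (coset_face (inord 4) g : P) -> exists v k, c = elt v k * g.
Proof.
rewrite face_coset_coset_face // mem_rcoset inordK // stab4 => /(hex_eltP qx)[v [k cE]].
by exists v, k; rewrite -cE mulgKV.
Qed.

Lemma facet_map_tface_mem y v k : (face_index y <= 4)%N ->
  elt v k * g \in face_coset y -> h (tface (face_index y) v k) = y.
Proof.
by move=> i4 cy; rewrite facet_map_tface // inord_val; apply/esym/coset_faceE.
Qed.

Lemma facet_map_homo f f' : tri_le f f' -> (h f <= h f')%O.
Proof.
move=> ff'; have ij := tri_le_index ff'; have [v [k [-> ->]]] := tri_le_tface ff'.
have j4 := tess_index_le4 f'; have i4 := leq_trans ij j4.
rewrite !facet_map_tface //; apply: coset_face_le; first exact: hex_elt_mul_group.
by rewrite !inordK // ltnS leqW.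
Qed.

Lemma facet_map_reflects_le f f' : (h f <= h f')%O ->
  exists2 f2, translation_orbit u f' f2 & tri_le f f2.
Proof.
move=> ff'; have [c [cf cf' cF]] := cface_le_common ff' (facet_map_le f').
have [v [k cE]] := mem_coset_face4 cF; rewrite cE in cf cf'.
have tfE e : elt v k * g \in face_coset (h e) -> h (tface (tess_index e) v k) = h e.
  move=> ce; rewrite -{1}facet_map_index facet_map_tface_mem //.
  by rewrite facet_map_index tess_index_le4.
have /facet_map_fiber[t ut ->] := tfE f cf.
exists (translate t (tface (tess_index f') v k)).
  apply: (@translation_orbit_trans _ _ (tface (tess_index f') v k)); last by exists t.
  exact/facet_map_fiber/esym/tfE.
apply/tri_le_translate/tface_le; have := face_index_le ff'.
by rewrite !facet_map_index tess_index_le4 andbT.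
Qed.

Lemma facet_torus_cover : torus_cover u
  (@below_le 4 P (coset_face (inord 4) g)) (fun f => exist _ (h f) (facet_map_le f)).
Proof.
split.
- case=> y yF; have /cface_leP[_ [c cy cF]] := yF.
  have [v [k cE]] := mem_coset_face4 cF.
  have y4 : (face_index y <= 4)%N by have := face_index_le yF; rewrite /= inordK.
  exists (tface (face_index y) v k); apply: eq_exist.
  by rewrite facet_map_tface_mem -?cE.
- move=> f f'; rewrite -facet_map_fiber; split=> [/(congr1 sval)//|eqh].
  exact: eq_exist.
- move=> f f'; split=> [|[f2 [t ut ->]] le]; first exact: facet_map_reflects_le.
  by rewrite /below_le /= -(facet_map_translate f' ut) facet_map_homo.
Qed.

End FacetMap.

Lemma coset_has_facets : has_facets P (@map36 u).
Proof.
move=> F rF; have iF : face_index F = inord 4.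
  apply: val_inj; rewrite /= inordK //; move: rF.
  by rewrite -[rank F]/(face_rank F) /face_rank; clear; lia.
have [g gF] := face_coset_nonempty F; rewrite (coset_faceE gF) iF.
exact: iso_of_torus_cover (facet_torus_cover (face_coset_group gF)).
Qed.

End CosetFacets.

(** * The polytope of a rotation system *)

Section SmallGroups.
Variable gT : finGroupType.
Implicit Types g h : gT.

Lemma mem_cycle_expg2 g h : g ^+ 2 = 1 -> h \in <[g]> -> h = 1 \/ h = g.
Proof.
move=> g2 /cycleP[n ->]; rewrite -(expg_mod n g2).
by have := ltn_pmod n (isT : 0 < 2)%N; case: (n %% 2)%N => [|[|]] // _; [left|right].
Qed.

Lemma prime_cycle_TI p g (H : {group gT}) :
  prime p -> g ^+ p = 1 -> g \notin H -> <[g]> :&: H = 1.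
Proof.
move=> p_pr gp gH; apply: prime_TIg; last by rewrite cycle_subG.
by rewrite -orderE (nt_prime_order p_pr gp) //; apply: contraNneq gH => ->.
Qed.

Lemma mulg_cycle_capl p g h (K : {set gT}) (H : {group gT}) : prime p ->
  h ^+ p = 1 -> K = <[g]> * <[h]> -> g \in H -> h \notin H -> K :&: H = <[g]>.
Proof.
move=> p_pr hp -> gH hH.
by rewrite -group_modl ?cycle_subG // (prime_cycle_TI p_pr hp hH) mulg1.
Qed.

Lemma mulg_cycle_capr p g h (K : {set gT}) (H : {group gT}) : prime p ->
  g ^+ p = 1 -> K = <[g]> * <[h]> -> g \notin H -> h \in H -> K :&: H = <[h]>.
Proof.
move=> p_pr gp -> gH hH; rewrite setIC -group_modr ?cycle_subG // setIC.
by rewrite (prime_cycle_TI p_pr gp gH) mul1g.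
Qed.

Lemma expg2_mulC g h : (g * h) ^+ 2 = 1 -> (h * g) ^+ 2 = 1.
Proof.
move=> gh2; have -> : h * g = (g * h) ^ g by rewrite conjgE !mulgA mulVg mul1g.
by rewrite -conjXg gh2 conj1g.
Qed.

Lemma invg_expg2 g : g ^+ 2 = 1 -> g^-1 = g.
Proof. by move=> g2; apply: (mulgI g); rewrite mulgV -expg2. Qed.

(* [h] inverts [g]. *)
Lemma gen2_mul_cycle g h :
  h ^+ 2 = 1 -> (g * h) ^+ 2 = 1 -> <<[set g; h]>> = <[g]> * <[h]>.
Proof.
move=> h2 gh2; rewrite -[<<_>>]/([set g] <*> [set h]) -joing_idl -joing_idr.
rewrite norm_joinEr // cycle_subG; apply/normP/eqP; rewrite -cycleJ.
have -> : g ^ h = g^-1; last by rewrite cycleV.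
rewrite conjgE (invg_expg2 h2); apply: (mulgI g).
by rewrite mulgV -gh2 expg2 !mulgA.
Qed.

Lemma mem_gen2 g h : g \in <<[set g; h]>> /\ h \in <<[set g; h]>>.
Proof. by split; rewrite mem_gen // (set21, set22). Qed.

Lemma eq_gen2 g h g' h' : g \in <<[set g'; h']>> -> h \in <<[set g'; h']>> ->
  g' \in <<[set g; h]>> -> h' \in <<[set g; h]>> -> <<[set g; h]>> = <<[set g'; h']>>.
Proof.
move=> gG hG g'G h'G; apply/eqP; rewrite eqEsubset !gen_subG.
by apply/andP; split; apply/subsetP=> y /set2P[]->.
Qed.

Lemma gen2_mull g h : <<[set g; g * h]>> = <<[set g; h]>>.
Proof.
have [[g1 h1] [g2 gh2]] := (mem_gen2 g h, mem_gen2 g (g * h)).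
by apply: eq_gen2; rewrite // ?groupM // -(groupMl _ g2).
Qed.

Lemma gen2_mulr g h : <<[set g; h * g]>> = <<[set g; h]>>.
Proof.
have [[g1 h1] [g2 gh2]] := (mem_gen2 g h, mem_gen2 g (h * g)).
by apply: eq_gen2; rewrite // ?groupM // -(groupMr _ g2).
Qed.

Lemma gen2V g h : <<[set g^-1; h^-1]>> = <<[set g; h]>>.
Proof. by rewrite -[RHS]genV invUg !invg_set1. Qed.

End SmallGroups.

Section RotationGeometry.
Variables (gT : finGroupType) (s1 s2 s3 d : gT) (L : point -> Prop).
Hypothesis rot : rotation_system s1 s2 s3 d L.
Local Notation q := (s2^-1).
Local Notation x := (unit_shift s1 s2).
Local Notation elt := (hex_elt q x).
Hypotheses (faithful : faithful_rotations q x) (unit_notin_L : ~ L (1, 0)%R).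
Local Notation s12 := (s1 * s2).
Local Notation s23 := (s2 * s3).
Local Notation s123 := (s1 * s2 * s3).

Let hex : hex_action q x := rot_hex rot.
Let s1_cube : s1 ^+ 3 = 1 := rot_s1 rot.
Let s12_sqr : s12 ^+ 2 = 1 := rot_s12 rot.
Let s123_sqr : s123 ^+ 2 = 1 := rot_s123 rot.

Lemma s3_cube : s3 ^+ 3 = 1.
Proof.
by apply: invg_inj; rewrite -expVgn -(rot_dual1 rot) -conjXg s1_cube conj1g invg1.
Qed.

Lemma s23_sqr : s23 ^+ 2 = 1.
Proof.
apply: invg_inj; rewrite -expVgn invMg -(rot_dual1 rot) -(rot_dual2 rot).
by rewrite -conjMg -conjXg s12_sqr conj1g invg1.
Qed.

(** [rot_stab i] is the stabiliser of the base face of index [i], generated by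
    the products [(rot_adj j)^-1 * rot_adj k] with [j] and [k] different from [i]. *)
Definition rot_stab (i : nat) : {group gT} :=
  match i with
  | 1 => <<[set s2; s3]>>%G
  | 2 => <<[set s12; s3]>>%G
  | 3 => <<[set s1; s23]>>%G
  | 4 => <<[set s1; s2]>>%G
  | _ => <<[set s1; s2; s3]>>%G
  end.

Definition rot_adj (i : nat) : gT :=
  match i with 2 => s1 | 3 => s12 | 4 => s123 | _ => 1 end.

Lemma rot_mem : [/\ s1 \in rot_stab 0, s2 \in rot_stab 0 & s3 \in rot_stab 0].
Proof. by split; apply: mem_gen; rewrite !inE eqxx ?orbT. Qed.

Lemma s2_stab1 : s2 \in rot_stab 1. Proof. exact: (mem_gen2 s2 s3).1. Qed.
Lemma s3_stab1 : s3 \in rot_stab 1. Proof. exact: (mem_gen2 s2 s3).2. Qed.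
Lemma s12_stab2 : s12 \in rot_stab 2. Proof. exact: (mem_gen2 s12 s3).1. Qed.
Lemma s3_stab2 : s3 \in rot_stab 2. Proof. exact: (mem_gen2 s12 s3).2. Qed.
Lemma s1_stab3 : s1 \in rot_stab 3. Proof. exact: (mem_gen2 s1 s23).1. Qed.
Lemma s23_stab3 : s23 \in rot_stab 3. Proof. exact: (mem_gen2 s1 s23).2. Qed.
Lemma s1_stab4 : s1 \in rot_stab 4. Proof. exact: (mem_gen2 s1 s2).1. Qed.
Lemma s2_stab4 : s2 \in rot_stab 4. Proof. exact: (mem_gen2 s1 s2).2. Qed.
Lemma s23_stab1 : s23 \in rot_stab 1. Proof. exact: groupM s2_stab1 s3_stab1. Qed.
Lemma s12_stab4 : s12 \in rot_stab 4. Proof. exact: groupM s1_stab4 s2_stab4. Qed.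
Lemma s123_stab2 : s123 \in rot_stab 2. Proof. exact: groupM s12_stab2 s3_stab2. Qed.
Lemma s123_stab3 : s123 \in rot_stab 3.
Proof. by rewrite -mulgA; apply: groupM s1_stab3 s23_stab3. Qed.

Lemma rot_stab_sub i : rot_stab i \subset rot_stab 0.
Proof.
have [m1 m2 m3] := rot_mem.
by case: i => [|[|[|[|[|i]]]]] //; rewrite gen_subG; apply/subsetP=> g /set2P[]->;
  rewrite // groupM.
Qed.

Lemma rot_stab4E : rot_stab 4 = <<[set q; x]>> :> {set gT}.
Proof.
have [qG xG] := mem_gen2 q x; apply: eq_gen2.
- rewrite -{1}(triangle_rot_unit_shift s1 s2).
  exact: groupM (groupM (groupX 3 qG) xG) qG.
- by rewrite -groupV.
- by rewrite groupV s2_stab4.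
- by rewrite !groupM ?groupX ?s1_stab4 ?s2_stab4.
Qed.

Lemma rot_stab2_s3_s12 : rot_stab 2 = <[s3]> * <[s12]> :> {set gT}.
Proof. by rewrite -gen2_mul_cycle ?s12_sqr ?(expg2_mulC s123_sqr) // setUC. Qed.

Lemma rot_stab2_s3_s123 : rot_stab 2 = <[s3]> * <[s123]> :> {set gT}.
Proof.
rewrite -gen2_mul_cycle ?s123_sqr //; first by rewrite gen2_mulr setUC.
have -> : s3 * s123 = s12^-1.
  by apply: (mulIg s12); rewrite mulVg -(expg2_mulC s123_sqr) expg2 !mulgA.
by rewrite expVgn s12_sqr invg1.
Qed.

Lemma rot_stab3_s1_s23 : rot_stab 3 = <[s1]> * <[s23]> :> {set gT}.
Proof. by rewrite -gen2_mul_cycle ?s23_sqr // mulgA s123_sqr. Qed.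

Lemma rot_stab3_s1_s123 : rot_stab 3 = <[s1]> * <[s123]> :> {set gT}.
Proof.
rewrite -gen2_mul_cycle ?s123_sqr //; first by rewrite -mulgA gen2_mull.
have -> : s1 * s123 = s23 ^ s1^-1.
  rewrite -(invg_expg2 s123_sqr) conjgE invgK -(mulgA s1 s2) invMg.
  by rewrite (invg_expg2 s23_sqr).
by rewrite -conjXg s23_sqr conj1g.
Qed.

Lemma rot_stab14 : rot_stab 1 :&: rot_stab 4 = <[s2]>.
Proof.
apply/eqP; rewrite eqEsubset cycle_subG inE s2_stab1 s2_stab4 !andbT.
apply/subsetP=> g /setIP[g1]; rewrite rot_stab4E => /(hex_eltP hex)[v [k gE]].
have qK : q ^+ k \in rot_stab 1 by rewrite groupX // groupV s2_stab1.
have : facet_tr s1 s2 v \in rot_stab 1.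
  by rewrite -(groupMl _ qK) -[_ * _]/(elt v k) -gE.
move/(rot_tr_vertex rot)/(rot_tr rot) => tr1.
by rewrite gE /hex_elt -/(facet_tr s1 s2 v) tr1 mulg1 expVgn groupV mem_cycle.
Qed.

Lemma s1_notin_s2 : s1 \notin <[s2]>.
Proof.
apply/negP; rewrite -cycleV => /cycleP[n s1E]; apply: unit_notin_L.
have : elt (unit_vec 1) 4 = elt 0%R n.
  by rewrite -(triangle_rotE hex) triangle_rot_unit_shift hex_elt_rot.
case/(hex_elt_inj hex faithful); rewrite subr0 => tr1 _.
apply/(rot_tr rot); apply: (conjg_inj q); rewrite /facet_tr hex_trJ // conj1g.
exact: tr1.
Qed.

Lemma s3_notin_s2 : s3 \notin <[s2]>.
Proof.
apply: contra s1_notin_s2 => s3s2.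
have : s3 ^ d \in <[s2]> :^ d by rewrite memJ_conjg.
by rewrite -cycleJ (rot_dual2 rot) (rot_dual3 rot) cycleV groupV.
Qed.

Lemma s2_cube_neq1 : s2 ^+ 3 <> 1.
Proof.
move=> s2_cube; have : elt 0%R 3 = 1 by rewrite hex_elt_rot expVgn s2_cube invg1.
by move/faithful.
Qed.

Lemma s2_notin_cycle3 g : g ^+ 3 = 1 -> s2 \notin <[g]>.
Proof.
move=> g3; apply/negP=> /cycleP[n s2E]; apply: s2_cube_neq1.
by rewrite s2E -expgM mulnC expgM g3 expg1n.
Qed.

Lemma s1_notin_stab1 : s1 \notin rot_stab 1.
Proof. by apply: contra s1_notin_s2 => s1_1; rewrite -rot_stab14 inE s1_1 s1_stab4. Qed.

Lemma s3_notin_stab4 : s3 \notin rot_stab 4.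
Proof. by apply: contra s3_notin_s2 => s3_4; rewrite -rot_stab14 inE s3_stab1. Qed.

Lemma s12_notin_stab1 : s12 \notin rot_stab 1.
Proof. by rewrite groupMr ?s2_stab1 ?s1_notin_stab1. Qed.

Lemma s23_notin_stab4 : s23 \notin rot_stab 4.
Proof. by rewrite groupMl ?s2_stab4 ?s3_notin_stab4. Qed.

Lemma s12_notin_s1 : s12 \notin <[s1]>.
Proof. by apply: contra (s2_notin_cycle3 s1_cube); rewrite groupMl ?cycle_id. Qed.

Lemma s23_notin_s3 : s23 \notin <[s3]>.
Proof. by apply: contra (s2_notin_cycle3 s3_cube); rewrite groupMr ?cycle_id. Qed.

Lemma rot_stab24 : rot_stab 2 :&: rot_stab 4 = <[s12]>.
Proof.
exact: mulg_cycle_capr (isT : prime 3) s3_cube rot_stab2_s3_s12 s3_notin_stab4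
  s12_stab4.
Qed.

Lemma rot_stab34 : rot_stab 3 :&: rot_stab 4 = <[s1]>.
Proof.
exact: mulg_cycle_capl (isT : prime 2) s23_sqr rot_stab3_s1_s23 s1_stab4
  s23_notin_stab4.
Qed.

Lemma rot_stab12 : rot_stab 1 :&: rot_stab 2 = <[s3]>.
Proof.
rewrite setIC.
exact: mulg_cycle_capl (isT : prime 2) s12_sqr rot_stab2_s3_s12 s3_stab1
  s12_notin_stab1.
Qed.

Lemma rot_stab13 : rot_stab 1 :&: rot_stab 3 = <[s23]>.
Proof.
rewrite setIC.
exact: mulg_cycle_capr (isT : prime 3) s1_cube rot_stab3_s1_s23 s1_notin_stab1
  s23_stab1.
Qed.

Lemma s3_notin_stab3 : s3 \notin rot_stab 3.
Proof.
apply: contra s3_notin_s2 => s3_3.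
have : s3 \in <[s23]> :&: <[s3]> by rewrite -rot_stab13 !inE s3_stab1 s3_3 cycle_id.
by rewrite (prime_cycle_TI (isT : prime 2) s23_sqr s23_notin_s3) => /set1gP->.
Qed.

Lemma rot_stab23 : rot_stab 2 :&: rot_stab 3 = <[s123]>.
Proof.
exact: mulg_cycle_capr (isT : prime 3) s3_cube rot_stab2_s3_s123 s3_notin_stab3
  s123_stab3.
Qed.

Lemma rot_stab_factor i j k : (i < j < k)%N -> (k <= 5)%N ->
  rot_stab j \subset (rot_stab j :&: rot_stab i) * (rot_stab j :&: rot_stab k).
Proof.
have stab5 l : rot_stab l \subset rot_stab 5 := rot_stab_sub l.
have swap g h : rot_stab 3 = <[g]> * <[h]> :> {set gT} ->
    rot_stab 3 = <[h]> * <[g]> :> {set gT}.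
  move=> stab3E; have gs : group_set (<[g]> * <[h]>) by rewrite -stab3E groupP.
  by rewrite stab3E; apply: (comm_group_setP gs).
case: i => [|i]; first by rewrite (setIidPl (rot_stab_sub j)) mulG_subl.
case/andP=> ij jk k5; have [->|k5'] := eqVneq k 5.
  by rewrite (setIidPl (stab5 j)) mulG_subr.
move: i j k ij jk k5 k5'.
case=> [|[|[|[|i]]]] [|[|[|[|[|j]]]]] [|[|[|[|[|[|k]]]]]] // _ _ _ _.
- by rewrite (setIC (rot_stab 2)) rot_stab12 rot_stab23 -rot_stab2_s3_s123.
- by rewrite (setIC (rot_stab 2)) rot_stab12 rot_stab24 -rot_stab2_s3_s12.
- by rewrite (setIC (rot_stab 3)) rot_stab13 rot_stab34 -(swap _ _ rot_stab3_s1_s23).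
- by rewrite (setIC (rot_stab 3)) rot_stab23 rot_stab34 -(swap _ _ rot_stab3_s1_s123).
Qed.

Lemma rot_stab_diamond i : (i < 4)%N -> exists y,
  [/\ y \in rot_stab i :&: rot_stab i.+2, y \notin rot_stab i.+1 &
      rot_stab i :&: rot_stab i.+2 \subset rot_stab i.+1 :|: rot_stab i.+1 :* y].
Proof.
have split2 (K : {group gT}) (D : {set gT}) g h : h ^+ 2 = 1 -> g \in K ->
    D = <[g]> * <[h]> -> D \subset K :|: K :* h.
  move=> h2 gK ->; apply/subsetP=> _ /mulsgP[u v ug vh ->]; rewrite inE mem_rcoset.
  have uK : u \in K by apply: subsetP ug; rewrite cycle_subG.
  by case: (mem_cycle_expg2 h2 vh) => ->; rewrite ?mulg1 ?mulgK uK ?orbT.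
have cycle2 (K : {group gT}) (D : {set gT}) h : h ^+ 2 = 1 -> D = <[h]> ->
    D \subset K :|: K :* h.
  move=> h2 DE; apply: (split2 K D 1 h h2 (group1 K)).
  by rewrite DE cycle1 mul1g.
case: i => [|[|[|[|//]]]] _.
- exists s12; rewrite (setIidPr (rot_stab_sub 2)) s12_stab2 s12_notin_stab1; split=> //.
  exact: split2 s12_sqr s3_stab1 rot_stab2_s3_s12.
- exists s23; rewrite rot_stab13 cycle_id; split=> //; last exact: cycle2 s23_sqr _.
  by apply: contra s23_notin_s3 => s23_2; rewrite -rot_stab12 inE s23_stab1.
- exists s12; rewrite rot_stab24 cycle_id; split=> //; last exact: cycle2 s12_sqr _.
  by apply: contra s12_notin_s1 => s12_3; rewrite -rot_stab34 inE s12_3 s12_stab4.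
- exists s23; rewrite (setIidPl (rot_stab_sub 3)) s23_stab3 s23_notin_stab4; split=> //.
  exact: split2 s23_sqr s1_stab4 rot_stab3_s1_s23.
Qed.

Lemma rot_adj_mem i : rot_adj i \in rot_stab 0.
Proof.
have [m1 m2 m3] := rot_mem.
by case: i => [|[|[|[|[|i]]]]] /=; rewrite ?group1 ?groupM.
Qed.

Lemma rot_adjE : [/\ (rot_adj 1)^-1 * rot_adj 2 = s1, (rot_adj 1)^-1 * rot_adj 3 = s12,
    (rot_adj 1)^-1 * rot_adj 4 = s123
  & [/\ (rot_adj 2)^-1 * rot_adj 3 = s2, (rot_adj 2)^-1 * rot_adj 4 = s23
      & (rot_adj 3)^-1 * rot_adj 4 = s3]].
Proof. by rewrite /= invg1 !mul1g -(mulgA s1) !mulKg (mulgA s1) mulKg. Qed.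

Lemma rot_adj_stab i j l : proper_index i -> proper_index j -> proper_index l ->
  l != i -> l != j -> (rot_adj i)^-1 * rot_adj j \in rot_stab l.
Proof.
have [E12 E13 E14 [E23 E24 E34]] := rot_adjE.
have lt_case i' j' : proper_index i' -> proper_index j' -> proper_index l ->
    l != i' -> l != j' -> (i' < j')%N -> (rot_adj i')^-1 * rot_adj j' \in rot_stab l.
  case: i' => [|[|[|[|[|i']]]]] //; case: j' => [|[|[|[|[|j']]]]] // _ _;
  rewrite ?E12 ?E13 ?E14 ?E23 ?E24 ?E34; case: l => [|[|[|[|[|l]]]]] // _ _ _ _;
  by rewrite ?s2_stab1 ?s3_stab1 ?s12_stab2 ?s3_stab2 ?s1_stab3 ?s23_stab3 ?s1_stab4
    ?s2_stab4 ?s23_stab1 ?s12_stab4 ?s123_stab2 ?s123_stab3.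
move=> pi pj pl li lj; case: (ltngtP i j) => [ij|ji|->]; first exact: lt_case.
- by rewrite -groupV invMg invgK; apply: lt_case.
- by rewrite mulVg group1.
Qed.

Lemma rot_adj2 : rot_adj 2 \in rot_stab 2 * rot_stab 1.
Proof.
have -> : rot_adj 2 = s12 * s2^-1 by rewrite mulgK.
exact: mem_mulg s12_stab2 (groupVr s2_stab1).
Qed.

Lemma mem_rotations_off (J : pred nat) (T := <<rotations_off rot_adj J>>) :
  [/\ ~~ J 1%N -> ~~ J 2%N -> s1 \in T, ~~ J 1%N -> ~~ J 3%N -> s12 \in T,
      ~~ J 1%N -> ~~ J 4%N -> s123 \in T
    & [/\ ~~ J 2%N -> ~~ J 3%N -> s2 \in T, ~~ J 2%N -> ~~ J 4%N -> s23 \in T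
        & ~~ J 3%N -> ~~ J 4%N -> s3 \in T]].
Proof.
have mem i j : proper_index i -> proper_index j -> ~~ J i -> ~~ J j ->
    (rot_adj i)^-1 * rot_adj j \in T.
  move=> pi pj Ji Jj; apply: mem_gen; apply/imset2P.
  exists (Ordinal (index_nat_face pi)) (Ordinal (index_nat_face pj)) => //;
    by rewrite inE /= ?pi ?pj.
have [E12 E13 E14 [E23 E24 E34]] := rot_adjE.
have mem12 := mem 1%N 2%N isT isT; have mem13 := mem 1%N 3%N isT isT.
have mem14 := mem 1%N 4%N isT isT; have mem23 := mem 2%N 3%N isT isT.
have mem24 := mem 2%N 4%N isT isT; have mem34 := mem 3%N 4%N isT isT.
by rewrite E12 E13 E14 E23 E24 E34 in mem12 mem13 mem14 mem23 mem24 mem34.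
Qed.

Lemma rot_stab_triple i j k g : (0 < i < j)%N -> (j < k < 5)%N ->
  g \in rot_stab i -> g \in rot_stab j -> g \in rot_stab k -> g = 1.
Proof.
have cap (K H : {group gT}) (D : {set gT}) : K :&: H = D ->
    g \in K -> g \in H -> g \in D.
  by move=> <- gK gH; rewrite inE gK.
have cap1 p y (H : {group gT}) : prime p -> y ^+ p = 1 -> y \notin H ->
    g \in <[y]> -> g \in H -> g = 1.
  move=> p_pr yp yH gy gH.
  by apply/set1gP; rewrite -(prime_cycle_TI p_pr yp yH) inE gy.
case/andP=> i0 ij /andP[jk k5] gi gj gk; move: i j k i0 ij jk k5 gi gj gk.
case=> [|[|[|i]]] [|[|[|[|j]]]] [|[|[|[|[|k]]]]] // _ _ _ _ gi gj gk.
- apply: (cap1 2 s23 <[s3]>%G isT s23_sqr s23_notin_s3).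
    exact: cap rot_stab13 gi gk.
  exact: cap rot_stab12 gi gj.
- apply: (cap1 3 s3 <[s2]>%G isT s3_cube s3_notin_s2).
    exact: cap rot_stab12 gi gj.
  exact: cap rot_stab14 gi gk.
- apply: (cap1 3 s1 <[s2]>%G isT s1_cube s1_notin_s2).
    exact: cap rot_stab34 gj gk.
  exact: cap rot_stab14 gi gk.
- apply: (cap1 2 s12 <[s1]>%G isT s12_sqr s12_notin_s1).
    exact: cap rot_stab24 gi gk.
  exact: cap rot_stab34 gj gk.
Qed.

Lemma rot_stab_generated (J : pred nat) g : g \in rot_stab 0 ->
    (forall j, proper_index j -> J j -> g \in rot_stab j) ->
  g \in <<rotations_off rot_adj J>>.
Proof.
move=> g0 gJ; set T := << _ >>.
have triple i j k : (0 < i < j)%N -> (j < k < 5)%N -> J i -> J j -> J k -> g \in T.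
  move=> ij jk Ji Jj Jk.
  have [pi pj pk] : [/\ proper_index i, proper_index j & proper_index k].
    by move: ij jk; rewrite /proper_index; clear; split; lia.
  by rewrite (rot_stab_triple ij jk (gJ i pi Ji) (gJ j pj Jj) (gJ k pk Jk)) group1.
have in_cap (K H : {group gT}) y : K :&: H = <[y]> -> y \in T -> g \in K -> g \in H ->
    g \in T.
  move=> KHE yT gK gH; have : g \in K :&: H by rewrite inE gK.
  by rewrite KHE; apply: subsetP; rewrite cycle_subG.
have in_gen2 y z : y \in T -> z \in T -> g \in <<[set y; z]>> -> g \in T.
  by move=> yT zT; apply: subsetP; rewrite gen_subG; apply/subsetP=> t /set2P[]->.
have [g1 g2] := (gJ 1%N isT, gJ 2%N isT); have [g3 g4] := (gJ 3%N isT, gJ 4%N isT).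
have [t12 t13 t14 [t23 t24 t34]] := mem_rotations_off J.
case J1: (J 1%N) g1 t12 t13 t14 => g1 t12 t13 t14;
case J2: (J 2%N) g2 t12 t23 t24 => g2 t12 t23 t24;
case J3: (J 3%N) g3 t13 t23 t34 => g3 t13 t23 t34;
case J4: (J 4%N) g4 t14 t24 t34 => g4 t14 t24 t34.
- exact: triple 1%N 2%N 3%N isT isT J1 J2 J3.
- exact: triple 1%N 2%N 3%N isT isT J1 J2 J3.
- exact: triple 1%N 2%N 4%N isT isT J1 J2 J4.
- exact: in_cap rot_stab12 (t34 isT isT) (g1 isT) (g2 isT).
- exact: triple 1%N 3%N 4%N isT isT J1 J3 J4.
- exact: in_cap rot_stab13 (t24 isT isT) (g1 isT) (g3 isT).
- exact: in_cap rot_stab14 (t23 isT isT) (g1 isT) (g4 isT).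
- exact: in_gen2 (t23 isT isT) (t34 isT isT) (g1 isT).
- exact: triple 2%N 3%N 4%N isT isT J2 J3 J4.
- exact: in_cap rot_stab23 (t14 isT isT) (g2 isT) (g3 isT).
- exact: in_cap rot_stab24 (t13 isT isT) (g2 isT) (g4 isT).
- exact: in_gen2 (t13 isT isT) (t34 isT isT) (g2 isT).
- exact: in_cap rot_stab34 (t12 isT isT) (g3 isT) (g4 isT).
- exact: in_gen2 (t12 isT isT) (t24 isT isT) (g3 isT).
- exact: in_gen2 (t12 isT isT) (t23 isT isT) (g4 isT).
- move: g0; apply: subsetP; rewrite gen_subG; apply/subsetP=> y.
  by case/setUP=> [/set2P[]|/set1P]->; rewrite (t12, t23, t34).
Qed.

Definition rot_geometry : coset_geometry :=
  @CosetGeometry gT (rot_stab 0) rot_stab rot_adj rot_stab_sub erefl erefl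
    rot_stab_factor rot_stab_diamond erefl rot_adj_mem rot_adj_stab rot_adj2
    s1_notin_stab1 rot_stab_generated.

Lemma rot_geometry_duality : @cg_duality rot_geometry d.
Proof.
have [d1 d2 d3] := And3 (rot_dual1 rot) (rot_dual2 rot) (rot_dual3 rot).
have ds12 : s12 ^ d = s23^-1 by rewrite conjMg d1 d2 -invMg.
have ds23 : s23 ^ d = s12^-1 by rewrite conjMg d2 d3 -invMg.
have gen2J (g h : gT) : <<[set g; h]>> :^ d = <<[set g ^ d; h ^ d]>>.
  by rewrite -genJ conjUg !conjg_set1.
have stab0J : rot_stab 0 :^ d = rot_stab 0.
  apply/eqP; rewrite eqEcard cardJg leqnn andbT -genJ !conjUg !conjg_set1 d1 d2 d3.
  have [m1 m2 m3] := rot_mem; rewrite gen_subG; apply/subsetP=> y.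
  by case/setUP=> [/set2P[]|/set1P]->; rewrite groupV.
case=> [|[|[|[|[|[|//]]]]]] _ /=; first exact: stab0J.
- by rewrite gen2J d2 d3 gen2V setUC.
- by rewrite gen2J ds12 d3 gen2V setUC.
- by rewrite gen2J d1 ds23 gen2V setUC.
- by rewrite gen2J d1 d2 gen2V setUC.
- exact: stab0J.
Qed.

Lemma rot_geometry_facets u : (forall v, L v <-> in_lattice u v) ->
  has_facets (coset_polytope rot_geometry) (@map36 u).
Proof.
move=> Lu; apply: (@coset_has_facets rot_geometry q x u hex faithful).
- by move=> v; rewrite -Lu; apply: rot_tr rot v.
- exact: rot_stab4E.
- by rewrite cycleV; apply: rot_stab14.
- by rewrite triangle_rot_unit_shift invgK; apply: rot_stab24.
- by rewrite triangle_rot_unit_shift; apply: rot_stab34.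
Qed.

Lemma mirror_symmetric_facet_tr : mirror_symmetric rot_geometry ->
  exists2 alpha : {morphism rot_stab 0 >-> gT}, alpha @* rot_stab 0 = rot_stab 0 &
    forall v, alpha (facet_tr s1 s2 v) = facet_tr s1 s2 (- v.1 - v.2, v.2)%R.
Proof.
case=> alpha alpha_im alphaE; exists alpha => // v.
have [m1 m2 m3] := rot_mem; have [E12 _ _ [E23 _ _]] := rot_adjE.
have alpha1 : alpha s1 = s1^-1.
  by have := alphaE 0%N 1%N isT isT; rewrite /= invg1 !mul1g.
have alpha2 : alpha s2 = s1 * q * s1^-1.
  by have := alphaE 1%N 2%N isT isT; rewrite /= mulKg invMg mulgA.
have [q0 x0] : q \in rot_stab 0 /\ x \in rot_stab 0.
  by rewrite groupV !groupM ?groupX.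
have alphaq : alpha q = s1 * s2 * s1^-1.
  by rewrite morphV // alpha2 !invMg !invgK mulgA.
have alphax : alpha x = facet_tr s1 s2 (-1, 0)%R.
  rewrite /facet_tr -(reflected_unit_shift hex) triangle_rot_unit_shift.
  rewrite morphM ?(groupM (groupX 3 m2) m1) // morphM ?groupX // morphX //.
  by rewrite alpha1 alpha2.
have := reflected_unit_shiftJ hex.
rewrite triangle_rot_unit_shift invgK -alphaq -/(facet_tr s1 s2 _) => shiftJ.
rewrite /facet_tr morph_hex_tr // {1}/hex_tr alphax shiftJ /facet_tr.
rewrite !(zpow_hex_tr hex) -(hex_trD hex).
by congr hex_tr; rewrite !mulpE addpE; congr pair; clear; lia.
Qed.

Theorem rotation_system_polytope :
  (forall alpha : {morphism <<[set s1; s2; s3]>> >-> gT},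
     alpha @* <<[set s1; s2; s3]>> = <<[set s1; s2; s3]>> ->
     exists v, alpha (facet_tr s1 s2 v) <> facet_tr s1 s2 (- v.1 - v.2, v.2)%R) ->
  exists P : polytope 4,
    [/\ chiral P, properly_self_dual P, Gamma P \isog <<[set s1; s2; s3]>>
      & forall u, (forall v, L v <-> in_lattice u v) ->
          has_type P (@map36 u) (@map63 u)].
Proof.
move=> no_mirror; have asymmetric : ~ mirror_symmetric rot_geometry.
  by case/mirror_symmetric_facet_tr=> alpha /no_mirror[v neq] /(_ v).
exists (coset_polytope rot_geometry); split.
- exact: coset_chiral.
- exact: coset_properly_self_dual rot_geometry_duality asymmetric.
- exact: Gamma_isog.
- move=> u Lu; apply: (self_dual_has_type (dual_perm_duality rot_geometry_duality)).
    exact: map63_dual.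
  exact: rot_geometry_facets.
Qed.

End RotationGeometry.

(** * Products with a simple group *)

Section DirectProducts.
Variables (aT bT : finGroupType).

Lemma morphim_gen_fst (D : {set aT * bT}) : fst @* <<D>> = <<[set g.1 | g in D]>>.
Proof. by rewrite morphim_gen ?subsetT // morphimEsub ?subsetT. Qed.

Lemma morphim_gen_snd (D : {set aT * bT}) : snd @* <<D>> = <<[set g.2 | g in D]>>.
Proof. by rewrite morphim_gen ?subsetT // morphimEsub ?subsetT. Qed.

Lemma facet_tr_pair (s t : aT) (s' t' : bT) v :
  facet_tr (s, s') (t, t') v = (facet_tr s t v, facet_tr s' t' v).
Proof.
apply: injective_projections.
  by apply: (morph_hex_tr (fst_morphism aT bT)); rewrite in_setT.
by apply: (morph_hex_tr (snd_morphism aT bT)); rewrite in_setT.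
Qed.

Lemma faithful_rotations_pair (q x : aT * bT) :
  faithful_rotations q.1 x.1 -> faithful_rotations q x.
Proof.
move=> faithful v k elt1; apply: (faithful v).
by rewrite -(morph_hex_elt (fst_morphism aT bT)) ?in_setT // elt1.
Qed.

Lemma rotation_system_pair s1 s2 s3 d L t1 t2 t3 e M :
  rotation_system s1 s2 s3 d L -> rotation_system t1 t2 t3 e M ->
  @rotation_system (aT * bT)%type (s1, t1) (s2, t2) (s3, t3) (d, e)
    (fun v => L v /\ M v).
Proof.
move=> rotL rotM; case: (rotL) (rotM) =>
  [a1 a12 a123 [ac a2 a6] aL aLv d1 d2 d3] [b1 b12 b123 [bc b2 b6] bM bMv e1 e2 e3].
split; try by apply: injective_projections.
- by split; apply: injective_projections.
- by move=> v; rewrite facet_tr_pair; split=> [[/aL ? /bM ?]|[/aL-> /bM->]].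
- move=> v tr_v; split.
    apply: aLv; have := mem_morphim (fst_morphism aT bT) (in_setT _) tr_v.
    by rewrite morphim_gen_fst !imsetU !imset_set1 facet_tr_pair.
  apply: bMv; have := mem_morphim (snd_morphism aT bT) (in_setT _) tr_v.
  by rewrite morphim_gen_snd !imsetU !imset_set1 facet_tr_pair.
Qed.

Lemma card_ker_snd (N : {group aT * bT}) :
  N \subset 'ker (snd_morphism aT bT) -> #|fst @* N| = #|N|.
Proof.
move=> /subsetP kerN; rewrite morphimEsub ?subsetT // card_in_imset // => g h gN hN gh1.
by apply: injective_projections gh1 _; rewrite !(mker (kerN _ _)).
Qed.

Section SimpleFactor.
Variables (A : {group aT}) (B : {group bT}).
Hypotheses (simpleA : simple A) (ndvd_AB : ~~ (#|A| %| #|B|)%N).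

Lemma goursat_simple (G : {group aT * bT}) :
  fst @* G = A -> snd @* G = B -> G = setX A B :> {set _}.
Proof.
move=> fstG sndG; pose N := (G :&: 'ker (snd_morphism aT bT))%G.
have cardG : #|G| = (#|N| * #|B|)%N.
  rewrite -(Lagrange (subsetIl G ('ker (snd_morphism aT bT)))) -sndG card_morphim.
  by rewrite setTI indexgI.
have nNA : fst @* N <| A.
  by rewrite -fstG morphim_normal // (normalGI (subsetT G)) ?ker_normal.
have subX : G \subset setX A B.
  apply/subsetP=> g gG; rewrite inE -fstG -sndG.
  by rewrite !(mem_morphim _ (in_setT g) gG).
have [_ /(_ _ nNA)[N1|NA]] := simpleP _ simpleA.
  case/negP: ndvd_AB; have <- : #|G| = #|B|.
    by rewrite cardG -card_ker_snd ?subsetIr // N1 cards1 mul1n.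
  by rewrite -fstG dvdn_morphim.
by apply/eqP; rewrite eqEcard subX cardsX cardG -card_ker_snd ?subsetIr // NA /=.
Qed.

Lemma fst_normal_trivial (N : {group aT * bT}) :
  N <| setX A B -> (#|N| %| #|B|)%N -> fst @* N = 1.
Proof.
move=> nN dvdN; have nNA : fst @* N <| A.
  by rewrite -(morphim_fstX A B) morphim_normal.
have [_ /(_ _ nNA)[//|NA]] := simpleP _ simpleA.
by case/negP: ndvd_AB; rewrite -NA (dvdn_trans (dvdn_morphim _ _)).
Qed.

Lemma simple_cofactor_stable (alpha : {morphism setX A B >-> aT * bT}) y :
  alpha @* setX A B = setX A B -> y \in B -> (alpha (1, y)).1 = 1.
Proof.
move=> alpha_im yB; have nB : setX 1 B <| setX A B.
  by have /dprod_normal2[] := setX_dprod A B.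
have nN : alpha @* setX 1 B <| setX A B.
  by rewrite -[X in _ <| X]alpha_im morphim_normal.
have im1 : fst @* (alpha @* setX 1 B) = 1.
  rewrite fst_normal_trivial // (dvdn_trans (dvdn_morphim _ _)) //.
  by rewrite cardsX cards1 mul1n.
suff: (alpha (1, y)).1 \in fst @* (alpha @* setX 1 B) by rewrite im1 => /set1P.
apply: (mem_morphim (fst_morphism aT bT)); rewrite ?in_setT //.
by apply: mem_morphim; apply/setXP; rewrite !group1.
Qed.

End SimpleFactor.

Variables (s1 s2 s3 d : aT) (t1 t2 t3 e : bT) (L M : point -> Prop).
Hypotheses (rotL : rotation_system s1 s2 s3 d L) (rotM : rotation_system t1 t2 t3 e M).
Local Notation A := <<[set s1; s2; s3]>>.
Local Notation B := <<[set t1; t2; t3]>>.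
Hypotheses (simpleA : simple A) (ndvd_AB : ~~ (#|A| %| #|B|)%N).

Lemma gen_rotation_pairs :
  <<[set ((s1, t1) : aT * bT); (s2, t2); (s3, t3)]>> = setX A B.
Proof.
apply: (goursat_simple (G := <<_>>%G) simpleA ndvd_AB).
  by rewrite morphim_gen_fst !imsetU !imset_set1.
by rewrite morphim_gen_snd !imsetU !imset_set1.
Qed.

Theorem rotation_product_polytope (v : point) :
    faithful_rotations s2^-1 (unit_shift s1 s2) -> ~ L (1, 0)%R ->
    L v -> ~ L (- v.1 - v.2, v.2)%R ->
  exists P : polytope 4,
    [/\ chiral P, properly_self_dual P, Gamma P \isog setX A B
      & forall u, (forall w, L w /\ M w <-> in_lattice u w) ->
          has_type P (@map36 u) (@map63 u)].
Proof.
move=> faithful L_unit Lv L_mirror; rewrite -gen_rotation_pairs.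
apply: (rotation_system_polytope (rotation_system_pair rotL rotM)).
- exact: faithful_rotations_pair.
- by case.
rewrite gen_rotation_pairs => alpha alpha_im; exists v; rewrite !facet_tr_pair.
have [t1B t2B] : t1 \in B /\ t2 \in B by split; rewrite mem_gen // !inE eqxx ?orbT.
have tr_B : facet_tr t1 t2 v \in B.
  by apply: hex_tr_mem; rewrite ?groupV // !groupM ?groupX.
have := simple_cofactor_stable simpleA ndvd_AB alpha_im tr_B.
by have /(rot_tr rotL)-> := Lv => + alphaE; rewrite alphaE /= => /(rot_tr rotL).
Qed.

End DirectProducts.

Local Close Scope group_scope.

Lemma simple_PSL2 (p : nat) : prime p -> (5 < p)%N -> simple (PSL2 p).
Proof.
move=> p_pr p_gt5; apply: (@simple_PSL2_over 'F_p); last by rewrite card_Fp.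
rewrite -(dvdn_pcharf (pchar_Fp p_pr)); apply/negP=> /dvdn_leq.
by move: p_gt5; clear; lia.
Qed.

Lemma ndvd_card_Gamma_plus (n p : nat) (Q : polytope n) (Phi : {set Q}) :
    prime p -> directly_regular Phi -> ~~ (p * (p ^ 2 - 1) %| #|Gamma Q|)%N ->
  ~~ (#|PSL2 p| %| #|Gamma_plus Phi|)%N.
Proof.
move=> p_pr [_ index2]; apply: contra => dvd_plus.
rewrite -(Lagrange (Gamma_plus_sub Phi)) index2 (mulnC _ 2).
have := dvdn_card_PSL2_over 'F_p; rewrite card_Fp // => /dvdn_trans; apply.
by rewrite dvdn_pmul2l.
Qed.

Theorem theorem8p2 (p b c : nat) (m : int) (Q : polytope 4) (Phi : {set Q})
    (p_prime : prime p) (p_mod12 : p = 1 %[mod 12])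
    (b_gt0 : (0 < b)%N) (c_gt0 : (0 < c)%N)
    (p_eq : p = (b ^ 2 + b * c + c ^ 2)%N)
    (m_odd : ~~ (2 %| m)%Z) (m_not3 : ~~ (3 %| m)%Z)
    (Phi_flag : flag Phi)
    (Q_self_dual : self_dual Q)
    (Q_directly_regular : directly_regular Phi)
    (Q_type : has_type Q (@map36 (m, 0)) (@map63 (m, 0)))
    (Q_order : ~~ (p * (p ^ 2 - 1) %| #|Gamma Q|)%N) :
  exists P : polytope 4,
    [/\ chiral P,
        properly_self_dual P,
        Gamma P \isog setX (PSL2 p) (Gamma_plus Phi),
        ((p%:Z %| m)%Z -> has_type P (@map36 (m, 0)) (@map63 (m, 0)))
      & (~~ (p%:Z %| m)%Z ->
           has_type P (@map36 (m * b%:Z, m * c%:Z)) (@map63 (m * b%:Z, m * c%:Z)))].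
Proof.
have [[regQ _] [facetsQ _]] := (Q_directly_regular, Q_type).
have p_gt12 : (12 < p)%N by move: p_mod12 (prime_gt1 p_prime); clear; lia.
have ndvd_p3 : ~~ (p %| 3)%N by apply/negP=> /dvdn_leq; move: p_gt12; clear; lia.
have [e rotQ] := regular_rotation_system Phi_flag regQ Q_self_dual facetsQ.
have [s1 [s2 [s3 [d [rotL genL faithfulL]]]]] :=
  PSL2_rotation_system p_prime p_mod12 b_gt0 c_gt0 p_eq.
have simpleL := simple_PSL2 p_prime (ltn_trans (isT : 5 < 12)%N p_gt12).
have ndvd_card := ndvd_card_Gamma_plus p_prime Q_directly_regular Q_order.
rewrite Gamma_plus_sigma -genL in simpleL ndvd_card *.
have [P [chiralP dualP GammaP typeP]] := rotation_product_polytope rotL rotQ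
  simpleL ndvd_card faithfulL (lattice_prime_unit p_prime b_gt0 c_gt0 p_eq)
  (lattice_prime_generator p_prime b_gt0 c_gt0 p_eq)
  (lattice_prime_mirror p_prime b_gt0 c_gt0 p_eq ndvd_p3).
exists P; split=> // p_m; apply: typeP => v.
  exact: (lattice_prime_cap_dvd p_prime b_gt0 c_gt0 p_eq).
exact: (lattice_prime_cap_ndvd p_prime b_gt0 c_gt0 p_eq).
Qed.
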